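(* Fix $E\in\mathbb R$. For each $n$, let $J_n$ be an $n\times n$ random Jacobi matrix with diagonal entries $a_1,\dots,a_n$ and subdiagonal entries $b_1,\dots,b_{n-1}$ (the entries may depend on $n$), where for each $n$ the random variables $a_1,\dots,a_n,b_1,\dots,b_{n-1}$ are independent and $b_i>0$. Let $\lambda_1,\dots,\lambda_n$ be the eigenvalues of $J_n$ and $\xi_n=\sum_{j=1}^n\delta_{n(\lambda_j-E)}$. Assume that the following conditions hold, with all constants independent of $n$: (A) each $a_i$ has a probability density $\rho_i$, and $\|\rho_i\|_\infty\le M_A$ for $i=1,\dots,n$; (B) for some $T>1$, $\mathbb E[b_i^T]\le M_B$ for $i=1,\dots,n-1$; (G) for some $0<s<1$ there are positive constants $M_s,\gamma_s,\delta_s$ such that $$\mathbb E\big[|G_{[u,v]}(z;y,x)|^s\big]\le M_se^{-\gamma_s|y-x|}\quad\text{for } y\in\{u,v\},\ x\in[u,v],$$ for all $z\in\mathbb C$ with $\operatorname{Im}z>0$ and $|z-E|<\delta_s$, and all $1\le u<v\le n$; (L) there is a constant $\theta>0$ such that $\mathbb E[\xi_n(I)]\to\theta|I|$ as $n\to\infty$ for all bounded intervals $I$. Then $\xi_n$ converges weakly, as $n\to\infty$, to a homogeneous Poisson point process on $\mathbb R$ with intensity $\theta$.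
   Context: A Jacobi matrix is a symmetric tridiagonal matrix with positive subdiagonal entries. For integers $u\le v$, $[u,v]=\{u,u+1,\dots,v\}$; $J_n^{[u,v]}=(J_n(i,j))_{i,j\in[u,v]}$ is the restriction of $J_n$; $G_{[u,v]}(z)=(J_n^{[u,v]}-z)^{-1}$ is its Green's function (resolvent), with entries $G_{[u,v]}(z;y,x)$, $y,x\in[u,v]$. A point process on $\mathbb R$ is a random integer-valued Radon measure; the space of such measures carries the vague topology, and weak convergence $\xi_n\to\xi$ means $\mathbb E[\Phi(\xi_n)]\to\mathbb E[\Phi(\xi)]$ for all bounded continuous $\Phi$ on this space; equivalently $\mathbb E[e^{-\xi_n(\varphi)}]\to\mathbb E[e^{-\xi(\varphi)}]$ for all nonnegative continuous compactly supported $\varphi$. A homogeneous Poisson point process with intensity $\theta$ is a Poisson point process with intensity measure $\theta\,dx$. *)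

(* Defs.v *)
From HB Require Import structures.
From mathcomp Require Import all_boot all_order all_algebra.
From mathcomp Require Import all_classical all_reals all_analysis.
From mathcomp Require Import measurable_realfun complex.

Set Implicit Arguments.
Unset Strict Implicit.
Unset Printing Implicit Defensive.

Import Order.TTheory GRing.Theory Num.Theory.
Import numFieldNormedType.Exports.

Local Open Scope classical_set_scope.
Local Open Scope ring_scope.

Section JacobiMatrices.
Context {R : rcfType}.

(* Indices are 0-based: b k sits at positions (k, k+1) and (k+1, k); the default
   0 of oapp is never reached. *)
Definition jacobi n (a : 'I_n -> R) (b : 'I_n.-1 -> R) : 'M[R]_n :=
  \matrix_(i, j)
    if i == j then a i
    else if (i.+1 == j :> nat) || (j.+1 == i :> nat)
    then oapp b 0 (insub (minn i j)) else 0.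

(* The k-th element u + k of [u, v]; when u <= v the default u of insubd is
   never used. *)
Definition window n (u v : 'I_n) (k : 'I_(v - u).+1) : 'I_n :=
  insubd u (u + k)%N.

Definition restrict n (A : 'M[R]_n) (u v : 'I_n) : 'M[R]_((v - u).+1) :=
  mxsub (@window n u v) (@window n u v) A.

(* The entry G_[u,v](z; y, x); y and x are positions in the full matrix,
   meaningful for u <= y, x <= v. *)
Definition green n (A : 'M[R]_n) (u v : 'I_n) (z : R[i]) (y x : 'I_n) : R[i] :=
  invmx (map_mx (real_complex R) (restrict A u v) - z%:M)
    (inord (y - u)) (inord (x - u)).

(* Eigenvalues listed with algebraic multiplicity. *)
Definition eigenvalues_of n (A : 'M[R]_n) (s : seq R) : Prop :=
  char_poly A = \prod_(x <- s) ('X - x%:P).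

End JacobiMatrices.

Section Independence.
Context {d d' : measure_display} {T : measurableType d} {T' : measurableType d'}
  {R : realType}.
Local Open Scope ereal_scope.

Definition independent (P : probability T R) (I : finType) (X : I -> T -> T')
    : Prop :=
  forall (K : {set I}) (B : I -> set T'),
    (forall i, i \in K -> measurable (B i)) ->
    P (\bigcap_(i in [set` K]) X i @^-1` B i) =
    \prod_(i in K) P (X i @^-1` B i).

End Independence.

Definition has_density {d} {T : measurableType d} {R : realType}
    (P : probability T R) (X : T -> R) (rho : R -> R) : Prop :=
  [/\ measurable_fun [set: R] rho,
      forall x, 0 <= rho x &
      forall B : set R, measurable B ->
        P (X @^-1` B) = (\int[lebesgue_measure]_(x in B) (rho x)%:E)%E].

Section PointMeasures.
Variable R : realType.

Record point_measure := PointMeasure {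
  pm_val :> {measure set (measurableTypeR R) -> \bar R} ;
  pm_radon : forall K : set R, compact K -> (pm_val K < +oo)%E ;
  pm_nat : forall A : set R, measurable A -> (pm_val A < +oo)%E ->
    exists k : nat, pm_val A = k%:R%:E }.

Definition test_function :=
  {phi : R -> R | continuous phi & compact (closure [set x | phi x != 0])}.

Definition test_fun (phi : test_function) : R -> R := s2val phi.

Definition vague_map (mu : point_measure) : {ptws test_function -> R} :=
  fun phi => \int[mu]_x test_fun phi x.

HB.instance Definition _ := gen_eqMixin point_measure.
HB.instance Definition _ := gen_choiceMixin point_measure.
(* the vague topology: the coarsest one making every mu |-> mu(phi) continuous *)
HB.instance Definition _ :=
  Topological.copy point_measure (initial_topology vague_map).

Section Atoms.
Variable s : seq R.

Definition atoms : {measure set (measurableTypeR R) -> \bar R} :=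
  msum (fun j => \d_(nth 0 s j : measurableTypeR R)) (size s).

Lemma atomsE A : atoms A = (\sum_(x <- s) \d_x A)%E.
Proof. by rewrite (big_nth 0) big_mkord. Qed.

Lemma atoms_nat A : exists k : nat, atoms A = k%:R%:E.
Proof.
rewrite atomsE; elim: s => [|x t [k IH]]; first by exists 0%N; rewrite big_nil.
exists ((x \in A) + k)%N; rewrite big_cons IH diracE natrD EFinD.
by case: (x \in A).
Qed.

Lemma atoms_fin A : (atoms A < +oo)%E.
Proof. by have [k ->] := atoms_nat A; rewrite ltry. Qed.

Definition atomic_measure : point_measure :=
  @PointMeasure atoms (fun K _ => atoms_fin K) (fun A _ _ => atoms_nat A).

End Atoms.
End PointMeasures.

Section PointProcesses.
Context {R : realType}.

Definition rescaled_process (E : R) (n : nat) (lambda : seq R) :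
    point_measure R :=
  atomic_measure [seq n%:R * (x - E) | x <- lambda].

Definition point_process {d} {T : measurableType d}
    (xi : T -> point_measure R) : Prop :=
  forall A : set (measurableTypeR R), measurable A ->
    measurable_fun [set: T] (fun w => xi w A).

(* The second argument of poisson_prob is a dummy in its definition.  At rate 0
   poisson_prob is the Dirac mass at 0. *)
Definition poisson_process {d} {T : measurableType d} (P : probability T R)
    (xi : T -> point_measure R) (nu : set R -> \bar R) : Prop :=
  [/\ point_process xi,
      forall A : set (measurableTypeR R), measurable A -> (nu A < +oo)%E ->
        forall k : nat,
          P [set w | xi w A = k%:R%:E] = poisson_prob (fine (nu A)) 0 [set k] &
      forall (m : nat) (A : 'I_m -> set (measurableTypeR R)),
        (forall i, measurable (A i) /\ (nu (A i) < +oo)%E) ->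
        trivIset [set: 'I_m] A ->
        independent P (fun i w => xi w (A i))].

Definition homogeneous_poisson_process {d} {T : measurableType d}
    (P : probability T R) (xi : T -> point_measure R) (theta : R) : Prop :=
  poisson_process P xi (fun A => theta%:E * lebesgue_measure A)%E.

Definition weak_cvg (d : nat -> measure_display)
    (T : forall n, measurableType (d n)) (P : forall n, probability (T n) R)
    (xi : forall n, T n -> point_measure R)
    d' (T' : measurableType d') (Q : probability T' R)
    (eta : T' -> point_measure R) : Prop :=
  forall Phi : point_measure R -> R,
    continuous Phi -> (exists M : R, forall mu, `|Phi mu| <= M) ->
    'E_(P n)[Phi \o xi n]%E @[n --> \oo] --> 'E_Q[Phi \o eta]%E.

End PointProcesses.

(* Main.v *)
Require Import Defs.
From HB Require Import structures.
From mathcomp Require Import all_boot all_order all_algebra.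
From mathcomp Require Import all_classical all_reals all_analysis.
From mathcomp Require Import measurable_realfun complex ess_sup_inf zify ring lra.

(** Up to a small error in mean, the rescaled eigenvalues are a superposition of
    many independent point processes, each of which rarely has a point in a given
    bounded set; such a superposition is close to a Poisson process.

    Let G = (J - z)^-1, and call h / ((x - t)^2 + h^2) the kernel of centre t and
    height h. Its sum over the rescaled eigenvalues is the trace of Im G, divided
    by n, at the point z = E + (t + i h) / n ([linstat_kernel]). Statistics at the
    scale of the eigenvalue spacing are thus controlled by single entries of
    resolvents.

    _Wegner and Minami estimates._ As a function of the diagonal entry a_x of J,
    Im G(x, x) is a kernel whose centre and height do not involve a_x
    ([resolvent_diag_shift]); averaging over a_x bounds its mean by pi M_A
    ([wegner]). Sums over pairs of distinct eigenvalues are sums of 2 x 2 minors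
    of Im G. Such a minor is at most Im G(x, x) Im G'(y, y), where G' is the
    resolvent after site x has been decoupled ([minami_pair]); averaging over
    a_x, then over a_y, bounds its mean by (pi M_A)^2 ([minami]). For a diagonal
    block with n / m sites and a fixed bounded set, the mean number of points is
    then O(1 / m) and the mean number of ordered pairs of points O(1 / m^2).

    _Decoupling._ Cutting J into m diagonal blocks changes G(x, x) by products of
    a Green function entry of the block, between x and an end of the block, and a
    removed bond ([resolvent_restrict]). By the decay of the Green functions this is small
    in mean unless x is within n / m^2 sites of an end, and there Wegner's
    estimate applies ([block_error]). So the sum of a kernel over the eigenvalues
    differs in mean by O(1 / m), as n grows, from its sum over the eigenvalues of
    the blocks ([block_gap_kernel]). The indicator of an interval is a combination
    of kernels up to a combination of small total weight
    ([indicator_comb_approx]), which gives the same comparison for numbers of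
    eigenvalues in intervals ([union_gap]).

    _Avoidance probabilities._ The blocks are independent, so the probability that
    a finite union V of intervals is empty is close to the product of the 1 - q_p,
    q_p being the probability that block p has a point in V; this product is close
    to exp (- \sum q_p), and by Minami's estimate \sum q_p is close to the mean
    number of points in V ([avoidance_estimate]), which is assumed to tend to
    theta |V|.

    _Weak convergence._ By inclusion-exclusion, the avoidance probabilities
    determine the limit law of the set of occupied cells of a grid
    ([pattern_cvg]). On a grid of mesh k^-3 over [-k, k), the probability that
    some cell holds two points is O(1 / k^2) in the limit, so that the occupied
    cells determine all the counts up to an event of small probability. A vaguely
    continuous function Phi is at each measure nearly determined by the counts in
    a fine grid ([grid_continuous]); hence its infimum given the counts tends to
    it in mean, and yields the lower bound E Phi(eta) for the lower limit of
    E Phi(xi_n) ([mean_lower_semicontinuous]). Applied to Phi + M and to M - Phi,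
    where M bounds |Phi|, this gives the convergence ([grid_weak_cvg]). *)

Set Implicit Arguments.
Unset Strict Implicit.
Unset Printing Implicit Defensive.

Import Order.TTheory GRing.Theory Num.Theory.
Import numFieldNormedType.Exports.

Local Open Scope classical_set_scope.
Local Open Scope ring_scope.

Local Open Scope complex_scope.

(** * Resolvents of real symmetric matrices *)

Section Resolvent.
Context {R : rcfType}.
Implicit Types (n : nat) (z w : R[i]) (t h x : R).

Definition cauchy_kernel t h x : R := h / ((x - t) ^+ 2 + h ^+ 2).

Definition resolvent n (A : 'M[R]_n) z : 'M[R[i]]_n :=
  invmx (map_mx (real_complex R) A - z%:M).

Lemma sqr_shift_gt0 t h x : 0 < h -> 0 < (x - t) ^+ 2 + h ^+ 2.
Proof. by move=> h0; rewrite ltr_wpDl ?sqr_ge0 ?exprn_gt0. Qed.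

Lemma cauchy_kernel_gt0 t h x : 0 < h -> 0 < cauchy_kernel t h x.
Proof. by move=> h0; rewrite divr_gt0 ?sqr_shift_gt0. Qed.

Lemma Im_real_sub_inv x z : 0 < complex.Im z ->
  complex.Im ((x%:C - z)^-1) = cauchy_kernel (complex.Re z) (complex.Im z) x.
Proof.
case: z => t h /= h0; rewrite /cauchy_kernel sub0r sqrrN /= mulNr opprK.
by rewrite mulrC.
Qed.

(** A real symmetric matrix is Hermitian over R[i], so the spectral theorem for
    normal matrices applies, with real eigenvalues. *)
Lemma spectral_symmetric n (A : 'M[R]_n) : A^T = A ->
  exists U : 'M[R[i]]_n, exists d : 'rV[R]_n,
    U \in unitmx /\
    map_mx (real_complex R) A =
      invmx U *m diag_mx (map_mx (real_complex R) d) *m U.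
Proof.
move=> Asym; pose B := map_mx (real_complex R) A.
have Bs : B \is symmetricmx.
  by apply/is_hermitianmxP; rewrite expr0 scale1r map_mx_id // /B map_trmx Asym.
have Br : B \is a mxOver Num.real.
  by apply/mxOverP => i j; rewrite mxE; apply/complex_realP; exists (A i j).
have Bh := realsym_hermsym Bs Br.
have /hermitian_normalmx /orthomx_spectralP Beq := Bh.
have dr := hermitian_spectral_diag_real Bh.
exists (spectralmx B); exists (map_mx (@complex.Re R) (spectral_diag B)).
split; first exact: spectral_unit.
rewrite -map_mx_comp [X in diag_mx X](_ : _ = spectral_diag B) //.
apply/matrixP => i j; rewrite mxE /=; apply: RRe_real.
by move/mxOverP: dr; apply.
Qed.

Lemma diag_inv_mx n (e : 'rV[R[i]]_n) : (forall i, e 0 i != 0) ->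
  diag_mx e \in unitmx /\ invmx (diag_mx e) = diag_mx (\row_i (e 0 i)^-1).
Proof.
move=> e0; pose f : 'rV_n := \row_i (e 0 i)^-1.
have ef : diag_mx e *m diag_mx f = 1%:M.
  rewrite mulmx_diag -diag_const_mx; congr diag_mx.
  by apply/rowP => i; rewrite !mxE divff.
have [eu _] := mulmx1_unit ef.
by split => //; rewrite -[LHS]mulmx1 -ef mulKmx.
Qed.

Lemma conj_unitmx_inv n (U B : 'M[R[i]]_n) : U \in unitmx -> B \in unitmx ->
  invmx U *m B *m U \in unitmx /\
  invmx (invmx U *m B *m U) = invmx U *m invmx B *m U.
Proof.
move=> Uu Bu; have E : (invmx U *m B *m U) *m (invmx U *m invmx B *m U) = 1%:M.
  by rewrite -!mulmxA mulKVmx // mulKVmx // mulVmx.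
have [MU _] := mulmx1_unit E; split => //.
by rewrite -[LHS]mulmx1 -E mulKmx.
Qed.

Lemma real_sub_neq0 x z : complex.Im z != 0 -> x%:C - z != 0.
Proof.
case: z => a b /= b0; rewrite eq_complex /= negb_and sub0r oppr_eq0 b0.
by rewrite orbT.
Qed.

Lemma resolvent_spectral n (A : 'M[R]_n) U (d : 'rV[R]_n) z :
  complex.Im z != 0 -> U \in unitmx ->
  map_mx (real_complex R) A =
      invmx U *m diag_mx (map_mx (real_complex R) d) *m U ->
  map_mx (real_complex R) A - z%:M \in unitmx /\
  resolvent A z = invmx U *m diag_mx (\row_i ((d 0 i)%:C - z)^-1) *m U.
Proof.
move=> z0 Uu AE; rewrite /resolvent.
have -> : map_mx (real_complex R) A - z%:M =
    invmx U *m diag_mx (\row_i ((d 0 i)%:C - z)) *m U.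
  rewrite AE (_ : z%:M = invmx U *m z%:M *m U); last first.
    by rewrite mul_mx_scalar -scalemxAl mulVmx // scalemx1.
  have -> : diag_mx (\row_i ((d 0 i)%:C - z)) =
      diag_mx (map_mx (real_complex R) d) - z%:M.
    by apply/matrixP => i j; rewrite !mxE mulrnBl.
  by rewrite mulmxBr mulmxBl.
have [|Du DE] := @diag_inv_mx _ (\row_i ((d 0 i)%:C - z)).
  by move=> i; rewrite mxE real_sub_neq0.
have [Mu ME] := conj_unitmx_inv Uu Du; split; first exact: Mu.
have rE : \row_i ((d 0 i)%:C - z)^-1 =
    \row_i ((\row_i ((d 0 i)%:C - z)) 0 i)^-1 :> 'rV_n.
  by apply/rowP => i; rewrite !mxE.
by apply: (etrans ME); congr (_ *m _ *m _); apply: (etrans DE); rewrite -rE.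
Qed.

Lemma resolvent_unit n (A : 'M[R]_n) z : A^T = A -> complex.Im z != 0 ->
  map_mx (real_complex R) A - z%:M \in unitmx.
Proof.
by move=> /spectral_symmetric [U [d [Uu AE]]] z0; have [] := resolvent_spectral z0 Uu AE.
Qed.

Lemma resolvent_sym n (A : 'M[R]_n) z i j : A^T = A ->
  resolvent A z i j = resolvent A z j i.
Proof.
move=> As; rewrite -[in RHS](trmxK (resolvent A z)) [in RHS]mxE.
by rewrite /resolvent trmx_inv raddfB /= map_trmx As tr_scalar_mx.
Qed.

Lemma resolvent_conj n (A : 'M[R]_n) z :
  map_mx conjc (resolvent A z) = resolvent A (conjc z).
Proof.
rewrite /resolvent map_invmx map_mxB map_scalar_mx /=; congr (invmx (_ - _)).
by apply/matrixP => i j; rewrite !mxE; exact: conjc_real.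
Qed.

Lemma eigenvalues_spectral n (A : 'M[R]_n) U (d : 'rV[R]_n) :
  U \in unitmx ->
  map_mx (real_complex R) A =
      invmx U *m diag_mx (map_mx (real_complex R) d) *m U ->
  eigenvalues_of A [seq d 0 i | i : 'I_n].
Proof.
move=> Uu AE; rewrite /eigenvalues_of.
apply: (@map_poly_inj _ _ (real_complex R)); rewrite map_char_poly AE.
rewrite /char_poly /char_poly_mx.
have PU : map_mx polyC U \in unitmx by rewrite map_unitmx.
rewrite !map_mxM /= map_invmx.
rewrite (_ : 'X%:M = invmx (map_mx polyC U) *m 'X%:M *m map_mx polyC U); last first.
  by rewrite mul_mx_scalar -scalemxAl mulVmx // scalemx1.
rewrite -mulmxBl -mulmxBr !det_mulmx mulrAC -det_mulmx mulVmx // det1 mul1r.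
rewrite big_map big_enum /= rmorph_prod /=.
rewrite (_ : _ - _ = diag_mx (\row_i ('X - ((d 0 i)%:C)%:P))); last first.
  apply/matrixP => i j; rewrite !mxE; case: eqP => [->|_]; rewrite ?mulr1n ?mulr0n ?polyC0 ?subr0 //.
rewrite det_diag; apply: eq_bigr => i _.
by rewrite mxE rmorphB /= map_polyX map_polyC.
Qed.

Lemma eigenvalues_exist n (A : 'M[R]_n) : A^T = A ->
  exists s : seq R, eigenvalues_of A s.
Proof.
move=> /spectral_symmetric [U [d [Uu AE]]].
by exists [seq d 0 i | i : 'I_n]; apply: eigenvalues_spectral Uu AE.
Qed.

Lemma sum_eigenvalues n (A : 'M[R]_n) U (d : 'rV[R]_n) s (f : R -> R) :
  U \in unitmx ->
  map_mx (real_complex R) A =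
      invmx U *m diag_mx (map_mx (real_complex R) d) *m U ->
  eigenvalues_of A s -> \sum_(x <- s) f x = \sum_i f (d 0 i).
Proof.
move=> Uu AE sE; have := eigenvalues_spectral Uu AE.
rewrite /eigenvalues_of sE => /prod_XsubC_eq/(perm_big _) ->.
by rewrite big_map big_enum.
Qed.

Lemma Im_conjc (w : R[i]) : (complex.Im w)%:C = (2%:R^-1 * 'i) * (conjc w - w).
Proof. by rewrite ImJ_sub -mulrA mulrC. Qed.

Lemma scale_conj_diag_sub (F : comPzRingType) n (c : F) (V U : 'M[F]_n)
    (p q r : 'rV[F]_n) : (forall i, r 0 i = c * (p 0 i - q 0 i)) ->
  c *: (V *m diag_mx p *m U - V *m diag_mx q *m U) = V *m diag_mx r *m U.
Proof.
move=> rE; rewrite -mulmxBl -mulmxBr scalemxAl scalemxAr; congr (_ *m _ *m _).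
by apply/matrixP => i j; rewrite !mxE rE -mulrnBl mulrnAr.
Qed.

(** Entrywise imaginary part is (G - conj G) / 2i, and conj G is the resolvent at
    the conjugate point; both are diagonal in the same basis. *)
Lemma Im_resolvent_spectral n (A : 'M[R]_n) U (d : 'rV[R]_n) z :
  0 < complex.Im z -> U \in unitmx ->
  map_mx (real_complex R) A =
      invmx U *m diag_mx (map_mx (real_complex R) d) *m U ->
  map_mx (fun w => (complex.Im w)%:C) (resolvent A z) =
  invmx U *m diag_mx (\row_i (cauchy_kernel (complex.Re z) (complex.Im z) (d 0 i))%:C)
    *m U.
Proof.
move=> z0 Uu AE.
have zn : complex.Im z != 0 by rewrite gt_eqF.
have [_ G1] := resolvent_spectral zn Uu AE.
have zn' : complex.Im (conjc z) != 0 by case: z zn {z0 G1} => a b /=; rewrite oppr_eq0.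
have [_ G2] := resolvent_spectral zn' Uu AE.
have -> : map_mx (fun w => (complex.Im w)%:C) (resolvent A z) =
   (2%:R^-1 * 'i) *: (map_mx conjc (resolvent A z) - resolvent A z).
  move: (resolvent A z) => G; apply/matrixP => i j.
  by rewrite !mxE; exact: Im_conjc.
rewrite resolvent_conj.
move: (resolvent A z) (resolvent A _) G1 G2 => G G' -> ->.
apply: scale_conj_diag_sub => i.
rewrite !mxE -Im_real_sub_inv // Im_conjc conjc_inv rmorphB /=.
by rewrite oppr0.
Qed.

Lemma trace_resolvent n (A : 'M[R]_n) s z : A^T = A -> 0 < complex.Im z ->
  eigenvalues_of A s ->
  \sum_i complex.Im (resolvent A z i i) =
  \sum_(x <- s) cauchy_kernel (complex.Re z) (complex.Im z) x.
Proof.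
move=> /spectral_symmetric [U [d [Uu AE]]] z0 sE.
rewrite (sum_eigenvalues _ Uu AE sE); apply: complexI; rewrite !rmorph_sum /=.
have /(congr1 mxtrace) := Im_resolvent_spectral z0 Uu AE.
rewrite mxtrace_mulC mulmxA mulmxV // mul1mx mxtrace_diag.
rewrite (eq_bigr (fun i => (cauchy_kernel (complex.Re z) (complex.Im z) (d 0 i))%:C)); last by move=> i _; rewrite mxE.
by move=> <-; apply: eq_bigr => i _; rewrite mxE.
Qed.

(** Trace of the square of the symmetric matrix Im G. *)
Lemma pair_resolvent n (A : 'M[R]_n) s z : A^T = A -> 0 < complex.Im z ->
  eigenvalues_of A s ->
  \sum_i \sum_j complex.Im (resolvent A z i j) ^+ 2 =
  \sum_(x <- s) cauchy_kernel (complex.Re z) (complex.Im z) x ^+ 2.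
Proof.
move=> As; have [U [d [Uu AE]]] := spectral_symmetric As; move=> z0 sE.
rewrite (sum_eigenvalues (fun x => cauchy_kernel _ _ x ^+ 2) Uu AE sE).
apply: complexI; rewrite !rmorph_sum /=.
have B := Im_resolvent_spectral z0 Uu AE.
have /(congr1 mxtrace) := congr2 mulmx B B.
rewrite [in RHS]mxtrace_mulC -!mulmxA mulKVmx // [in RHS]mxtrace_mulC.
rewrite -!mulmxA mulmxV // mulmx1 mulmx_diag mxtrace_diag.
under [RHS]eq_bigr do rewrite !mxE -rmorphM /= -expr2.
move=> <-; apply: eq_bigr => i _; rewrite mxE rmorph_sum; apply: eq_bigr => j _.
by rewrite !mxE (resolvent_sym _ j i As) -rmorphM expr2.
Qed.

Definition nsq (w : R[i]) : R := complex.Re w ^+ 2 + complex.Im w ^+ 2.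

Lemma nsqE w : (nsq w)%:C = w * conjc w.
Proof.
case: w => a b; apply/eqP; rewrite eq_complex /nsq /=; apply/andP; split.
  by apply/eqP; ring.
by apply/eqP; ring.
Qed.

Lemma nsq_ge0 w : 0 <= nsq w.
Proof. by rewrite addr_ge0 ?sqr_ge0. Qed.

Lemma nsq_eq0 w : (nsq w == 0) = (w == 0).
Proof.
by case: w => a b; rewrite /nsq eq_complex /= paddr_eq0 ?sqr_ge0 // !sqrf_eq0.
Qed.

Lemma normc_sqr w : Normc.normc w ^+ 2 = nsq w.
Proof. by case: w => a b; rewrite sqr_sqrtr // addr_ge0 ?sqr_ge0. Qed.

Lemma normc_ge0 w : 0 <= Normc.normc w.
Proof. by case: w => a b; exact: sqrtr_ge0. Qed.

Lemma Im_le_normc w : `|complex.Im w| <= Normc.normc w.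
Proof.
rewrite -[leRHS](ger0_norm (normc_ge0 w)) -ler_sqr ?nnegrE ?normr_ge0 //.
by rewrite !real_normK ?num_real // normc_sqr lerDr sqr_ge0.
Qed.

Lemma subcJ' (w : R[i]) : w - conjc w = (2%:R * 'i) * (complex.Im w)%:C.
Proof. by rewrite subcJ mulrAC. Qed.

Lemma two_i_neq0 : 2%:R * 'i != 0 :> R[i].
Proof. by rewrite mulf_neq0 ?pnatr_eq0 // eq_complex /= oner_eq0 andbF. Qed.

Lemma resolvent_mulV n (A : 'M[R]_n) z : A^T = A -> complex.Im z != 0 ->
  resolvent A z *m (map_mx (real_complex R) A - z%:M) = 1%:M.
Proof. by move=> As z0; rewrite mulVmx // resolvent_unit. Qed.

Lemma resolvent_Vmul n (A : 'M[R]_n) z : A^T = A -> complex.Im z != 0 ->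
  (map_mx (real_complex R) A - z%:M) *m resolvent A z = 1%:M.
Proof. by move=> As z0; rewrite mulmxV // resolvent_unit. Qed.

Lemma Im_conj_neq0 z : complex.Im z != 0 -> complex.Im (conjc z) != 0.
Proof. by case: z => a b /=; rewrite oppr_eq0. Qed.

Lemma resolvent_sub_conj n (A : 'M[R]_n) z : A^T = A -> complex.Im z != 0 ->
  resolvent A z - resolvent A (conjc z) =
  (z - conjc z) *: (resolvent A z *m resolvent A (conjc z)).
Proof.
move=> As z0.
have h1 := resolvent_mulV As z0.
have h2 := resolvent_Vmul As (Im_conj_neq0 z0).
set M := map_mx _ _ in h1 h2.
move: (resolvent A (conjc z)) h2 => G' h2; move: (resolvent A z) h1 => G h1.
rewrite scalemxAl -mul_mx_scalar.
have -> : (z - conjc z)%:M = (M - (conjc z)%:M) - (M - z%:M).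
  by rewrite raddfB /= opprB [RHS]addrC addrA subrK.
by rewrite mulmxBr mulmxBl h1 mul1mx -mulmxA h2 mulmx1.
Qed.

(** The Ward identity: the diagonal of G - G^* = 2 i (Im z) G G^*. *)
Lemma Im_resolvent_diag n (A : 'M[R]_n) z i : A^T = A -> complex.Im z != 0 ->
  complex.Im (resolvent A z i i) =
  complex.Im z * \sum_j nsq (resolvent A z i j).
Proof.
move=> As z0; apply: complexI; apply: (mulfI two_i_neq0).
rewrite rmorphM rmorph_sum /= mulrA -!subcJ'.
have := resolvent_sub_conj As z0; rewrite -resolvent_conj => /matrixP/(_ i i).
set G := resolvent A z; rewrite !mxE => ->; congr (_ * _).
by apply: eq_bigr => j _; rewrite nsqE mxE; congr (_ * conjc _); exact: resolvent_sym.
Qed.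

Lemma resolvent_diag_gt0 n (A : 'M[R]_n) z i : A^T = A -> 0 < complex.Im z ->
  0 < complex.Im (resolvent A z i i).
Proof.
move=> As z0; have zn : complex.Im z != 0 by rewrite gt_eqF.
rewrite Im_resolvent_diag // mulr_gt0 // lt_def sumr_ge0 ?andbT; last first.
  by move=> j _; exact: nsq_ge0.
apply/negP => /eqP /psumr_eq0P H.
have := resolvent_mulV As zn => /matrixP/(_ i i); rewrite !mxE eqxx big1.
  by move/esym/eqP; rewrite oner_eq0.
move=> j _; have /eqP := H (fun j _ => nsq_ge0 _) j isT.
by rewrite nsq_eq0 => /eqP ->; rewrite mul0r.
Qed.

Lemma resolvent_diag_neq0 n (A : 'M[R]_n) z i : A^T = A -> 0 < complex.Im z ->
  resolvent A z i i != 0.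
Proof.
move=> As z0; apply: contraTneq (resolvent_diag_gt0 i As z0) => ->.
by rewrite ltxx.
Qed.

(** The Ward identity bounds |G(i, k)|^2 by Im G(i, i) / Im z, first for k = i. *)
Lemma normc_resolvent_le n (A : 'M[R]_n) z i j : A^T = A -> 0 < complex.Im z ->
  Normc.normc (resolvent A z i j) <= (complex.Im z)^-1.
Proof.
move=> As z0; have zn : complex.Im z != 0 by rewrite gt_eqF.
have h k : nsq (resolvent A z i k) <= (complex.Im z)^-1 * complex.Im (resolvent A z i i).
  rewrite Im_resolvent_diag // mulKf // (bigD1 k) //= lerDl sumr_ge0 // => l _.
  exact: nsq_ge0.
have d : complex.Im (resolvent A z i i) <= (complex.Im z)^-1.
  have p := resolvent_diag_gt0 i As z0; rewrite -(ler_pM2r p).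
  apply: le_trans (h i); rewrite /nsq -expr2 lerDr sqr_ge0 //.
rewrite -ler_sqr ?nnegrE ?normc_ge0 ?invr_ge0 ?(ltW z0) // normc_sqr.
by apply: le_trans (h j) _; rewrite expr2 ler_pM2l // invr_gt0.
Qed.

(** Rank-one perturbation. This makes the dependence of G(i, i) on a single
    diagonal entry explicit. *)
Lemma resolvent_diag_shift n (A : 'M[R]_n) z i c : A^T = A -> 0 < complex.Im z ->
  (resolvent (A + c *: delta_mx i i) z i i)^-1 =
  (resolvent A z i i)^-1 + c%:C.
Proof.
move=> As z0; have zn : complex.Im z != 0 by rewrite gt_eqF.
set B := A + _; have Bs : B^T = B.
  by rewrite /B raddfD /= As linearZ /= trmx_delta.
have E : resolvent A z - resolvent B z =
    c%:C *: (resolvent A z *m delta_mx i i *m resolvent B z).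
  have h1 := resolvent_mulV As zn; have h2 := resolvent_Vmul Bs zn.
  have BE : map_mx (real_complex R) B - z%:M =
     (map_mx (real_complex R) A - z%:M) + c%:C *: delta_mx i i.
    apply/matrixP => k l; rewrite !mxE rmorphD rmorphM /= rmorph_nat.
    by rewrite addrAC.
  rewrite -[X in X - _]mulmx1 -h2 -[X in _ - X]mul1mx -h1 mulmxA -mulmxBl.
  by rewrite BE mulmxDr addrC addKr -scalemxAr -scalemxAl.
have g0 := resolvent_diag_neq0 i As z0; have b0 := resolvent_diag_neq0 i Bs z0.
have : resolvent A z i i - resolvent B z i i =
    c%:C * (resolvent A z i i * resolvent B z i i).
  move/matrixP/(_ i i): E; rewrite 2!mxE => ->; rewrite mxE; congr (_ * _).
  rewrite mxE (bigD1 i) //= big1 ?addr0; last first.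
    move=> k ki; rewrite mxE (bigD1 i) //= big1 ?addr0 ?mxE ?(negbTE ki) ?andbF ?mulr0 ?mul0r //.
    by move=> l li; rewrite mxE (negbTE li) mulr0.
  rewrite mxE (bigD1 i) //= big1 ?addr0 ?mxE ?eqxx ?mulr1 //.
  by move=> l li; rewrite mxE (negbTE li) mulr0.
move: (resolvent A z i i) (resolvent B z i i) g0 b0 => g b g0 b0 E'.
have -> : c%:C = (g - b) / (g * b) by rewrite E' mulfK // mulf_neq0.
by field; rewrite g0 b0.
Qed.
End Resolvent.
(** * Schur complements and pairs of eigenvalues *)

Section Minami.
Context {R : rcfType}.
Implicit Types (n : nat) (z w : R[i]).

(** Decoupling a site without deleting it keeps the size of the matrix. *)
Definition isolate n (A : 'M[R]_n) (x : 'I_n) : 'M[R]_n :=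
  \matrix_(i, j) if (i == x) || (j == x) then 0 else A i j.

Lemma isolate_sym n (A : 'M[R]_n) x : A^T = A -> (isolate A x)^T = isolate A x.
Proof.
move=> As; apply/matrixP => i j; rewrite !mxE orbC.
by have /matrixP/(_ i j) := As; rewrite mxE => ->.
Qed.

Lemma Im_gt0_neq0 z : 0 < complex.Im z -> z != 0.
Proof. by apply: contraTneq => ->; rewrite ltxx. Qed.

Lemma shift_mxE n (A : 'M[R]_n) z i j :
  (map_mx (real_complex R) A - z%:M) i j = (A i j)%:C - z *+ (i == j).
Proof. by rewrite !mxE. Qed.

(** The entries of (A - z) G = 1; with [resolvent_uniq], this replaces
    matrix-inversion formulas by the verification of scalar identities. *)
Lemma resolvent_row n (A : 'M[R]_n) z i j : A^T = A -> complex.Im z != 0 ->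
  \sum_k ((A i k)%:C - z *+ (i == k)) * resolvent A z k j = (i == j)%:R.
Proof.
move=> As z0; have /matrixP/(_ i j) := resolvent_Vmul As z0.
by rewrite [X in X = _ -> _]mxE [X in _ = X -> _]mxE => <-; apply: eq_bigr => k _; rewrite shift_mxE.
Qed.

Lemma resolvent_uniq n (A : 'M[R]_n) z (F : 'I_n -> 'I_n -> R[i]) :
  (forall i j, \sum_k ((A i k)%:C - z *+ (i == k)) * F k j = (i == j)%:R) ->
  forall i j, resolvent A z i j = F i j.
Proof.
move=> H i j; have XE : (map_mx (real_complex R) A - z%:M) *m \matrix_(i, j) F i j = 1%:M.
  apply/matrixP => k l; rewrite mxE [RHS]mxE -H; apply: eq_bigr => m _.
  by rewrite shift_mxE mxE.
have [Mu _] := mulmx1_unit XE.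
by rewrite /resolvent -[invmx _]mulmx1 -XE mulKmx // mxE.
Qed.

(** Schur complement: decoupling site x removes the rank-one part of the
    resolvent that goes through x. *)
Lemma resolvent_isolate n (A : 'M[R]_n) z (x y : 'I_n) : A^T = A -> 0 < complex.Im z ->
  y != x -> resolvent (isolate A x) z y y =
    resolvent A z y y - resolvent A z x y ^+ 2 / resolvent A z x x.
Proof.
move=> As z0 yx; have zn : complex.Im z != 0 by rewrite gt_eqF.
have zz := Im_gt0_neq0 z0.
have h1 := fun i j => resolvent_row i j As zn.
have g0 := resolvent_diag_neq0 x As z0.
have gs := resolvent_sym z y x As.
rewrite expr2 -{1}gs.
move: (resolvent A z) h1 g0 {gs} => G h1 g0.
rewrite (@resolvent_uniq _ _ _ (fun i j => G i j - G i x * G x j / G x x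
      - z^-1 *+ ((i == x) && (j == x)))); first by rewrite (negbTE yx) subr0.
move=> i j /=; have [->|ix] := eqVneq i x.
  rewrite (bigD1 x) //= big1 ?addr0; last first.
    by move=> k kx; rewrite mxE eqxx [x == k]eq_sym (negbTE kx) mulr0n subr0 mul0r.
  rewrite mxE eqxx /= mulrAC divff // mul1r subrr sub0r mulr1n sub0r mulrNN.
  by rewrite mulrnAr divff // eq_sym.
have := h1 i x; have := h1 i j; rewrite (negbTE ix) mulr0n => <- hx.
rewrite -[RHS]subr0 -[X in _ = _ - X](mul0r (G x j / G x x)).
rewrite -[X in _ - X * _]hx mulr_suml -sumrB.
apply: eq_bigr => k _; rewrite mxE (negbTE ix) /=.
have [->|kx] := eqVneq k x; last by rewrite subr0 mulrBr !mulrA.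
by rewrite (negbTE ix) mulr0n subr0 mul0r -mulrA [G x x * _]mulrC divfK // subrr.
Qed.

(** The difference is a square: with w1 = P + i Q and w2 = p + i q, it is
    (Q p - P q)^2 / (P^2 + Q^2). *)
Lemma Im_sqr_div_le w1 w2 : 0 < complex.Im w1 ->
  complex.Im w1 * complex.Im (w2 ^+ 2 / w1) <= complex.Im w2 ^+ 2.
Proof.
case: w1 w2 => P Q [p q] /= Q0.
rewrite expr2 -subr_ge0 /=.
have D : P ^+ 2 + Q ^+ 2 != 0 by rewrite gt_eqF // ltr_wpDl ?sqr_ge0 ?exprn_gt0.
rewrite [leRHS](_ : _ = (Q * p - P * q) ^+ 2 / (P ^+ 2 + Q ^+ 2)).
  by rewrite divr_ge0 ?sqr_ge0 // addr_ge0 ?sqr_ge0.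
by field.
Qed.

(** The left side is the 2 x 2 minor of Im G at x, y. Bounding it by a product in
    which the second factor does not depend on the diagonal entry at x makes the
    two averages successive. *)
Lemma minami_pair n (A : 'M[R]_n) z (x y : 'I_n) : A^T = A -> 0 < complex.Im z ->
  y != x ->
  complex.Im (resolvent A z x x) * complex.Im (resolvent A z y y)
    - complex.Im (resolvent A z x y) ^+ 2 <=
  complex.Im (resolvent A z x x) * complex.Im (resolvent (isolate A x) z y y).
Proof.
move=> As z0 yx; rewrite resolvent_isolate //.
have g0 := resolvent_diag_gt0 x As z0.
have := Im_sqr_div_le (resolvent A z x y) g0.
move: (resolvent A z x x) (resolvent A z x y) (resolvent A z y y) g0 => g h k g0.
rewrite raddfB /= mulrBr => H; exact: lerB.
Qed.
End Minami.

(** * Cutting out a window of a tridiagonal matrix *)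

Section Window.
Context {R : rcfType}.
Implicit Types (n : nat) (z w : R[i]).

Lemma windowE n (u v : 'I_n) (k : 'I_(v - u).+1) : (u <= v)%N ->
  window k = (u + k)%N :> nat.
Proof.
move=> uv; rewrite /window val_insubd ifT //.
have := ltn_ord k; have := ltn_ord v; lia.
Qed.

Lemma window_inj n (u v : 'I_n) : (u <= v)%N -> injective (@window n u v).
Proof.
move=> uv i j /(congr1 val) /=; rewrite !windowE // => /addnI ij.
exact: val_inj.
Qed.

Lemma trmx_mxsub_sym n k (f : 'I_k -> 'I_n) (A : 'M[R]_n) :
  A^T = A -> (mxsub f f A)^T = mxsub f f A.
Proof. by move=> As; apply/matrixP => i j; rewrite !mxE -{1}As mxE. Qed.

Definition tridiagonal n (A : 'M[R]_n) :=
  forall i j : 'I_n, (i.+1 < j)%N || (j.+1 < i)%N -> A i j = 0.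

Lemma normc_sum_le (I : Type) (r : seq I) (Q : pred I) (F : I -> R[i]) :
  Normc.normc (\sum_(i <- r | Q i) F i) <= \sum_(i <- r | Q i) Normc.normc (F i).
Proof.
elim/big_rec2: _ => [|i y1 y2 _ h]; first by rewrite Normc.normc0.
by apply: le_trans (le_normcD _ _) _; rewrite lerD2l.
Qed.

Lemma normc_real (x : R) : Normc.normc x%:C = `|x|.
Proof. by rewrite /= expr0n /= addr0 sqrtr_sqr. Qed.

(** Geometric resolvent identity: cutting out the window [u, v] changes a
    diagonal entry only through the two bonds at the ends of the window. *)
Lemma resolvent_restrict n (A : 'M[R]_n) z (u v : 'I_n) (k : 'I_(v - u).+1) :
  A^T = A -> tridiagonal A -> 0 < complex.Im z -> (u < v)%N ->
  Normc.normc (resolvent A z (window k) (window k) - resolvent (Defs.restrict A u v) z k k)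
  <= (complex.Im z)^-1 *
     (Normc.normc (resolvent (Defs.restrict A u v) z ord0 k) *
        (\sum_(l < n | (l < u)%N) `|A u l|)
      + Normc.normc (resolvent (Defs.restrict A u v) z ord_max k) *
        (\sum_(l < n | (v < l)%N) `|A v l|)).
Proof.
move=> As At z0 uv; have zn : complex.Im z != 0 by rewrite gt_eqF.
have uv' := ltnW uv.
set f := @window n u v.
have Bs : (Defs.restrict A u v)^T = Defs.restrict A u v by exact: trmx_mxsub_sym.
have h1 := fun i j => resolvent_row i j As zn.
have h2 i j : \sum_l resolvent (Defs.restrict A u v) z i l *
    ((Defs.restrict A u v l j)%:C - z *+ (l == j)) = (i == j)%:R.
  have /matrixP/(_ i j) := resolvent_mulV Bs zn.
  by rewrite [X in X = _ -> _]mxE [X in _ = X -> _]mxE => <-; apply: eq_bigr => l _; rewrite shift_mxE.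
have Gn : forall i j, Normc.normc (resolvent A z i j) <= (complex.Im z)^-1.
  by move=> i j; exact: normc_resolvent_le.
have Bsym := fun i j => resolvent_sym z i j Bs.
move: (resolvent A z) (resolvent (Defs.restrict A u v) z) h1 h2 Gn Bsym => G H h1 h2 Gn Hs.
pose out (l : 'I_n) := (l < u)%N || (v < l)%N.
pose r j := \sum_(l < n | out l) (A (f j) l)%:C * G l (f k).
have split_sum (F : 'I_n -> R[i]) :
    \sum_l F l = \sum_j F (f j) + \sum_(l | out l) F l.
  rewrite (bigID out) /= addrC; congr (_ + _).
  rewrite (reindex_onto f (fun l : 'I_n => inord (l - u))) /=; last first.
    move=> l; rewrite /out negb_or -!leqNgt => /andP[ul lv].
    apply: val_inj; rewrite /= windowE // inordK; lia.
  apply: eq_bigl => j; rewrite /out /f windowE // addKn inord_val eqxx andbT.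
  by have := ltn_ord j; lia.
(* Multiply (A - z) G = 1, restricted to the window, by H on the left. *)
have key : G (f k) (f k) - H k k = - \sum_j H k j * r j.
  have E i : \sum_j ((Defs.restrict A u v i j)%:C - z *+ (i == j)) * G (f j) (f k) =
     (i == k)%:R - r i.
    rewrite -(inj_eq (@window_inj _ _ _ uv')) -(h1 (f i) (f k)) split_sum -addrA /r.
    rewrite -[LHS]addr0; congr (_ + _).
      by apply: eq_bigr => l _; rewrite mxE (inj_eq (@window_inj _ _ _ uv')).
    rewrite -sumrB big1 // => l lo; rewrite -mulrBl.
    have -> : (f i == l) = false.
      apply/negbTE/eqP => fl; move: lo; rewrite /out -fl windowE //.
      by have := ltn_ord i; lia.
    by rewrite mulr0n subr0 subrr mul0r.
  have : \sum_i H k i * (\sum_j ((Defs.restrict A u v i j)%:C - z *+ (i == j)) * G (f j) (f k))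
     = G (f k) (f k).
    under eq_bigr do rewrite mulr_sumr; rewrite exchange_big /=.
    rewrite (eq_bigr (fun j => (k == j)%:R * G (f j) (f k))); last first.
      by move=> j _; rewrite -h2 mulr_suml; apply: eq_bigr => i _; rewrite mulrA.
    rewrite (bigD1 k) //= big1 ?addr0 ?eqxx ?mul1r // => j jk.
    by rewrite eq_sym (negbTE jk) mul0r.
  under eq_bigr do rewrite E mulrBr; rewrite sumrB (bigD1 k) //= big1 ?addr0.
    by rewrite eqxx mulr1 => <-; rewrite addrC addKr.
  by move=> j jk; rewrite (negbTE jk) mulr0.
have r_le j : Normc.normc (r j) <= (complex.Im z)^-1 * \sum_(l < n | out l) `|A (f j) l|.
  rewrite mulr_sumr; apply: le_trans (normc_sum_le _ _ _) _; apply: ler_sum => l lo.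
  by rewrite Normc.normcM normc_real mulrC ler_wpM2r.
have low (j : 'I_(v - u).+1) : (0 < j)%N -> \sum_(l < n | (l < u)%N) `|A (f j) l| = 0.
  move=> j0; rewrite big1 // => l lu; rewrite At ?normr0 // windowE //.
  by apply/orP; right; lia.
have up (j : 'I_(v - u).+1) : (j < v - u)%N -> \sum_(l < n | (v < l)%N) `|A (f j) l| = 0.
  move=> j0; rewrite big1 // => l lu; rewrite At ?normr0 // windowE //.
  by apply/orP; left; lia.
have outE j : \sum_(l < n | out l) `|A (f j) l| =
    \sum_(l < n | (l < u)%N) `|A (f j) l| + \sum_(l < n | (v < l)%N) `|A (f j) l|.
  rewrite (bigID (fun l : 'I_n => (l < u)%N)) /=; congr (_ + _).
    by apply: eq_bigl => l; rewrite /out; lia.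
  by apply: eq_bigl => l; rewrite /out; lia.
have f0 : f ord0 = u by apply: val_inj; rewrite /= windowE // addn0.
have fm : f ord_max = v by apply: val_inj; rewrite /= windowE // subnKC.
rewrite key normcN; apply: le_trans (normc_sum_le _ _ _) _.
have om : ord_max != ord0 :> 'I_(v - u).+1.
  by rewrite -val_eqE /= -lt0n subn_gt0.
have Hle j : Normc.normc (H k j * r j) <= (complex.Im z)^-1 *
    (Normc.normc (H k j) * \sum_(l < n | out l) `|A (f j) l|).
  by rewrite Normc.normcM mulrCA ler_wpM2l ?normc_ge0.
apply: le_trans (ler_sum _ (fun j _ => Hle j)) _; rewrite -mulr_sumr.
rewrite ler_pM2l ?invr_gt0 //.
rewrite (bigD1 ord0) //= (bigD1 ord_max) //= [X in _ + (_ + X)]big1 ?addr0; last first.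
  move=> j /andP[j0 jm]; rewrite outE low ?up ?addr0 ?mulr0 //.
    have := ltn_ord j; move: jm; rewrite -val_eqE /=; lia.
  by rewrite lt0n.
rewrite !outE (low ord_max) ?subn_gt0 // (up ord0) ?subn_gt0 // addr0 add0r f0 fm.
by rewrite (Hs k ord0) (Hs k ord_max).
Qed.
End Window.
Local Close Scope complex_scope.

(** * Averages of Lorentzian kernels over bounded laws *)

Lemma measurable_funV {R : realType} d (T : measurableType d) (f : T -> R) :
  measurable_fun setT f -> measurable_fun setT (fun x => (f x)^-1).
Proof.
move=> mf; have -> : (fun x => (f x)^-1) = (fun x => f x * (f x ^+ 2) `^ (-1)).
  apply/funext => x; rewrite powR_inv1 ?sqr_ge0 //.
  have [->|fx] := eqVneq (f x) 0; first by rewrite mul0r invr0.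
  by rewrite expr2 invfM mulrA divff // mul1r.
apply: measurable_funM => //.
by apply: measurableT_comp (measurable_powR _) _; exact: measurable_funX.
Qed.

Section CauchyIntegral.
Context {R : realType}.
Local Notation mu := (@lebesgue_measure R).

Lemma is_derive_atan_scale (U V x : R) : 0 < V ->
  is_derive x 1 (fun y => atan ((y - U) / V)) (cauchy_kernel U V x).
Proof.
move=> V0; have Vn : V != 0 by rewrite gt_eqF.
have h : is_derive x 1 (fun y => (y - U) / V) V^-1.
  have -> : (fun y => (y - U) / V) = (fun y => V^-1 *: (y - U)).
    by apply/funext => y /=; rewrite mulrC.
  by apply: is_derive_eq; rewrite subr0 /GRing.scale /= mulr1.
have := @is_derive1_comp R atan (fun y => (y - U) / V) x _ _ (is_derive1_atan _) h.
suff <- : (1 + ((x - U) / V) ^+ 2)^-1 / V = cauchy_kernel U V x by [].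
rewrite /cauchy_kernel expr_div_n.
have := sqr_shift_gt0 U x V0; move: ((x - U) ^+ 2) => a /lt0r_neq0 D.
have -> : 1 + a / V ^+ 2 = (a + V ^+ 2) / V ^+ 2 by field.
by rewrite invf_div; field; rewrite Vn D.
Qed.

Lemma continuous_cauchy_kernel (U V : R) : 0 < V -> continuous (cauchy_kernel U V).
Proof.
move=> V0 x; apply: cvgM; first exact: cvg_cst.
apply: cvgV; first by rewrite gt_eqF // sqr_shift_gt0.
apply: cvgD; last exact: cvg_cst.
have h : (fun y : R => y - U) y @[y --> x] --> x - U.
  by apply: cvgB; [exact: cvg_id|exact: cvg_cst].
exact: (continuous_comp h (@exprn_continuous _ 2 _)).
Qed.

Lemma measurable_cauchy_kernel (U V : R) : 0 < V -> measurable_fun setT (cauchy_kernel U V).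
Proof. by move=> V0; apply: continuous_measurable_fun; exact: continuous_cauchy_kernel. Qed.

(** The kernel has a bounded primitive, of total variation pi. *)
Lemma integral_cauchy_le (U V : R) : 0 < V ->
  (\int[mu]_x (cauchy_kernel U V x)%:E <= pi%:E)%E.
Proof.
move=> V0; have f0 x : 0 <= cauchy_kernel U V x by rewrite ltW ?cauchy_kernel_gt0.
pose F n := [set` `[- n%:R : R, +oo[ ].
have half n : (\int[mu]_(x in F n) (cauchy_kernel U V x)%:E <= pi%:E)%E.
  rewrite /F (@ge0_continuous_FTC2y R (cauchy_kernel U V) (fun x => atan ((x - U) / V)) _ (pi / 2)).
  - rewrite -EFinB lee_fin.
    by have := atan_gtNpi2 ((- n%:R - U) / V); lra.
  - by [].
  - exact/continuous_subspaceT/continuous_cauchy_kernel.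
  - apply: (@cvg_comp _ _ _ (fun x : R => (x - U) / V) (@atan R) _ (pinfty_nbhs R) _ _ (@cvgy_atan R)).
    apply/cvgryPge => A; near=> x.
    rewrite ler_pdivlMr // lerBrDr; near: x; apply: nbhs_pinfty_ge; exact: num_real.
  - by move=> x _; have [] := is_derive_atan_scale U x V0.
  - apply: cvg_at_right_filter; apply: differentiable_continuous.
    by apply/derivable1_diffP; have [] := is_derive_atan_scale U (- n%:R) V0.
  - by move=> x _; rewrite derive1E; have [_] := is_derive_atan_scale U x V0.
have FT : \bigcup_n F n = setT.
  apply/seteqP; split => // x _; exists (Num.truncn `|x|).+1 => //=.
  rewrite /F /= in_itv /= andbT; have := truncnS_gt `|x|; rewrite ltr_norml.
  by move=> /andP[/ltW].
have := @ge0_nondecreasing_set_cvg_integral _ (measurableTypeR R) R F (fun x => (cauchy_kernel U V x)%:E) mu.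
rewrite FT => H.
have C : (\int[mu]_(x in F i) (cauchy_kernel U V x)%:E)%E @[i --> \oo] -->
    (\int[mu]_x (cauchy_kernel U V x)%:E)%E.
  apply: H.
  - move=> m n mn; rewrite /F subsetEset => x /=; rewrite !in_itv /= !andbT.
    by apply: le_trans; rewrite lerN2 ler_nat.
  - by move=> i; exact: measurable_itv.
  - by move=> i; apply: measurable_funTS; apply/measurable_EFinP; exact: measurable_cauchy_kernel.
  - by move=> i x _; rewrite lee_fin.
rewrite -(cvg_lim _ C) //; apply: lime_le; first exact: cvgP C.
by apply: nearW => n; exact: half.
Unshelve. all: by end_near. Qed.
End CauchyIntegral.

Section IntegralTools.
Import HBNNSimple.
Context {R : realType}.
Local Open Scope ereal_scope.

Lemma le_measure_integral d (T : measurableType d)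
    (m1 m2 : {measure set T -> \bar R}) (f : T -> \bar R) :
  (forall A, measurable A -> m1 A <= m2 A) -> (forall x, 0 <= f x) ->
  \int[m1]_x f x <= \int[m2]_x f x.
Proof.
move=> m12 f0; rewrite !ge0_integralTE //.
apply: ge_ereal_sup => _ [h /= hf <-].
apply: (@le_trans _ _ (sintegral m2 h)); last first.
  by apply: ereal_sup_ubound; exists h.
rewrite !sintegralE; apply: lee_fsum => // _ [x _ <-].
by apply: lee_wpmul2l; rewrite ?lee_fin ?fun_ge0 //; apply: m12.
Qed.

(** Lebesgue measure lives on a different copy of the measurable space of reals
    than the law; it is transported by the identity map. *)
Lemma integral_cauchy_law_le (m : {measure set R -> \bar R})
    (C : R) (U V : R) : (0 <= C)%R -> (0 < V)%R ->
  (forall A : set R, measurable A -> m A <= C%:E * lebesgue_measure A) ->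
  \int[m]_x (cauchy_kernel U V x)%:E <= (C * pi)%:E.
Proof.
move=> C0 V0 mC; have f0 x : (0 <= cauchy_kernel U V x)%R by rewrite ltW ?cauchy_kernel_gt0.
have mi : measurable_fun setT (fun x : measurableTypeR R => x : R).
  by move=> _ A mA; rewrite setTI.
have mK : measurable_fun setT (fun x : R => (cauchy_kernel U V x)%:E).
  by apply/measurable_EFinP; exact: measurable_cauchy_kernel.
pose leb := [the {measure set R -> \bar R} of
  pushforward lebesgue_measure (fun x : measurableTypeR R => x : R)].
apply: (@le_trans _ _ (\int[mscale (NngNum C0) (leb mi)]_x (cauchy_kernel U V x)%:E)).
  by apply: le_measure_integral => // A mA; exact: mC.
rewrite ge0_integral_mscale //=.
- rewrite EFinM; apply: lee_wpmul2l; rewrite ?lee_fin //.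
  rewrite ge0_integral_pushforward //=; first exact: integral_cauchy_le.
  by move=> y _; rewrite lee_fin.
- by move=> x _; rewrite lee_fin.
Qed.

End IntegralTools.

Section SpectralAveraging.
Context {R : realType} d d' {T : measurableType d} {T' : measurableType d'}.
Variable P : probability T R.
Local Open Scope ereal_scope.

(** Integrating first over a coordinate X whose law is dominated by C dx, and
    that is independent of everything else, turns a Lorentzian in X into at
    most pi C, whatever its centre U and width V. *)
Lemma spectral_averaging (X : T -> R) (Y : T -> T') (C : R) (U V H : T' -> R) :
  measurable_fun setT X -> measurable_fun setT Y ->
  (forall (A : set R) (B : set T'), measurable A -> measurable B ->
    P (X @^-1` A `&` Y @^-1` B) = P (X @^-1` A) * P (Y @^-1` B)) ->
  (0 <= C)%R ->
  (forall A : set R, measurable A -> P (X @^-1` A) <= C%:E * lebesgue_measure A) ->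
  measurable_fun setT U -> measurable_fun setT V -> measurable_fun setT H ->
  (forall y, 0 < V y)%R -> (forall y, 0 <= H y)%R ->
  \int[P]_w (H (Y w) * cauchy_kernel (U (Y w)) (V (Y w)) (X w))%:E <=
  (C * pi)%:E * \int[P]_w (H (Y w))%:E.
Proof.
move=> mX mY XY C0 PC mU mV mH V0 H0.
pose Xm : {mfun T >-> R} := mfun_Sub (mem_set mX).
pose Ym : {mfun T >-> T'} := mfun_Sub (mem_set mY).
have mZ : measurable_fun setT (fun w => (X w, Y w)) by exact: measurable_fun_pair.
pose Zm : {mfun T >-> (R * T')%type} := mfun_Sub (mem_set mZ).
pose f (z : R * T') : R := (H z.2 * cauchy_kernel (U z.2) (V z.2) z.1)%R.
have f0 z : (0 <= f z)%R by rewrite mulr_ge0 // ltW // cauchy_kernel_gt0.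
have mf : measurable_fun setT f.
  have m2 (g : T' -> R) : measurable_fun setT g -> measurable_fun setT (fun z : R * T' => g z.2).
    by move=> mg; apply: measurableT_comp.
  apply: measurable_funM; first exact: m2.
  apply: measurable_funM; first exact: m2.
  apply: measurable_funV.
  apply: measurable_funD; apply: measurable_funX; last exact: m2.
  by apply: measurable_funB; [exact: measurable_fst|exact: m2].
have -> : \int[P]_w (H (Y w) * cauchy_kernel (U (Y w)) (V (Y w)) (X w))%:E =
   \int[distribution P Zm]_z (f z)%:E.
  by rewrite ge0_integral_distribution //; apply/measurable_EFinP.
have -> : \int[distribution P Zm]_z (f z)%:E =
   \int[distribution P Xm \x distribution P Ym]_z (f z)%:E.
  apply: eq_measure_integral => A mA _.
  by apply/esym/product_measure_unique.
have mfE : measurable_fun setT (fun z => (f z)%:E) by exact/measurable_EFinP.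
have fE0 z : 0 <= (f z)%:E by rewrite lee_fin.
rewrite (fubini_tonelli2 _ mfE fE0).
have -> : \int[P]_w (H (Y w))%:E = \int[distribution P Ym]_y (H y)%:E.
  by rewrite ge0_integral_distribution //; apply/measurable_EFinP.
have mHE : measurable_fun setT (fun y => (H y)%:E) by exact/measurable_EFinP.
rewrite -ge0_integralZl //; last first.
- by rewrite lee_fin mulr_ge0 // pi_ge0.
- by move=> y _; rewrite lee_fin.
apply: ge0_le_integral => //.
- by move=> y _; apply: integral_ge0 => x _; rewrite lee_fin.
- exact: (measurable_fun_fubini_tonelli_G _ mfE fE0).
- exact: measurable_funeM.
move=> y _; rewrite /fubini_G /f /=.
have mK : measurable_fun setT (fun x : R => (cauchy_kernel (U y) (V y) x)%:E).
  by apply/measurable_EFinP; exact: measurable_cauchy_kernel.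
have K0 (x : R) : setT x -> 0 <= (cauchy_kernel (U y) (V y) x)%:E.
  by move=> _; rewrite lee_fin ltW // cauchy_kernel_gt0.
have Hy : 0 <= (H y)%:E by rewrite lee_fin.
under eq_integral do rewrite EFinM.
rewrite (ge0_integralZl (distribution P Xm) measurableT mK K0 Hy).
rewrite muleC; apply: lee_wpmul2r; first by rewrite lee_fin.
exact: integral_cauchy_law_le.
Qed.
End SpectralAveraging.
(** * Sigma-algebras generated by blocks of independent variables *)

Section IndependentSigmaAlgebras.
Context {R : realType} d d' {T : measurableType d} {T' : measurableType d'}.
Variable P : probability T R.
Context {I : finType} (X : I -> T -> T').
Hypothesis mX : forall i, measurable_fun setT (X i).
Implicit Types K L : {set I}.
Local Open Scope ereal_scope.

Definition generators K : set_system T :=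
  [set A | exists2 i, i \in K & exists2 B, measurable B & A = X i @^-1` B].

(** A generating class stable under intersection, as the uniqueness of measures
    requires. *)
Definition cylinders K : set_system T :=
  [set A | exists2 B : I -> set T', (forall i, measurable (B i)) &
    A = \bigcap_(i in [set` K]) X i @^-1` B i].

Lemma cylinders_setI K : setI_closed (cylinders K).
Proof.
move=> _ _ [B mB ->] [C mC ->]; exists (fun i => B i `&` C i).
  by move=> i; exact: measurableI.
by rewrite -bigcapI.
Qed.

Lemma generators_measurable K : generators K `<=` measurable.
Proof. by move=> _ [i _ [B mB ->]]; rewrite -[X in measurable X]setTI; exact: mX. Qed.

Lemma sigma_generators_measurable K : <<s generators K>> `<=` measurable.
Proof.
apply: smallest_sub; last exact: generators_measurable.
exact: sigma_algebra_measurable.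
Qed.

Lemma cylinders_measurable K : cylinders K `<=` measurable.
Proof.
move=> _ [B mB ->]; apply: fin_bigcap_measurable; first exact: finite_finset.
by move=> i _; rewrite -[X in measurable X]setTI; exact: mX.
Qed.

Lemma generators_sub_cylinders K : generators K `<=` cylinders K.
Proof.
move=> _ [i iK [B mB ->]]; exists (fun j => if j == i then B else setT).
  by move=> j; case: ifP.
apply/seteqP; split=> [w /= Bw j _|w].
  by rewrite /=; case: eqP => // ->.
by move=> /(_ i iK) /=; rewrite eqxx.
Qed.

Lemma sigma_generators_sub K : <<s generators K>> `<=` <<s cylinders K>>.
Proof.
apply: smallest_sub; first exact: smallest_sigma_algebra.
by move=> A /generators_sub_cylinders; exact: sub_sigma_algebra.
Qed.

(** Uniqueness of measures, applied to P restricted to A and to P scaled by P A. *)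
Lemma measure_restr_unique (G : set_system T) (A : set T) :
  setI_closed G -> G `<=` measurable -> G setT -> measurable A ->
  (forall B, G B -> P (A `&` B) = P A * P B) ->
  forall B, <<s G>> B -> P (A `&` B) = P A * P B.
Proof.
move=> GI Gm GT mA H B sB.
have PA0 : (0 <= fine (P A))%R by rewrite fine_ge0.
have PAf : P A = (fine (P A))%:E by rewrite fineK // fin_num_measure.
have := @g_sigma_algebra_measure_unique _ _ _ G Gm (fun=> setT) (fun=> GT)
  (bigcup_const _ _) (mrestr P mA) (mscale (NngNum PA0) P) GI.
have msE C : mscale (NngNum PA0) P C = P A * P C by rewrite [in RHS]PAf.
move=> U; rewrite setIC -[LHS]/(mrestr P mA B) U //.
- exact: msE.
- move=> C GC; apply/esym/(etrans (msE C)).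
  by rewrite -H // setIC.
- move=> _; apply: le_lt_trans (probability_le1 P _) (ltry _).
  exact: measurableI.
Qed.

Hypothesis indep : independent P X.

Lemma independent_cylinders K L A B : (forall i, i \in K -> i \notin L) ->
  cylinders K A -> cylinders L B -> P (A `&` B) = P A * P B.
Proof.
move=> KL [B1 mB1 ->] [B2 mB2 ->].
rewrite !indep //.
pose B3 i := if i \in K then B1 i else B2 i.
have BK i : i \in K -> B3 i = B1 i by rewrite /B3 => ->.
have BL i : i \in L -> B3 i = B2 i.
  by rewrite /B3 => iL; case: ifPn => // /KL; rewrite iL.
have -> : \bigcap_(i in [set` K]) X i @^-1` B1 i `&` \bigcap_(i in [set` L]) X i @^-1` B2 i
    = \bigcap_(i in [set` K :|: L]) X i @^-1` B3 i.
  apply/seteqP; split => [w [w1 w2] i /=|w H].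
    by rewrite inE => /orP[iK|iL]; [rewrite BK //; exact: w1|rewrite BL //; exact: w2].
  split => i /= iK.
    by rewrite -BK //; apply: (H i); rewrite /= inE iK.
  by rewrite -BL //; apply: (H i); rewrite /= inE iK orbT.
rewrite indep; last by move=> i _; rewrite /B3; case: ifP.
rewrite (bigID (fun i => i \in K)) /=; congr (_ * _); apply: eq_big => i.
- by rewrite inE; case: (i \in K); rewrite /= ?orbF ?andbT ?andbF.
- by move=> /andP[_ iK]; rewrite BK.
- by rewrite inE; case: (boolP (i \in K)) => [/KL/negbTE ->|]; rewrite /= ?andbF ?andbT.
- by rewrite inE => /andP[/orP[-> //|iL] _]; rewrite BL.
Qed.

Lemma cylinders_setT K : cylinders K setT.
Proof.
exists (fun=> setT) => //.
by apply/seteqP; split.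
Qed.

(** The product rule passes from cylinders to sigma-algebras one side at a time. *)
Lemma independent_sigma K L A B : (forall i, i \in K -> i \notin L) ->
  <<s generators K>> A -> <<s generators L>> B -> P (A `&` B) = P A * P B.
Proof.
move=> KL sA sB.
have mA := sigma_generators_measurable sA.
have {}sA := sigma_generators_sub sA.
have step C : cylinders L C -> P (C `&` A) = P C * P A.
  move=> LC; apply: (@measure_restr_unique (cylinders K)) => //.
  - exact: cylinders_setI.
  - exact: cylinders_measurable.
  - exact: cylinders_setT.
  - exact: cylinders_measurable LC.
  - move=> D KD; apply: (@independent_cylinders L K) => //.
    by move=> i iL; apply/negP => /KL; rewrite iL.
apply: (@measure_restr_unique (cylinders L)) => //.
- exact: cylinders_setI.
- exact: cylinders_measurable.
- exact: cylinders_setT.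
- by move=> C LC; rewrite setIC step // muleC.
- exact: sigma_generators_sub sB.
Qed.

Lemma independent_blocks (J : eqType) (r : seq J) (K : J -> {set I}) (A : J -> set T) :
  uniq r -> (forall p q i, p != q -> i \in K p -> i \notin K q) ->
  (forall p, p \in r -> <<s generators (K p)>> (A p)) ->
  P [set w | forall p, p \in r -> A p w] = \prod_(p <- r) P (A p).
Proof.
move=> ur KK; pose KU (r : seq J) : {set I} := finset (fun i => has (fun p => i \in K p) r).
suff H : (forall p, p \in r -> <<s generators (K p)>> (A p)) ->
  <<s generators (KU r)>> [set w | forall p, p \in r -> A p w] /\
  P [set w | forall p, p \in r -> A p w] = \prod_(p <- r) P (A p).
  by move=> /H[].
elim: r ur => [_ _|p r IH /= /andP[pr ur] sA].
  rewrite big_nil; have -> : [set w | forall p, p \in [::] -> A p w] = setT by apply/seteqP.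
  split; first exact: (@measurableT _ (g_sigma_algebraType (generators (KU [::])))).
  exact: probability_setT.
have [|sr Pr] := IH ur; first by move=> q qr; apply: sA; rewrite inE qr orbT.
have -> : [set w | forall q, q \in p :: r -> A q w] =
    A p `&` [set w | forall q, q \in r -> A q w].
  apply/seteqP; split => [w H|w [Ap H] q].
    by split; [apply: H; rewrite mem_head|move=> q qr; apply: H; rewrite inE qr orbT].
  by rewrite inE => /orP[/eqP ->|/H].
have mono (K1 K2 : {set I}) (B : set T) : {subset K1 <= K2} ->
    <<s generators K1>> B -> <<s generators K2>> B.
  move=> K12; apply: smallest_sub; first exact: smallest_sigma_algebra.
  move=> _ [i iK [C mC ->]]; apply: sub_sigma_algebra; exists i; first exact: K12.
  by exists C.
have sp : <<s generators (K p)>> (A p) by apply: sA; rewrite mem_head.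
split.
  apply: (@measurableI _ (g_sigma_algebraType (generators (KU (p :: r))))).
  - by apply: mono sp => i ip; rewrite inE /= ip.
  - by apply: mono sr => i; rewrite !inE /= => ->; rewrite orbT.
rewrite big_cons -Pr; apply: independent_sigma sp sr => i ip.
rewrite inE -all_predC; apply/allP => q qr /=.
by apply: KK ip; apply: contraNneq pr => ->.
Qed.

End IndependentSigmaAlgebras.
Local Open Scope complex_scope.

(** * Measurability of resolvent entries *)

Section ComplexMeasurability.
Context {R : realType} d {T : measurableType d}.

Definition cmeasurable (f : T -> R[i]) :=
  measurable_fun setT (fun w => complex.Re (f w)) /\
  measurable_fun setT (fun w => complex.Im (f w)).

Lemma cmeasurable_cst (c : R[i]) : cmeasurable (fun=> c).
Proof. by split; exact: measurable_cst. Qed.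

Lemma cmeasurable_real (f : T -> R) : measurable_fun setT f ->
  cmeasurable (fun w => (f w)%:C).
Proof. by split => //; exact: measurable_cst. Qed.

Lemma cmeasurableD f g : cmeasurable f -> cmeasurable g ->
  cmeasurable (fun w => f w + g w).
Proof.
move=> [f1 f2] [g1 g2]; split.
  by under eq_fun do rewrite raddfD; exact: measurable_funD.
by under eq_fun do rewrite raddfD; exact: measurable_funD.
Qed.

Lemma cmeasurableN f : cmeasurable f -> cmeasurable (fun w => - f w).
Proof.
move=> [f1 f2]; split.
  by under eq_fun do rewrite raddfN; exact: measurable_funN.
by under eq_fun do rewrite raddfN; exact: measurable_funN.
Qed.

Lemma cmeasurableM f g : cmeasurable f -> cmeasurable g ->
  cmeasurable (fun w => f w * g w).
Proof.
move=> [f1 f2] [g1 g2]; split.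
  rewrite (_ : (fun w => _) = (fun w => complex.Re (f w) * complex.Re (g w)
      - complex.Im (f w) * complex.Im (g w))).
    by apply: measurable_funB; exact: measurable_funM.
  by apply/funext => w; case: (f w) (g w) => [? ?] [? ?].
rewrite (_ : (fun w => _) = (fun w => complex.Re (f w) * complex.Im (g w)
      + complex.Im (f w) * complex.Re (g w))).
  by apply: measurable_funD; exact: measurable_funM.
by apply/funext => w; case: (f w) (g w) => [? ?] [? ?].
Qed.

Lemma cmeasurableV f : cmeasurable f -> cmeasurable (fun w => (f w)^-1).
Proof.
move=> [f1 f2].
have n : measurable_fun setT (fun w => (nsq (f w))^-1).
  by apply: measurable_funV; apply: measurable_funD; exact: measurable_funX.
split.
  rewrite (_ : (fun w => _) = (fun w => complex.Re (f w) * (nsq (f w))^-1)).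
    exact: measurable_funM.
  by apply/funext => w; case: (f w).
rewrite (_ : (fun w => _) = (fun w => - (complex.Im (f w)) * (nsq (f w))^-1)).
  by apply: measurable_funM => //; exact: measurable_funN.
by apply/funext => w; case: (f w) => a b /=; rewrite mulNr.
Qed.

Lemma cmeasurable_sum (J : Type) (r : seq J) (Q : pred J) (F : J -> T -> R[i]) :
  (forall j, Q j -> cmeasurable (F j)) ->
  cmeasurable (fun w => \sum_(j <- r | Q j) F j w).
Proof.
move=> H; elim: r => [|j r IH].
  by under eq_fun do rewrite big_nil; exact: cmeasurable_cst.
under eq_fun do rewrite big_cons.
by case Qj : (Q j) => //; apply: cmeasurableD => //; exact: H.
Qed.

Lemma cmeasurable_prod (J : Type) (r : seq J) (Q : pred J) (F : J -> T -> R[i]) :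
  (forall j, Q j -> cmeasurable (F j)) ->
  cmeasurable (fun w => \prod_(j <- r | Q j) F j w).
Proof.
move=> H; elim: r => [|j r IH].
  by under eq_fun do rewrite big_nil; exact: cmeasurable_cst.
under eq_fun do rewrite big_cons.
by case Qj : (Q j) => //; apply: cmeasurableM => //; exact: H.
Qed.

Lemma cmeasurable_det n (M : T -> 'M[R[i]]_n) :
  (forall i j, cmeasurable (fun w => M w i j)) -> cmeasurable (fun w => \det (M w)).
Proof.
move=> H; apply: cmeasurable_sum => s _.
by apply: cmeasurableM; [exact: cmeasurable_cst|exact: cmeasurable_prod].
Qed.

(** Cramer's rule: the entries are rational functions of those of A. *)
Lemma cmeasurable_resolvent n (A : T -> 'M[R]_n) z i j :
  (forall w, (A w)^T = A w) -> complex.Im z != 0 ->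
  (forall i j, measurable_fun setT (fun w => A w i j)) ->
  cmeasurable (fun w => resolvent (A w) z i j).
Proof.
move=> As z0 mA; pose M w := map_mx (real_complex R) (A w) - z%:M.
have mM k l : cmeasurable (fun w => M w k l).
  under eq_fun do rewrite /M shift_mxE.
  by apply: cmeasurableD; [exact: cmeasurable_real|exact: cmeasurable_cst].
rewrite (_ : (fun w => _) = (fun w => (\det (M w))^-1 *
    ((-1) ^+ (j + i) * \det (row' j (col' i (M w)))))).
  apply: cmeasurableM; first exact/cmeasurableV/cmeasurable_det.
  apply: cmeasurableM; first exact: cmeasurable_cst.
  apply: cmeasurable_det => k l.
  rewrite (_ : (fun w => _) = (fun w => M w (lift j k) (lift i l))) //.
  by apply/funext => w; move: (M w) => N; rewrite !mxE.
apply/funext => w; rewrite /resolvent /invmx (resolvent_unit (As w) z0).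
by rewrite mxE [X in _ * X]mxE.
Qed.

End ComplexMeasurability.

(** * Wegner and Minami estimates *)

Section Wegner.
Context {R : realType} d {T : measurableType d}.
Variable P : probability T R.
Context {I : finType} (X : I -> T -> R).
Hypothesis mX : forall i, measurable_fun setT (X i).
Hypothesis indep : independent P X.

(** The sample space with the sigma-algebra of the variables X i, i in K: to be
    measurable on it is to depend on these variables only. *)
Definition sigmaType (K : {set I}) := g_sigma_algebraType (generators X K).

(** The form in which a bounded density is used; it avoids changes of variables
    in integrals. *)
Definition bounded_law (C : R) (Y : T -> R) :=
  forall A : set R, measurable A ->
    (P (Y @^-1` A) <= C%:E * lebesgue_measure A)%E.

Lemma has_density_bounded_law Y rho C : has_density P Y rho ->
  ('N[lebesgue_measure]_+oo[EFin \o rho] <= C%:E)%E -> 0 <= C /\ bounded_law C Y.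
Proof.
move=> [mrho rho0 PE] NC.
have C0 : 0 <= C by rewrite -lee_fin; apply: le_trans NC; exact: Lnorm_ge0.
split=> // A mA; rewrite PE //.
have ae_le : \forall x \ae (@lebesgue_measure R), (`|(rho x)%:E| <= C%:E)%E.
  move: NC; rewrite unlock /Lnorm; case: ifPn => [_ /ess_supP //|].
  move=> mu0 _; exists setT; split => //.
  by apply/eqP; rewrite eq_le measure_ge0 andbT leNgt.
apply: (@le_trans _ _ (\int[lebesgue_measure]_(x in A) C%:E)%E).
  apply: ae_ge0_le_integral => //.
  - by move=> x _; rewrite lee_fin.
  - exact/measurable_funTS/measurable_EFinP.
  - have [N [mN N0 sub]] := ae_le; exists N; split => // x /= nQ.
    by apply: sub => /= h; apply: nQ => _; move: h; rewrite lee_fin /= ger0_norm.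
by rewrite integral_cst.
Qed.

Lemma sigmaType_measurable_X (K : {set I}) i : i \in K ->
  measurable_fun setT (X i : sigmaType K -> R).
Proof.
move=> iK _ B mB; rewrite setTI; apply: sub_sigma_algebra.
by exists i => //; exists B.
Qed.

Lemma sigmaType_measurable_fun (K : {set I}) d' (T' : measurableType d') (f : T -> T') :
  measurable_fun setT (f : sigmaType K -> T') -> measurable_fun setT f.
Proof.
move=> mf _ B mB; have := mf measurableT B mB.
by rewrite !setTI => /(sigma_generators_measurable mX).
Qed.

(** Wegner's estimate: seen as a function of the diagonal entry X k at site x,
    the resolvent entry at (x, x) is 1 / (X k + beta), where beta has negative
    imaginary part and does not depend on X k. *)
Lemma wegner n (A : T -> 'M[R]_n) (x : 'I_n) k z C (H : T -> R) :
  (forall w, (A w)^T = A w) -> 0 < complex.Im z ->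
  (forall w, A w x x = X k w) ->
  (forall i j, ~~ ((i == x) && (j == x)) ->
     measurable_fun setT ((fun w => A w i j) : sigmaType [set~ k]%SET -> R)) ->
  0 <= C -> bounded_law C (X k) ->
  measurable_fun setT (H : sigmaType [set~ k]%SET -> R) -> (forall w, 0 <= H w) ->
  (\int[P]_w (H w * complex.Im (resolvent (A w) z x x))%:E <=
    (C * pi)%:E * \int[P]_w (H w)%:E)%E.
Proof.
move=> As z0 Axx mA C0 XC mH H0.
have zn : complex.Im z != 0 by rewrite gt_eqF.
(* The matrix with the entry at (x, x) set to 0. *)
pose A0 w := A w + (- X k w) *: delta_mx x x.
have A0s w : (A0 w)^T = A0 w.
  by rewrite /A0 raddfD /= As linearZ /= trmx_delta.
have mA0 i j : measurable_fun setT ((fun w => A0 w i j) : sigmaType [set~ k]%SET -> R).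
  have [/andP[/eqP -> /eqP ->]|ij] := boolP ((i == x) && (j == x)).
    rewrite (_ : (fun w => _) = fun=> 0); first exact: measurable_cst.
    by apply/funext => w; rewrite /A0 !mxE !eqxx Axx mulr1 subrr.
  rewrite (_ : (fun w => _) = (fun w => A w i j)); first exact: mA.
  by apply/funext => w; rewrite /A0 !mxE (negbTE ij) mulr0 addr0.
pose g (w : sigmaType [set~ k]%SET) := resolvent (A0 w) z x x.
have mg : cmeasurable (fun w => - (g w)^-1).
  by apply/cmeasurableN/cmeasurableV/cmeasurable_resolvent.
have g0 w : 0 < complex.Im (- (g w)^-1).
  have := resolvent_diag_gt0 x (A0s w) z0; rewrite -/(g w); case: (g w) => a b /= b0.
  by rewrite opprK divr_gt0 // ltr_wpDl ?sqr_ge0 ?exprn_gt0.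
have E w : complex.Im (resolvent (A w) z x x) =
    cauchy_kernel (complex.Re (- (g w)^-1)) (complex.Im (- (g w)^-1)) (X k w).
  have := resolvent_diag_shift x (X k w) (A0s w) z0.
  rewrite {1}/A0 scaleNr addrNK -/(g w) => h.
  by rewrite -Im_real_sub_inv // opprK addrC -h invrK.
under eq_integral do rewrite E.
apply: (@spectral_averaging R _ _ T (sigmaType [set~ k]%SET) P (X k) (fun w => w)
  C (fun w => complex.Re (- (g w)^-1)) (fun w => complex.Im (- (g w)^-1)) H).
- exact: mX.
- move=> _ B mB; rewrite setTI; exact: (sigma_generators_measurable mX mB).
- move=> B1 B2 mB1 mB2.
  apply: (@independent_sigma _ _ _ _ _ P _ X mX indep [set k]%SET [set~ k]%SET) => //.
  + by move=> i; rewrite !inE negbK.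
  + by apply: sub_sigma_algebra; exists k; rewrite ?inE //; exists B1.
- exact: C0.
- exact: XC.
- exact: mg.1.
- exact: mg.2.
- exact: mH.
- exact: g0.
- exact: H0.
Qed.

(** Minami's estimate: Wegner's estimate at x, where the weight H is the second
    factor, then at y for the matrix with x isolated. *)
Lemma minami n (A : T -> 'M[R]_n) (x y : 'I_n) kx ky z C :
  (forall w, (A w)^T = A w) -> 0 < complex.Im z -> y != x ->
  (forall w, A w x x = X kx w) -> (forall w, A w y y = X ky w) ->
  (forall i j, ~~ ((i == x) && (j == x)) ->
     measurable_fun setT ((fun w => A w i j) : sigmaType [set~ kx]%SET -> R)) ->
  (forall i j, ~~ ((i == y) && (j == y)) ->
     measurable_fun setT ((fun w => A w i j) : sigmaType [set~ ky]%SET -> R)) ->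
  0 <= C -> bounded_law C (X kx) -> bounded_law C (X ky) ->
  (\int[P]_w (complex.Im (resolvent (A w) z x x) *
     complex.Im (resolvent (isolate (A w) x) z y y))%:E <= ((C * pi) ^+ 2)%:E)%E.
Proof.
move=> As z0 yx Axx Ayy mAx mAy C0 Xx Xy.
have zn : complex.Im z != 0 by rewrite gt_eqF.
have Bs w : (isolate (A w) x)^T = isolate (A w) x by exact: isolate_sym.
have mB i j : measurable_fun setT
    ((fun w => isolate (A w) x i j) : sigmaType [set~ kx]%SET -> R).
  under eq_fun do rewrite mxE; case E : (_ || _); first exact: measurable_cst.
  by apply: mAx; case: (i == x) E.
under eq_integral do rewrite mulrC.
apply: (le_trans (wegner (H := fun w => complex.Im (resolvent (isolate (A w) x) z y y))
  As z0 Axx mAx C0 Xx _ _)).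
- by have [] := @cmeasurable_resolvent R _ (sigmaType [set~ kx]%SET) n
    (fun w => isolate (A w) x) z y y Bs zn mB.
- by move=> w; rewrite ltW // resolvent_diag_gt0.
rewrite expr2 [leRHS]EFinM; apply: lee_wpmul2l; first by rewrite lee_fin mulr_ge0 // pi_ge0.
under eq_integral do rewrite -[X in X%:E]mul1r.
apply: (le_trans (wegner (k := ky) (H := fun=> 1) (C := C) Bs z0 _ _ C0 Xy _ _)).
- by move=> w; rewrite mxE (negbTE yx) /=; exact: Ayy.
- move=> i j ij; under eq_fun do rewrite mxE.
  case: (_ || _); first exact: measurable_cst.
  exact: mAy.
- exact: measurable_cst.
- by [].
rewrite integral_cst // mul1e.
rewrite -[leRHS]mule1; apply: lee_wpmul2l; last exact: probability_le1.
by rewrite lee_fin mulr_ge0 // pi_ge0.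
Qed.

End Wegner.
Local Close Scope complex_scope.

(** * Lorentzian approximation of interval indicators *)

Section SmoothedIndicator.
Context {R : realType}.
Implicit Types (a b t h x y r : R).

Lemma atan_MVT x y : x < y ->
  exists2 c, x < c < y & atan y - atan x = (1 + c ^+ 2)^-1 * (y - x).
Proof.
move=> xy; have [|c cxy E] := @MVT R (@atan R) (fun x => (1 + x ^+ 2)^-1) x y xy (fun z _ => is_derive1_atan z).
  by apply: continuous_subspaceT => z; exact: continuous_atan.
by exists c => //; move: cxy; rewrite in_itv.
Qed.

Lemma atan_sub_le x y : 0 < x -> x <= y -> atan y - atan x <= x^-1.
Proof.
move=> x0; rewrite le_eqVlt => /predU1P[<-|xy].
  by rewrite subrr invr_ge0 ltW.
pose g (z : R) := atan z + z^-1.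
have dg z : z \in `]x, y[ -> is_derive z 1 g ((1 + z ^+ 2)^-1 - z ^- 2).
  rewrite in_itv /= => /andP[xz _].
  have z0 : z != 0 by rewrite gt_eqF // (lt_trans x0).
  have := is_deriveD (is_derive1_atan z) (is_deriveV z0 (is_derive_id z (1 : R))).
  by rewrite /GRing.scale /= mulr1.
have [|c cxy E] := MVT xy dg.
  apply: continuous_in_subspaceT => z; rewrite inE /= in_itv /= => /andP[xz _].
  apply: cvgD; first exact: continuous_atan.
  by apply: cvgV; [rewrite gt_eqF // (lt_le_trans x0)|exact: cvg_id].
have c0 : 0 < c by move: cxy; rewrite in_itv /= => /andP[/(lt_trans x0)].
have : g y <= g x.
  rewrite -subr_le0 E mulr_le0_ge0 ?subr_ge0 ?ltW // subr_lt0.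
  have c2 : 0 < c ^+ 2 by rewrite exprn_gt0.
  by rewrite ltf_pV2 ?posrE; lra.
rewrite /g => H; have : 0 < y^-1 by rewrite invr_gt0 (lt_trans x0).
by lra.
Qed.

Lemma pi2_sub_atan_le x : 0 < x -> pi / 2 - atan x <= x^-1.
Proof.
move=> x0; have C : (fun y : R => atan y - atan x) y @[y --> +oo] --> pi / 2 - atan x.
  by apply: cvgB; [exact: cvgy_atan|exact: cvg_cst].
apply: (cvgr_to_le C).
near=> y; apply: atan_sub_le => //; near: y; apply: nbhs_pinfty_ge; exact: num_real.
Unshelve. all: by end_near. Qed.

(** The integral over t in [a, b] of the kernels of centre t and height h, divided
    by pi. *)
Definition smooth_step a b h x : R := (atan ((b - x) / h) - atan ((a - x) / h)) / pi.

Lemma smooth_step_ge0 a b h x : 0 < h -> a <= b -> 0 <= smooth_step a b h x.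
Proof.
move=> h0 ab; rewrite divr_ge0 ?pi_ge0 // subr_ge0 le_atan //.
by rewrite ler_pM2r ?invr_gt0 // lerD2r.
Qed.

Lemma smooth_step_le1 a b h x : smooth_step a b h x <= 1.
Proof.
rewrite /smooth_step ler_pdivrMr ?pi_gt0 // mul1r.
by have := atan_ltpi2 ((b - x) / h); have := atan_gtNpi2 ((a - x) / h); lra.
Qed.

Lemma smooth_step_inside a b h x : 0 < h -> a < x < b ->
  1 - smooth_step a b h x <= (h / (b - x) + h / (x - a)) / pi.
Proof.
move=> h0 /andP[ax xb]; rewrite /smooth_step ler_pdivlMr ?pi_gt0 // mulrBl mul1r.
rewrite divfK ?gt_eqF ?pi_gt0 //.
have := @pi2_sub_atan_le ((b - x) / h); rewrite divr_gt0 ?subr_gt0 // invf_div => /(_ isT).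
have := @pi2_sub_atan_le ((x - a) / h); rewrite divr_gt0 ?subr_gt0 // invf_div => /(_ isT).
have -> : (a - x) / h = - ((x - a) / h) by rewrite -mulNr opprB.
rewrite atanN.
by lra.
Qed.

Lemma smooth_step_right a b h x : 0 < h -> a < b -> b < x ->
  smooth_step a b h x <= (b - a) * h / (x - b) ^+ 2 / pi.
Proof.
move=> h0 ab bx; rewrite ler_pM2r ?invr_gt0 ?pi_gt0 //.
have lt : (a - x) / h < (b - x) / h by rewrite ltr_pM2r ?invr_gt0 // ltrD2r.
have [c /andP[ac cb] ->] := atan_MVT lt.
have -> : (b - x) / h - (a - x) / h = (b - a) / h by field; rewrite gt_eqF.
have cb2 : ((x - b) / h) ^+ 2 <= c ^+ 2.
  have y0 : 0 < (x - b) / h by rewrite divr_gt0 ?subr_gt0.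
  have yc : (x - b) / h < - c by rewrite ltrNr -mulNr opprB.
  by rewrite -[c ^+ 2]sqrrN ler_sqr ?nnegrE; lra.
have xb0 : 0 < ((x - b) / h) ^+ 2 by rewrite exprn_gt0 // divr_gt0 // subr_gt0.
apply: (@le_trans _ _ ((((x - b) / h) ^+ 2)^-1 * ((b - a) / h))).
  rewrite ler_pM2r ?divr_gt0 ?subr_gt0 // lef_pV2 ?posrE //.
    by rewrite (le_trans cb2) // lerDr.
  by rewrite (lt_le_trans xb0) // (le_trans cb2) // lerDr.
rewrite le_eqVlt; apply/orP; left; apply/eqP; field.
by rewrite !gt_eqF ?subr_gt0.
Qed.

Lemma smooth_stepN a b h x : smooth_step a b h x = smooth_step (- b) (- a) h (- x).
Proof.
rewrite /smooth_step; congr (_ / _).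
have -> : (- a - - x) / h = - ((a - x) / h) by rewrite -mulNr opprB opprK addrC.
have -> : (- b - - x) / h = - ((b - x) / h) by rewrite -mulNr opprB opprK addrC.
by rewrite !atanN opprK addrC.
Qed.

Lemma smooth_step_left a b h x : 0 < h -> a < b -> x < a ->
  smooth_step a b h x <= (b - a) * h / (x - a) ^+ 2 / pi.
Proof.
move=> h0 ab xa; rewrite smooth_stepN.
have := @smooth_step_right (- b) (- a) h (- x) h0.
rewrite !ltrN2 => /(_ ab xa) H; apply: le_trans H _.
have -> : - a - - b = b - a by ring.
by have -> : (- x - - a) ^+ 2 = (x - a) ^+ 2 by ring.
Qed.

(** Between nearby centres the kernels are comparable, so that a Riemann sum of
    kernels differs from their integral by a small multiple of itself. *)
Lemma cauchy_kernel_near c t h e x : 0 < h -> `|c - t| <= e * h -> e <= 1 ->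
  `|cauchy_kernel c h x - cauchy_kernel t h x| <= 2 * e * cauchy_kernel t h x.
Proof.
move=> h0 ct e1; have e0 : 0 <= e.
  by rewrite -(pmulr_lge0 _ h0) (le_trans _ ct).
have A0 := sqr_shift_gt0 t x h0; have B0 := sqr_shift_gt0 c x h0.
have key : `|(x - t) ^+ 2 - (x - c) ^+ 2| <= 2 * e * ((x - c) ^+ 2 + h ^+ 2).
  have -> : (x - t) ^+ 2 - (x - c) ^+ 2 = (c - t) * (2 * (x - c) + (c - t)) by ring.
  rewrite normrM; apply: (@le_trans _ _ ((e * h) * (2 * `|x - c| + e * h))).
    apply: ler_pM => //; apply: le_trans (ler_normD _ _) _.
    by rewrite normrM ger0_norm // lerD2l.
  have H : 2 * h * `|x - c| <= (x - c) ^+ 2 + h ^+ 2.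
    rewrite -[(x - c) ^+ 2]real_normK ?num_real // -subr_ge0.
    by rewrite (_ : _ - _ = (`|x - c| - h) ^+ 2) ?sqr_ge0 //; ring.
  have H2 : e * h ^+ 2 <= h ^+ 2 by rewrite ler_piMl // sqr_ge0.
  have x2 := sqr_ge0 (x - c).
  have -> : e * h * (2 * `|x - c| + e * h) = e * (2 * h * `|x - c| + e * h ^+ 2) by ring.
  rewrite [leRHS](_ : _ = e * (2 * ((x - c) ^+ 2 + h ^+ 2))); last by ring.
  by rewrite ler_wpM2l //; lra.
rewrite /cauchy_kernel.
have -> : h / ((x - c) ^+ 2 + h ^+ 2) - h / ((x - t) ^+ 2 + h ^+ 2) =
  h / ((x - t) ^+ 2 + h ^+ 2) * (((x - t) ^+ 2 - (x - c) ^+ 2) / ((x - c) ^+ 2 + h ^+ 2)).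
  by field; rewrite !gt_eqF.
have k0 : 0 < h / ((x - t) ^+ 2 + h ^+ 2) by rewrite divr_gt0.
rewrite normrM (gtr0_norm k0) [leRHS]mulrC ler_pM2l //.
by rewrite normrM normfV (gtr0_norm B0) ler_pdivrMr.
Qed.

(** A Riemann sum for [smooth_step]. *)
Definition kernel_sum a b h (N : nat) x : R :=
  \sum_(i < N) (b - a) / N%:R / pi * cauchy_kernel (a + i%:R * ((b - a) / N%:R)) h x.

Lemma kernel_sum_ge0 a b h N x : 0 < h -> a <= b -> 0 <= kernel_sum a b h N x.
Proof.
move=> h0 ab; apply: sumr_ge0 => i _.
apply: mulr_ge0; last by rewrite ltW // cauchy_kernel_gt0.
by rewrite !divr_ge0 ?pi_ge0 ?subr_ge0.
Qed.

Lemma kernel_sum_near a b h N e x : 0 < h -> a < b -> (0 < N)%N ->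
  (b - a) / N%:R <= e * h -> e <= 1 ->
  `|smooth_step a b h x - kernel_sum a b h N x| <= 2 * e * kernel_sum a b h N x.
Proof.
move=> h0 ab N0 de e1; set d := (b - a) / N%:R in de *.
have N0' : 0 < N%:R :> R by rewrite ltr0n.
have d0 : 0 < d by rewrite divr_gt0 ?subr_gt0.
have pi0 : 0 < pi :> R by exact: pi_gt0.
pose t (i : nat) := a + i%:R * d.
have tS i : t i.+1 = t i + d by rewrite /t -natr1 mulrDl mul1r addrA.
have E : smooth_step a b h x =
  \sum_(i < N) (atan ((t i.+1 - x) / h) - atan ((t i - x) / h)) / pi.
  rewrite -mulr_suml -(big_mkord xpredT (fun i => atan ((t i.+1 - x) / h) - atan ((t i - x) / h))).
  rewrite telescope_sumr // /smooth_step; congr ((atan ((_ - x) / h) - atan ((_ - x) / h)) / _).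
    by rewrite /t mulrC divfK ?gt_eqF // addrC subrK.
  by rewrite /t mul0r addr0.
rewrite E /kernel_sum -/d -sumrB mulr_sumr.
apply: le_trans (ler_norm_sum _ _ _) _; apply: ler_sum => i _.
have lt : (t i - x) / h < (t i.+1 - x) / h.
  by rewrite ltr_pM2r ?invr_gt0 // ltrD2r tS ltrDl.
have [c /andP[c1 c2] ->] := atan_MVT lt.
have {}c1 : t i - x < c * h by rewrite -ltr_pdivrMr.
have {}c2 : c * h < t i.+1 - x by rewrite -ltr_pdivlMr.
have -> : (1 + c ^+ 2)^-1 * ((t i.+1 - x) / h - (t i - x) / h) =
    d * cauchy_kernel (x + c * h) h x.
  rewrite tS /cauchy_kernel (_ : (x - (x + c * h)) ^+ 2 + h ^+ 2 = (1 + c ^+ 2) * h ^+ 2); last by ring.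
  by field; rewrite !gt_eqF //= ltr_wpDr ?sqr_ge0 // ltr01.
have -> : d * cauchy_kernel (x + c * h) h x / pi - d / pi * cauchy_kernel (a + i%:R * d) h x
    = d / pi * (cauchy_kernel (x + c * h) h x - cauchy_kernel (t i) h x).
  by rewrite /t mulrBr mulrAC.
have k0 : 0 < d / pi by rewrite divr_gt0.
rewrite normrM (gtr0_norm k0) mulrCA ler_pM2l //.
apply: cauchy_kernel_near => //; apply: le_trans de.
by move: c2; rewrite tS ler_norml; lra.
Qed.

Lemma kernel_sum_le3 a b h N e x : 0 < h -> a < b -> (0 < N)%N ->
  (b - a) / N%:R <= e * h -> e <= 3^-1 -> kernel_sum a b h N x <= 3.
Proof.
move=> h0 ab N0 de e3; have e1 : e <= 1 by lra.
have := kernel_sum_near x h0 ab N0 de e1; have := smooth_step_le1 a b h x.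
have := @kernel_sum_ge0 a b h N x h0 (ltW ab).
rewrite ler_norml => k0 s1 /andP[+ _].
have : e * kernel_sum a b h N x <= 3^-1 * kernel_sum a b h N x by rewrite ler_wpM2r.
by lra.
Qed.

(** A list of triples (coefficient, centre, height) encodes a linear combination of
    kernels. *)
Definition comb (l : seq (R * R * R)) x : R :=
  \sum_(p <- l) p.1.1 * cauchy_kernel p.1.2 p.2 x.

Definition heights_pos (l : seq (R * R * R)) := all (fun p => 0 < p.2) l.

Definition weight (l : seq (R * R * R)) : R := \sum_(p <- l) `|p.1.1|.

Definition scale_comb k (l : seq (R * R * R)) := [seq (k * p.1.1, p.1.2, p.2) | p <- l].

Lemma comb_cat l1 l2 x : comb (l1 ++ l2) x = comb l1 x + comb l2 x.
Proof. by rewrite /comb big_cat. Qed.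

Lemma comb_cons p l x : comb (p :: l) x = p.1.1 * cauchy_kernel p.1.2 p.2 x + comb l x.
Proof. by rewrite /comb big_cons. Qed.

Lemma comb_scale k l x : comb (scale_comb k l) x = k * comb l x.
Proof. by rewrite /comb big_map mulr_sumr; apply: eq_bigr => p _; rewrite /= mulrA. Qed.

Lemma weight_cat l1 l2 : weight (l1 ++ l2) = weight l1 + weight l2.
Proof. by rewrite /weight big_cat. Qed.

Lemma weight_cons p l : weight (p :: l) = `|p.1.1| + weight l.
Proof. by rewrite /weight big_cons. Qed.

Lemma weight_scale k l : weight (scale_comb k l) = `|k| * weight l.
Proof. by rewrite /weight big_map mulr_sumr; apply: eq_bigr => p _; rewrite /= normrM. Qed.

Lemma heights_pos_scale k l : heights_pos (scale_comb k l) = heights_pos l.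
Proof. by rewrite /heights_pos all_map; apply: eq_all. Qed.

Definition kernel_nodes a b h N : seq (R * R * R) :=
  [seq ((b - a) / N%:R / pi, a + i%:R * ((b - a) / N%:R), h) | i <- iota 0 N].

Lemma comb_nodes a b h N x : comb (kernel_nodes a b h N) x = kernel_sum a b h N x.
Proof.
rewrite /comb big_map /kernel_sum -(big_mkord xpredT (fun i => (b - a) / N%:R / pi *
   cauchy_kernel (a + i%:R * ((b - a) / N%:R)) h x)) /index_iota subn0.
by [].
Qed.

Lemma heights_pos_nodes a b h N : 0 < h -> heights_pos (kernel_nodes a b h N).
Proof. by move=> h0; apply/allP => _ /mapP[i _ ->]. Qed.

Lemma weight_nodes a b h N : a <= b -> (0 < N)%N ->
  weight (kernel_nodes a b h N) = (b - a) / pi.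
Proof.
move=> ab N0; rewrite /weight big_map /=.
rewrite ger0_norm ?divr_ge0 ?subr_ge0 ?pi_ge0 //.
rewrite big_const_seq count_predT size_iota iter_addr addr0 -[LHS]mulr_natr.
have N1 : N%:R != 0 :> R by rewrite pnatr_eq0 -lt0n.
by rewrite mulrAC divfK.
Qed.

(** The two atoms correct the value 1/2 of the smoothed step at the endpoints,
    to converge to the indicator of the half-open interval at every point. *)
Definition indicator_comb a b (m : nat) : seq (R * R * R) :=
  let h := m.+1%:R^-1 in
  [:: (h / 2, a, h), (- (h / 2), b, h) & kernel_nodes a b h (m.+1 ^ 2)%N].

Lemma indicator_comb_pos a b m : heights_pos (indicator_comb a b m).
Proof.
have h0 : 0 < m.+1%:R^-1 :> R by rewrite invr_gt0 ltr0Sn.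
have := heights_pos_nodes a b (m.+1 ^ 2)%N h0; rewrite /indicator_comb.
by move: (kernel_nodes _ _ _ _) => l lpos; rewrite /heights_pos /= h0.
Qed.

Lemma comb_indicatorE a b m x (h := m.+1%:R^-1) :
  comb (indicator_comb a b m) x =
  h / 2 * cauchy_kernel a h x - h / 2 * cauchy_kernel b h x
    + kernel_sum a b h (m.+1 ^ 2)%N x.
Proof. by rewrite /indicator_comb 2!comb_cons comb_nodes mulNr addrA. Qed.

Lemma mesh_height a b m (h := m.+1%:R^-1) :
  (b - a) / (m.+1 ^ 2)%:R <= ((b - a) * h) * h.
Proof. by rewrite natrX -exprVn expr2 mulrA. Qed.

Lemma indic_itvE a b x : \1_(`[a, b[ : set R) x = (a <= x < b)%R%:R :> R.
Proof. by rewrite indicE; congr ((nat_of_bool _)%:R); apply/idP/idP; rewrite inE /= in_itv. Qed.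

Lemma half_le_kernel t r x : 0 < r -> `|x - t| <= r ->
  1 <= 2 * r * cauchy_kernel t r x.
Proof.
move=> r0 xr; rewrite /cauchy_kernel mulrA ler_pdivlMr ?sqr_shift_gt0 // mul1r.
have : (x - t) ^+ 2 <= r ^+ 2.
  by rewrite -real_normK ?num_real // ler_sqr ?nnegrE // ltW.
by rewrite -mulrA -expr2; lra.
Qed.

Lemma far_le_kernel t r x c : 0 < r -> 0 <= c -> r <= `|x - t| ->
  c / (x - t) ^+ 2 <= 2 * c / r * cauchy_kernel t r x.
Proof.
move=> r0 c0 xr; have H : r ^+ 2 <= (x - t) ^+ 2.
  by rewrite -[leRHS]real_normK ?num_real // ler_sqr ?nnegrE // ltW.
have r2 : 0 < r ^+ 2 by rewrite exprn_gt0.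
have y2 : 0 < (x - t) ^+ 2 by exact: lt_le_trans H.
rewrite /cauchy_kernel (_ : 2 * c / r * _ = c * (2 / ((x - t) ^+ 2 + r ^+ 2))); last first.
  by field; rewrite !gt_eqF // ltr_wpDl // ltW.
rewrite ler_wpM2l // ler_pdivlMr ?ltr_wpDl ?(ltW y2) // mulrC ler_pdivrMr //.
by lra.
Qed.

(** Near an endpoint, a kernel of height r dominates 1; elsewhere the error is
    O(h) and decays like the square of the distance, so a kernel dominates it. *)
Lemma indicator_step_near a b h r x : 0 < h -> 0 < r -> a < b ->
  `|\1_(`[a, b[ : set R) x - smooth_step a b h x| <=
  (2 * r + 2 * ((b - a) * h / pi) / r) * (cauchy_kernel a r x + cauchy_kernel b r x)
  + 4 * (b - a) * h / (pi * r) * cauchy_kernel a (b - a) x.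
Proof.
move=> h0 r0 ab; rewrite indic_itvE.
have pi0 : 0 < pi :> R by exact: pi_gt0.
have l0 : 0 < b - a by rewrite subr_gt0.
have ka := cauchy_kernel_gt0 a x r0; have kb := cauchy_kernel_gt0 b x r0.
have kl := cauchy_kernel_gt0 a x l0.
set c1 := 2 * r; set c2 := 2 * ((b - a) * h / pi) / r; set c3 := 4 * (b - a) * h / _.
have p1 : 0 < c1 by rewrite mulr_gt0.
have p2 : 0 < c2 by rewrite divr_gt0 // mulr_gt0 // divr_gt0 // mulr_gt0.
have p3 : 0 < c3 by rewrite divr_gt0 ?mulr_gt0.
have q1a := mulr_gt0 p1 ka; have q1b := mulr_gt0 p1 kb.
have q2a := mulr_gt0 p2 ka; have q2b := mulr_gt0 p2 kb; have q3 := mulr_gt0 p3 kl.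
have s0 := @smooth_step_ge0 a b h x h0 (ltW ab); have s1 := smooth_step_le1 a b h x.
have triv : `|(a <= x < b)%R%:R - smooth_step a b h x| <= 1.
  by rewrite ler_norml; case: (a <= x < b) => /=; lra.
rewrite [X in _ <= X + _]mulrDl !mulrDr.
have [xa|xa] := leP `|x - a| r.
  by have := half_le_kernel r0 xa; rewrite -/c1; lra.
have [xb|xb] := leP `|x - b| r.
  by have := half_le_kernel r0 xb; rewrite -/c1; lra.
have c0 : 0 <= (b - a) * h / pi by rewrite divr_ge0 ?mulr_ge0 ?ltW.
have [ax|ax] := leP a x; last first.
  rewrite /= sub0r normrN ger0_norm //.
  have := smooth_step_left h0 ab ax; have := far_le_kernel r0 c0 (ltW xa).
  by rewrite -/c2 [_ / pi / _]mulrAC; lra.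
have [xlb|bx] := ltP x b; last first.
  rewrite /= sub0r normrN ger0_norm //.
  have bx' : b < x.
    by rewrite lt_neqAle bx andbT; apply: contraTneq xb => ->; rewrite subrr normr0 -leNgt ltW.
  have := smooth_step_right h0 ab bx'; have := far_le_kernel r0 c0 (ltW xb).
  by rewrite -/c2 [_ / pi / _]mulrAC; lra.
have axr : r < x - a by move: xa; rewrite ger0_norm // subr_ge0.
have xbr : r < b - x by move: xb; rewrite distrC ger0_norm // subr_ge0 ltW.
rewrite /= ger0_norm ?subr_ge0 //.
have ax' : a < x < b by lra.
have := smooth_step_inside h0 ax'.
have i1 : h / (b - x) <= h / r by rewrite ler_pM2l // lef_pV2 ?posrE; lra.
have i2 : h / (x - a) <= h / r by rewrite ler_pM2l // lef_pV2 ?posrE; lra.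
have i3 : (h / (b - x) + h / (x - a)) / pi <= 2 * h / (pi * r).
  have E (q : R) : q != 0 -> 2 * h / (q * r) * q = h / r + h / r.
    by move=> q0; field; rewrite q0 gt_eqF.
  by rewrite ler_pdivrMr // E ?gt_eqF //; exact: lerD.
have i4 : 2 * h / (pi * r) <= c3 * cauchy_kernel a (b - a) x.
  have -> : c3 * cauchy_kernel a (b - a) x =
      2 * h / (pi * r) * (2 * (b - a) * cauchy_kernel a (b - a) x).
    by rewrite /c3; move: (pi * r)^-1 (b - a) (cauchy_kernel _ _ _) => q l k; ring.
  apply: ler_peMr; first by rewrite divr_ge0 // mulr_ge0 // ltW.
  by apply: half_le_kernel => //; rewrite ger0_norm; lra.
by lra.
Qed.

(** Approximation in the norm that Wegner's estimate controls: up to a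
    combination of kernels of small total weight, the indicator of an interval
    is a combination of kernels. *)
Lemma indicator_comb_approx a b e : a < b -> 0 < e ->
  exists m, exists chi, [/\ heights_pos chi, weight chi <= e &
    forall x, `|\1_(`[a, b[ : set R) x - comb (indicator_comb a b m) x| <= comb chi x].
Proof.
move=> ab e0; have l0 : 0 < b - a by rewrite subr_gt0.
have pi0 : 0 < pi :> R by exact: pi_gt0.
set l := b - a in l0 *; pose r := e / 8; have r0 : 0 < r by rewrite divr_gt0.
pose D := 8 * l / (pi * r) + 2 * l ^+ 2 / pi + 1.
have D1 : 0 < 8 * l / (pi * r) by rewrite divr_gt0 ?mulr_gt0.
have D2 : 0 < 2 * l ^+ 2 / pi by rewrite divr_gt0 ?mulr_gt0 ?exprn_gt0.
pose m := Num.truncn (2 * D / e + 3 * l).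
have m0 : 2 * D / e + 3 * l < m.+1%:R by exact: truncnS_gt.
have De0 : 0 < 2 * D / e by rewrite divr_gt0 // mulr_gt0 // /D; lra.
pose h : R := m.+1%:R^-1; have h0 : 0 < h by rewrite invr_gt0.
have hm : h * m.+1%:R = 1 by rewrite /h mulVf.
have hD : D * h <= e / 2.
  have : h * (2 * D / e) <= 1.
    rewrite -[leRHS]hm ler_pM2l //; apply: ltW; apply: le_lt_trans m0.
    by rewrite lerDl mulr_ge0 // ltW.
  by rewrite mulrA ler_pdivrMr // mul1r ler_pdivlMr //; move: (D) => D'; lra.
have hl : l * h <= 3^-1.
  have : h * (3 * l) <= 1.
    rewrite -[leRHS]hm ler_pM2l //; apply: ltW; apply: le_lt_trans m0.
    by rewrite lerDr ltW.
  by move: (l) (h) => l' h'; lra.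
have hl0 : 0 < l * h by rewrite mulr_gt0.
pose N := (m.+1 ^ 2)%N; have N0 : (0 < N)%N by rewrite expn_gt0.
pose c2 := 2 * r + 2 * (l * h / pi) / r; pose c3 := 4 * l * h / (pi * r).
have c20 : 0 < c2.
  by rewrite /c2 ltr_pwDl ?mulr_gt0 // ltW // divr_gt0 // mulr_gt0 // divr_gt0.
have c30 : 0 < c3 by rewrite divr_gt0 ?mulr_gt0.
exists m; exists ([:: (c2, a, r); (c2, b, r); (c3, a, l); (h / 2, a, h); (h / 2, b, h)]
   ++ scale_comb (2 * (l * h)) (kernel_nodes a b h N)); split.
- rewrite /heights_pos all_cat -!/(heights_pos _) heights_pos_scale heights_pos_nodes //.
  by rewrite /= r0 l0 h0.
- rewrite weight_cat weight_scale (weight_nodes _ (ltW ab) N0) !weight_cons /weight big_nil /=.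
  rewrite !gtr0_norm ?divr_gt0 ?mulr_gt0 // -/l.
  have -> : c2 + (c2 + (c3 + (h / 2 + (h / 2 + 0)))) + 2 * (l * h) * (l / pi)
    = 4 * r + D * h.
    rewrite /c2 /c3 /D; have : pi != 0 :> R by rewrite gt_eqF.
    by move: (pi : R) => q q0; field; rewrite q0 gt_eqF.
  by move: hD; rewrite /r; move: (D * h) => Dh; lra.
move=> x; rewrite comb_indicatorE -/h -/N comb_cat comb_scale comb_nodes !comb_cons.
rewrite /comb big_nil addr0 /=.
have s1 := indicator_step_near x h0 r0 ab; rewrite -/l -/c2 -/c3 in s1.
have s2 := kernel_sum_near x h0 ab N0 (mesh_height a b m).
have {}s2 := s2 (_ : l * h <= 1); rewrite -/l -/h in s2.
have {}s2 : `|smooth_step a b h x - kernel_sum a b h N x| <=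
      2 * (l * h) * kernel_sum a b h N x by apply: s2; lra.
have ka := mulr_gt0 (divr_gt0 h0 (ltr0Sn R 1)) (cauchy_kernel_gt0 a x h0).
have kb := mulr_gt0 (divr_gt0 h0 (ltr0Sn R 1)) (cauchy_kernel_gt0 b x h0).
move: s1 s2; rewrite !ler_norml => /andP[s11 s12] /andP[s21 s22].
by apply/andP; split; lra.
Qed.

(** Rate of pointwise convergence, with a constant that depends on x. *)
Lemma smooth_step_limit a b x : a < b -> exists C, forall h, 0 < h ->
  `|\1_(`[a, b[ : set R) x - (h / 2 * cauchy_kernel a h x - h / 2 * cauchy_kernel b h x
     + smooth_step a b h x)| <= C * h + C * h ^+ 2.
Proof.
move=> ab; have l0 : 0 < b - a by rewrite subr_gt0.
have pi0 : 0 < pi :> R by exact: pi_gt0.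
have kxx t h : 0 < h -> h / 2 * cauchy_kernel t h t = 2^-1.
  by move=> h0; rewrite /cauchy_kernel subrr expr0n add0r; field; rewrite gt_eqF.
have k0 t h : 0 < h -> 0 <= h / 2 * cauchy_kernel t h x.
  by move=> h0; apply: mulr_ge0; [rewrite divr_ge0 // ltW|rewrite ltW // cauchy_kernel_gt0].
have kt t h : x != t -> 0 < h -> h / 2 * cauchy_kernel t h x <= ((x - t) ^+ 2)^-1 * h ^+ 2.
  move=> xt h0; have y2 : 0 < (x - t) ^+ 2 by rewrite exprn_even_gt0 //= subr_eq0.
  have h2 : 0 < h ^+ 2 by rewrite exprn_gt0.
  have -> : h / 2 * cauchy_kernel t h x = h ^+ 2 * (2 * ((x - t) ^+ 2 + h ^+ 2))^-1.
    by rewrite /cauchy_kernel invfM mulrACA -expr2.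
  rewrite mulrC ler_pM2r // lef_pV2 ?posrE; lra.
have fin (I ka kb s c1 Ca Cb h : R) : 0 < h -> 0 <= ka <= Ca * h ^+ 2 -> 0 <= kb <= Cb * h ^+ 2 ->
    `|I - s| <= c1 * h -> 0 <= c1 -> 0 <= Ca -> 0 <= Cb ->
    `|I - (ka - kb + s)| <= (c1 + Ca + Cb) * h + (c1 + Ca + Cb) * h ^+ 2.
  move=> h0 /andP[ka0 ka1] /andP[kb0 kb1]; rewrite !ler_norml => /andP[Is1 Is2] c0 Ca0 Cb0.
  have h2 : 0 <= h ^+ 2 by exact: sqr_ge0.
  have q1 := mulr_ge0 c0 h2; have q2 := mulr_ge0 Ca0 (ltW h0); have q3 := mulr_ge0 Cb0 (ltW h0).
  by apply/andP; split; lra.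
pose Ca := ((x - a) ^+ 2)^-1; pose Cb := ((x - b) ^+ 2)^-1.
have Ca0 : 0 <= Ca by rewrite invr_ge0 sqr_ge0.
have Cb0 : 0 <= Cb by rewrite invr_ge0 sqr_ge0.
have step0 h : 0 < h -> `|2^-1 - atan ((b - a) / h) / pi| <= (b - a)^-1 / pi * h.
  move=> h0; have y0 : 0 < (b - a) / h by rewrite divr_gt0.
  have := pi2_sub_atan_le y0; rewrite invf_div => H.
  have := atan_ltpi2 ((b - a) / h) => H'.
  rewrite (_ : 2^-1 - _ = (pi / 2 - atan ((b - a) / h)) / pi); last first.
    have E (q t : R) : q != 0 -> 2^-1 - t / q = (q / 2 - t) / q by move=> q0; field.
    by apply: E; rewrite gt_eqF.
  rewrite ger0_norm; last by rewrite divr_ge0 ?(ltW pi0) // subr_ge0 ltW.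
  by rewrite mulrAC [(b - a)^-1 * h]mulrC ler_pM2r ?invr_gt0.
rewrite indic_itvE.
have [xa|ax|xa] := ltgtP x a.
- have c0 : 0 <= (b - a) / (x - a) ^+ 2 / pi.
    by rewrite !divr_ge0 ?sqr_ge0 ?(ltW pi0) ?(ltW l0).
  have xb : x != b by rewrite lt_eqF // (lt_trans xa).
  exists ((b - a) / (x - a) ^+ 2 / pi + Ca + Cb) => h h0; apply: fin => //.
  + by rewrite k0 // kt // lt_eqF.
  + by rewrite k0 // kt.
  + rewrite /= sub0r normrN ger0_norm ?smooth_step_ge0 ?(ltW ab) //.
    apply: le_trans (smooth_step_left h0 ab xa) _.
    by rewrite [(b - a) * h / _]mulrAC [_ * h / pi]mulrAC.
- have [xb|bx|xb] := ltgtP x b.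
  + pose c1 := ((b - x)^-1 + (x - a)^-1) / pi.
    have c0 : 0 <= c1 by rewrite divr_ge0 ?(ltW pi0) // addr_ge0 // invr_ge0; lra.
    exists (c1 + Ca + Cb) => h h0; apply: fin => //.
    * by rewrite k0 // kt // gt_eqF.
    * by rewrite k0 // kt // lt_eqF.
    * have axb : a < x < b by rewrite ax.
      rewrite /= ger0_norm ?subr_ge0 ?smooth_step_le1 //.
      apply: le_trans (smooth_step_inside h0 axb) _.
      have E (y z q : R) : (h * y + h * z) * q = (y + z) * q * h by ring.
      by rewrite (E _ _ (pi^-1)).
  + have c0 : 0 <= (b - a) / (x - b) ^+ 2 / pi.
      by rewrite !divr_ge0 ?sqr_ge0 ?(ltW pi0) ?(ltW l0).
    exists ((b - a) / (x - b) ^+ 2 / pi + Ca + Cb) => h h0; apply: fin => //.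
    * by rewrite k0 // kt // gt_eqF.
    * by rewrite k0 // kt // gt_eqF.
    * rewrite /= sub0r normrN ger0_norm ?smooth_step_ge0 ?(ltW ab) //.
      apply: le_trans (smooth_step_right h0 ab bx) _.
      by rewrite [(b - a) * h / _]mulrAC [_ * h / pi]mulrAC.
  + pose c1 := (b - a)^-1 / pi.
    have c0 : 0 <= c1 by rewrite divr_ge0 ?invr_ge0 ?(ltW pi0) ?(ltW l0).
    exists (c1 + Ca + Cb) => h h0.
    have xa : x != a by rewrite gt_eqF.
    have sE : smooth_step a b h x = atan ((b - a) / h) / pi.
      rewrite /smooth_step xb subrr mul0r atan0 sub0r -atanN.
      by rewrite -mulNr opprB.
    have -> : h / 2 * cauchy_kernel b h x = 2^-1 by rewrite xb kxx.
    rewrite /= (_ : _ - _ = 2^-1 - (h / 2 * cauchy_kernel a h x - 0 + smooth_step a b h x)); last first.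
      by rewrite subr0 sub0r !opprD opprK addrCA addrA.
    apply: fin => //.
    * by rewrite k0 // kt.
    * by rewrite lexx mulr_ge0 ?sqr_ge0.
    * by rewrite sE; exact: step0.
- pose c1 := (b - a)^-1 / pi.
  have c0 : 0 <= c1 by rewrite divr_ge0 ?invr_ge0 ?(ltW pi0) ?(ltW l0).
  exists (c1 + Ca + Cb) => h h0.
  have xb : x != b by rewrite xa lt_eqF.
  have sE : smooth_step a b h x = atan ((b - a) / h) / pi.
    by rewrite /smooth_step xa subrr mul0r atan0 subr0.
  have -> : h / 2 * cauchy_kernel a h x = 2^-1 by rewrite xa kxx.
  have E (u s : R) : 1 - (2^-1 - u + s) = 2^-1 - (0 - u + s) by field.
  have xltb : x < b by rewrite xa.
  rewrite xltb E.
  apply: fin => //.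
  + by rewrite lexx mulr_ge0 ?sqr_ge0.
  + by rewrite k0 // kt.
  + by rewrite sE; exact: step0.
Qed.

(** Pointwise convergence serves to prove that numbers of eigenvalues in intervals
    are measurable. *)
Lemma indicator_comb_cvg a b x : a < b ->
  comb (indicator_comb a b m) x @[m --> \oo] --> (\1_(`[a, b[ : set R) x : R).
Proof.
move=> ab; have [C HC] := smooth_step_limit x ab.
have l0 : 0 < b - a by rewrite subr_gt0.
pose h (m : nat) : R := m.+1%:R^-1.
have hc : h m @[m --> \oo] --> (0 : R) by exact: cvg_harmonic.
have h0 m : 0 < h m by rewrite invr_gt0.
apply/subr_cvg0; apply/norm_cvg0P.
have bnd : \forall m \near \oo, `|comb (indicator_comb a b m) x - \1_(`[a, b[ : set R) x| <=
    C * h m + C * (h m * h m) + 6 * ((b - a) * h m).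
  have : \forall m \near \oo, h m < (3 * (b - a))^-1.
    by apply: (cvgr_lt (0 : R)) => //; rewrite invr_gt0 mulr_gt0.
  apply: filterS => m hm; have hl : (b - a) * h m <= 3^-1.
    have : (b - a) * h m < (b - a) * (3 * (b - a))^-1 by rewrite ltr_pM2l.
    rewrite (_ : (b - a) * (3 * (b - a))^-1 = 3^-1); last by field; rewrite gt_eqF.
    exact: ltW.
  have N0 : (0 < m.+1 ^ 2)%N by rewrite expn_gt0.
  have hl1 : (b - a) * h m <= 1 by lra.
  have s2 : `|smooth_step a b (h m) x - kernel_sum a b (h m) (m.+1 ^ 2) x| <=
      2 * ((b - a) * h m) * kernel_sum a b (h m) (m.+1 ^ 2) x.
    exact: kernel_sum_near x (h0 m) ab N0 (mesh_height a b m) hl1.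
  have s3 := kernel_sum_le3 x (h0 m) ab N0 (mesh_height a b m) hl.
  have s1 := HC _ (h0 m).
  rewrite comb_indicatorE -/(h m) distrC.
  have e0 : 0 <= (b - a) * h m by rewrite mulr_ge0 ?ltW.
  have s4 : 2 * ((b - a) * h m) * kernel_sum a b (h m) (m.+1 ^ 2) x <= 6 * ((b - a) * h m).
    have : ((b - a) * h m) * kernel_sum a b (h m) (m.+1 ^ 2) x <= ((b - a) * h m) * 3 by rewrite ler_wpM2l.
    by rewrite -[2 * _ * _]mulrA; lra.
  move: s1 s2; rewrite expr2 !ler_norml => /andP[s11 s12] /andP[s21 s22].
  by apply/andP; split; lra.
have Z : (C * h m + C * (h m * h m) + 6 * ((b - a) * h m)) @[m --> \oo] --> (0 : R).
  rewrite (_ : (0 : R) = C * 0 + C * (0 * 0) + 6 * ((b - a) * 0)); last by rewrite !mulr0 !addr0.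
  apply: cvgD; first apply: cvgD.
  - by apply: cvgM => //; exact: cvg_cst.
  - by apply: cvgM; [exact: cvg_cst|exact: cvgM].
  - by apply: cvgM; [exact: cvg_cst|apply: cvgM => //; exact: cvg_cst].
apply: squeeze_cvgr (cvg_cst (0 : R)) Z.
by apply: filterS bnd => m ->; rewrite normr_ge0.
Qed.

End SmoothedIndicator.
(** * Means of nonnegative variables *)

Section Expectation.
Context {R : realType} d {T : measurableType d}.
Variable P : probability T R.
Implicit Types f g : T -> R.

Definition ge0_integrable f :=
  [/\ measurable_fun setT f, forall w, 0 <= f w & (\int[P]_w (f w)%:E < +oo)%E].

Definition mean f : R := fine (\int[P]_w (f w)%:E).

Lemma meanE f : ge0_integrable f -> (\int[P]_w (f w)%:E = (mean f)%:E)%E.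
Proof.
move=> [mf f0 fi]; rewrite /mean fineK // ge0_fin_numE //.
by apply: integral_ge0 => w _; rewrite lee_fin.
Qed.

Lemma mean_ge0 f : (forall w, 0 <= f w) -> 0 <= mean f.
Proof. by move=> f0; apply/fine_ge0/integral_ge0 => w _; rewrite lee_fin. Qed.

Lemma ge0_integrable_bound f c : measurable_fun setT f -> (forall w, 0 <= f w) ->
  (\int[P]_w (f w)%:E <= c%:E)%E -> ge0_integrable f /\ mean f <= c.
Proof.
move=> mf f0 fc; have fI : ge0_integrable f.
  by split => //; apply: le_lt_trans fc (ltry _).
by split => //; rewrite -lee_fin -meanE.
Qed.

Lemma mean_le f g : measurable_fun setT f -> (forall w, 0 <= f w <= g w) ->
  ge0_integrable g -> ge0_integrable f /\ mean f <= mean g.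
Proof.
move=> mf fg gI; have f0 w : 0 <= f w by have /andP[] := fg w.
apply: ge0_integrable_bound => //; rewrite -meanE //.
apply: ge0_le_integral => //.
- by move=> w _; rewrite lee_fin.
- exact/measurable_EFinP.
- by apply/measurable_EFinP; case: gI.
- by move=> w _; rewrite lee_fin; have /andP[] := fg w.
Qed.

Lemma meanD f g : ge0_integrable f -> ge0_integrable g ->
  ge0_integrable (fun w => f w + g w) /\ mean (fun w => f w + g w) = mean f + mean g.
Proof.
move=> fI gI; have [mf f0 _] := fI; have [mg g0 _] := gI.
have E : (\int[P]_w (f w + g w)%:E = (mean f + mean g)%:E)%E.
  under eq_integral do rewrite EFinD.
  rewrite ge0_integralD // ?meanE // ?EFinD //; do ?[exact/measurable_EFinP];
    by move=> w _; rewrite lee_fin.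
split; last by rewrite /mean E.
split; [exact: measurable_funD|by move=> w; rewrite addr_ge0|by rewrite E ltry].
Qed.

Lemma meanZ c f : 0 <= c -> ge0_integrable f ->
  ge0_integrable (fun w => c * f w) /\ mean (fun w => c * f w) = c * mean f.
Proof.
move=> c0 fI; have [mf f0 _] := fI.
have E : (\int[P]_w (c * f w)%:E = (c * mean f)%:E)%E.
  under eq_integral do rewrite EFinM.
  rewrite ge0_integralZl_EFin // ?meanE //; do ?[exact/measurable_EFinP];
    by move=> w _; rewrite lee_fin.
split; last by rewrite /mean E.
split; [exact: measurable_funM|by move=> w; rewrite mulr_ge0|by rewrite E ltry].
Qed.

Lemma mean_cst c : 0 <= c -> ge0_integrable (fun=> c) /\ mean (fun=> c) = c.
Proof.
move=> c0; have E : (\int[P]_w c%:E = c%:E)%E.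
  rewrite integral_cst // -[RHS]mule1; congr (_ * _)%E.
  exact: probability_setT.
split; last by rewrite /mean E.
by split => //; rewrite E ltry.
Qed.

Lemma mean_sum (J : Type) (r : seq J) (Q : pred J) (F : J -> T -> R) :
  (forall j, Q j -> ge0_integrable (F j)) ->
  ge0_integrable (fun w => \sum_(j <- r | Q j) F j w) /\
  mean (fun w => \sum_(j <- r | Q j) F j w) = \sum_(j <- r | Q j) mean (F j).
Proof.
move=> H; elim: r => [|j r [IH1 IH2]].
  by under eq_fun do rewrite big_nil; rewrite big_nil; exact: mean_cst.
under eq_fun do rewrite big_cons; rewrite big_cons.
case Qj : (Q j); last by split.
by rewrite -IH2; apply: meanD => //; exact: H.
Qed.

Lemma mean_indic (A : set T) : measurable A ->
  ge0_integrable (\1_A : T -> R) /\ mean (\1_A : T -> R) = fine (P A).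
Proof.
move=> mA; have E : (\int[P]_w ((\1_A : T -> R) w)%:E = P A)%E.
  by rewrite integral_indic // setIT.
split; last by rewrite /mean E.
split; [exact: measurable_indic|by move=> w; rewrite indicE|].
by rewrite E (le_lt_trans (probability_le1 P mA)) // ltry.
Qed.

Lemma fine_prob_le1 (A : set T) : measurable A -> 0 <= fine (P A) <= 1.
Proof.
move=> mA; rewrite fine_ge0 //= -lee_fin fineK ?fin_num_measure //.
exact: probability_le1.
Qed.

End Expectation.

(** * Linear statistics of point configurations *)

Section Statistics.
Context {R : realType}.
Implicit Types (f g : R -> R) (s : seq R).

Definition linstat f s : R := \sum_(x <- s) f x.

Lemma le_linstat f g s : (forall x, f x <= g x) -> linstat f s <= linstat g s.
Proof. by move=> fg; apply: ler_sum => x _. Qed.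

Lemma linstat_ge0 f s : (forall x, 0 <= f x) -> 0 <= linstat f s.
Proof. by move=> f0; apply: sumr_ge0 => x _. Qed.

Lemma linstat_comb l s :
  linstat (comb l) s = \sum_(p <- l) p.1.1 * linstat (cauchy_kernel p.1.2 p.2) s.
Proof.
rewrite /linstat /comb exchange_big /=; apply: eq_bigr => p _.
by rewrite mulr_sumr.
Qed.

Lemma linstatB f g s : linstat f s - linstat g s = linstat (fun x => f x - g x) s.
Proof. by rewrite /linstat sumrB. Qed.

Lemma linstat_norm f s : `|linstat f s| <= linstat (fun x => `|f x|) s.
Proof. exact: ler_norm_sum. Qed.

(** The difference is the sum of f x * f y over ordered pairs of distinct points,
    which increases with f >= 0. *)
Lemma le_pairstat f g s : (forall x, 0 <= f x <= g x) ->
  linstat f s ^+ 2 - linstat (fun x => f x ^+ 2) s <=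
  linstat g s ^+ 2 - linstat (fun x => g x ^+ 2) s.
Proof.
move=> fg; rewrite /linstat; elim: s => [|x s IH]; first by rewrite !big_nil.
rewrite !big_cons; have /andP[fx0 fxg] := fg x.
have f0 : 0 <= \sum_(y <- s) f y by apply: sumr_ge0 => y _; have /andP[] := fg y.
have fgs : \sum_(y <- s) f y <= \sum_(y <- s) g y.
  by apply: ler_sum => y _; have /andP[] := fg y.
have : f x * \sum_(y <- s) f y <= g x * \sum_(y <- s) g y by apply: ler_pM.
move: IH; move: (\sum_(y <- s) f y) (\sum_(y <- s) g y) (\sum_(y <- s) f y ^+ 2)
  (\sum_(y <- s) g y ^+ 2) => F G F2 G2.
by rewrite !sqrrD; lra.
Qed.

Lemma measurable_indic_stat d (T : measurableType d) (s : T -> seq R) a b :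
  (forall t h, 0 < h -> measurable_fun setT (fun w => linstat (cauchy_kernel t h) (s w))) ->
  a < b -> measurable_fun setT (fun w => linstat (\1_(`[a, b[ : set R)) (s w)).
Proof.
move=> ms ab.
apply: (@measurable_fun_cvg _ _ _ _ (fun m w => linstat (comb (indicator_comb a b m)) (s w))).
  move=> m; under eq_fun do rewrite linstat_comb.
  have : heights_pos (indicator_comb a b m) by exact: indicator_comb_pos.
  elim: (indicator_comb a b m) => [_|p l IH /= /andP[p0 l0]].
    by under eq_fun do rewrite big_nil; exact: measurable_cst.
  under eq_fun do rewrite big_cons; apply: measurable_funD; last exact: IH.
  by apply: measurable_funM => //; exact: ms.
move=> w _; rewrite /linstat; elim: (s w) => [|x l IH].
  by rewrite big_nil; under eq_fun do rewrite big_nil; exact: cvg_cst.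
rewrite big_cons; under eq_fun do rewrite big_cons.
by apply: cvgD => //; exact: indicator_comb_cvg.
Qed.

End Statistics.
Local Open Scope complex_scope.

(** * Eigenvalue statistics of random Jacobi matrices *)

Section JacobiDeterministic.
Context {R : realType}.
Implicit Types n : nat.

Lemma jacobi_sym n (a : 'I_n -> R) b : (jacobi a b)^T = jacobi a b.
Proof.
apply/matrixP => i j; rewrite !mxE eq_sym minnC [X in if X then oapp _ _ _ else _]orbC.
by case: eqP => // ->.
Qed.

Lemma jacobi_tridiagonal n (a : 'I_n -> R) b : tridiagonal (jacobi a b).
Proof.
move=> i j ij; rewrite mxE ifF; last by apply/eqP => E; move: ij; rewrite E; lia.
by rewrite ifF //; lia.
Qed.

Lemma jacobi_diag n (a : 'I_n -> R) b i : jacobi a b i i = a i.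
Proof. by rewrite mxE eqxx. Qed.

(** Some list of the eigenvalues; the value [::] is never taken for a symmetric
    matrix. *)
Definition eigs n (A : 'M[R]_n) : seq R := xget [::] [set s | eigenvalues_of A s].

Lemma eigsP n (A : 'M[R]_n) : A^T = A -> eigenvalues_of A (eigs A).
Proof.
by move=> /eigenvalues_exist [s sE]; rewrite /eigs; case: xgetP => [_ ->|/(_ s)].
Qed.

Definition rescale n (E : R) (s : seq R) := [seq n%:R * (x - E) | x <- s].

(** The spectral parameter at which the trace of the resolvent is the kernel
    (t, h) summed over the rescaled eigenvalues. *)
Definition zpar n (E t h : R) : R[i] := (E + t / n%:R) +i* (h / n%:R).

Lemma cauchy_kernel_rescale n E t h (x : R) : (0 < n)%N -> 0 < h ->
  cauchy_kernel t h (n%:R * (x - E)) =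
  n%:R^-1 * cauchy_kernel (E + t / n%:R) (h / n%:R) x.
Proof.
move=> n0 h0; have N0 : n%:R != 0 :> R by rewrite pnatr_eq0 -lt0n.
rewrite /cauchy_kernel.
have -> : (n%:R * (x - E) - t) ^+ 2 + h ^+ 2 =
   n%:R ^+ 2 * ((x - (E + t / n%:R)) ^+ 2 + (h / n%:R) ^+ 2).
  by move: (n%:R : R) N0 => N N0; field.
have D : (x - (E + t / n%:R)) ^+ 2 + (h / n%:R) ^+ 2 != 0.
  by rewrite gt_eqF // sqr_shift_gt0 // divr_gt0 // ltr0n.
move: ((x - _) ^+ 2 + _) D => D D0; move: (n%:R : R) N0 => N N0.
by field; rewrite N0 D0.
Qed.

Lemma zpar_Im n E t h : (0 < n)%N -> 0 < h -> 0 < complex.Im (zpar n E t h).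
Proof. by move=> n0 h0; rewrite /= divr_gt0 // ltr0n. Qed.

Lemma linstat_kernel n k (A : 'M[R]_k) s E t h : A^T = A -> (0 < n)%N -> 0 < h ->
  eigenvalues_of A s ->
  linstat (cauchy_kernel t h) (rescale n E s) =
  n%:R^-1 * \sum_i complex.Im (resolvent A (zpar n E t h) i i).
Proof.
move=> As n0 h0 sE; rewrite (trace_resolvent As (zpar_Im E t n0 h0) sE).
rewrite /linstat big_map mulr_sumr; apply: eq_bigr => x _.
exact: cauchy_kernel_rescale.
Qed.

Lemma linstat_kernel_sqr n k (A : 'M[R]_k) s E t h : A^T = A -> (0 < n)%N -> 0 < h ->
  eigenvalues_of A s ->
  linstat (fun x => cauchy_kernel t h x ^+ 2) (rescale n E s) =
  n%:R^-2 * \sum_i \sum_j complex.Im (resolvent A (zpar n E t h) i j) ^+ 2.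
Proof.
move=> As n0 h0 sE; rewrite (pair_resolvent As (zpar_Im E t n0 h0) sE).
rewrite /linstat big_map mulr_sumr; apply: eq_bigr => x _.
by rewrite cauchy_kernel_rescale // exprMn exprVn.
Qed.

(** Sums over pairs of distinct eigenvalues are sums of 2 x 2 minors of the
    imaginary part of the resolvent, hence bounded through Schur complements. *)
Lemma pairstat_kernel_le n k (A : 'M[R]_k) s E t h : A^T = A -> (0 < n)%N -> 0 < h ->
  eigenvalues_of A s ->
  linstat (cauchy_kernel t h) (rescale n E s) ^+ 2
    - linstat (fun x => cauchy_kernel t h x ^+ 2) (rescale n E s) <=
  n%:R^-2 * \sum_i \sum_(j | j != i) complex.Im (resolvent A (zpar n E t h) i i) *
      complex.Im (resolvent (isolate A i) (zpar n E t h) j j).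
Proof.
move=> As n0 h0 sE; have z0 := zpar_Im E t n0 h0.
rewrite (linstat_kernel _ _ As n0 h0 sE) (linstat_kernel_sqr _ _ As n0 h0 sE).
rewrite exprMn -exprVn -mulrBr ler_wpM2l ?exprn_ge0 ?invr_ge0 //.
rewrite expr2 mulr_suml -sumrB; apply: ler_sum => i _.
rewrite mulr_sumr -sumrB (bigD1 i) //= -expr2 subrr add0r.
by apply: ler_sum => j ji; exact: minami_pair.
Qed.

End JacobiDeterministic.

Section RandomJacobi.
Context {R : realType} d {T : measurableType d}.
Variable P : probability T R.
Variables (n : nat) (a : 'I_n -> T -> R) (b : 'I_n.-1 -> T -> R).
Let X (k : 'I_n + 'I_n.-1) (w : T) : R :=
  match k with inl i => a i w | inr i => b i w end.
Hypothesis mX : forall k, measurable_fun setT (X k).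
Hypothesis indep : independent P X.
Variable C : R.
Hypothesis C0 : 0 <= C.
Hypothesis aC : forall i, bounded_law P C (a i).
Let J w := jacobi (a ^~ w) (b ^~ w).

(** An entry depends on the one variable that it equals, if any. *)
Lemma measurable_jacobi (K : {set 'I_n + 'I_n.-1}) i j :
  (i = j -> inl i \in K) ->
  (forall k : 'I_n.-1, k = minn i j :> nat -> i != j -> inr k \in K) ->
  measurable_fun setT ((fun w => J w i j) : sigmaType X K -> R).
Proof.
move=> Ki Kb; under eq_fun do rewrite mxE.
have [ij|ij] := eqVneq i j; first exact: (@sigmaType_measurable_X _ _ _ _ X K (inl i) (Ki ij)).
case: (_ || _); last exact: measurable_cst.
case: insubP => [k _ kE|_] /=; last exact: measurable_cst.
exact: (@sigmaType_measurable_X _ _ _ _ X K (inr k) (Kb k kE ij)).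
Qed.

Section Submatrix.
Variables (k : nat) (f : 'I_k -> 'I_n).
Hypothesis f_inj : injective f.
Let A w := mxsub f f (J w).

Lemma submatrix_sym w : (A w)^T = A w.
Proof. by apply: trmx_mxsub_sym; exact: jacobi_sym. Qed.

Lemma measurable_submatrix_off x i j : ~~ ((i == x) && (j == x)) ->
  measurable_fun setT ((fun w => A w i j) : sigmaType X [set~ inl (f x)]%SET -> R).
Proof.
move=> ij; under eq_fun do rewrite mxE.
apply: measurable_jacobi => [/f_inj E|l _ _]; last by rewrite !inE.
rewrite !inE; apply: contra ij => /eqP [/f_inj ix].
by rewrite -E ix eqxx.
Qed.

Lemma measurable_submatrix i j : measurable_fun setT (fun w => A w i j).
Proof.
apply: (@sigmaType_measurable_fun _ _ _ _ _ mX [set: 'I_n + 'I_n.-1]%SET); under eq_fun do rewrite mxE.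
by apply: measurable_jacobi => *; rewrite inE.
Qed.

Lemma measurable_submatrix_resolvent z i j : complex.Im z != 0 ->
  cmeasurable (fun w => resolvent (A w) z i j).
Proof.
move=> z0; apply: cmeasurable_resolvent => //; first exact: submatrix_sym.
exact: measurable_submatrix.
Qed.

Lemma wegner_submatrix z x : 0 < complex.Im z ->
  ge0_integrable P (fun w => complex.Im (resolvent (A w) z x x)) /\
  mean P (fun w => complex.Im (resolvent (A w) z x x)) <= C * pi.
Proof.
move=> z0; apply: ge0_integrable_bound.
- by have [] := measurable_submatrix_resolvent x x (lt0r_neq0 z0).
- by move=> w; rewrite ltW // resolvent_diag_gt0 // submatrix_sym.
under eq_integral do rewrite -[X in X%:E]mul1r.
apply: (le_trans (wegner (k := inl (f x)) (C := C) (H := fun=> 1) mX indep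
  submatrix_sym z0 _ _ C0 (aC (f x)) _ _)).
- by move=> w; rewrite mxE jacobi_diag.
- exact: measurable_submatrix_off.
- exact: measurable_cst.
- by [].
by rewrite -[leRHS]mule1; apply: lee_wpmul2l; rewrite ?lee_fin ?mulr_ge0 ?pi_ge0 //
  integral_cst // mul1e; exact: probability_le1.
Qed.

Lemma minami_submatrix z x y : 0 < complex.Im z -> y != x ->
  ge0_integrable P (fun w => complex.Im (resolvent (A w) z x x) *
     complex.Im (resolvent (isolate (A w) x) z y y)) /\
  mean P (fun w => complex.Im (resolvent (A w) z x x) *
     complex.Im (resolvent (isolate (A w) x) z y y)) <= (C * pi) ^+ 2.
Proof.
move=> z0 yx; have zn := lt0r_neq0 z0; apply: ge0_integrable_bound.
- apply: measurable_funM; first by have [] := measurable_submatrix_resolvent x x zn.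
  have [] // := @cmeasurable_resolvent _ _ _ k (fun w => isolate (A w) x) z y y _ zn _.
  + by move=> w; apply: isolate_sym; exact: submatrix_sym.
  + move=> i j; under eq_fun do rewrite mxE; case: (_ || _); first exact: measurable_cst.
    exact: measurable_submatrix.
- move=> w; rewrite mulr_ge0 ?ltW // resolvent_diag_gt0 //; first exact: submatrix_sym.
  by apply: isolate_sym; exact: submatrix_sym.
apply: (minami (kx := inl (f x)) (ky := inl (f y)) mX indep submatrix_sym z0 yx) => //.
- by move=> w; rewrite mxE jacobi_diag.
- by move=> w; rewrite mxE jacobi_diag.
- exact: measurable_submatrix_off.
- exact: measurable_submatrix_off.
- exact: aC.
- exact: aC.
Qed.

Variables (s : T -> seq R) (E : R).
Hypothesis sP : forall w, eigenvalues_of (A w) (s w).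

(** Wegner's estimate, summed over the k sites of the submatrix. *)
Lemma mean_linstat t h : (0 < n)%N -> 0 < h ->
  ge0_integrable P (fun w => linstat (cauchy_kernel t h) (rescale n E (s w))) /\
  mean P (fun w => linstat (cauchy_kernel t h) (rescale n E (s w)))
    <= C * pi * (k%:R / n%:R).
Proof.
move=> n0 h0; have z0 := zpar_Im E t n0 h0.
under eq_fun do rewrite (linstat_kernel _ _ (submatrix_sym _) n0 h0 (sP _)).
have [I1 E1] := @mean_sum _ _ _ P _ (index_enum 'I_k) (xpredT) _
  (fun i _ => (wegner_submatrix i z0).1).
have [|I2 E2] := @meanZ _ _ _ P n%:R^-1 _ _ I1; first by rewrite invr_ge0.
split; first exact: I2.
rewrite E2 E1 mulrA mulrC ler_wpM2r ?invr_ge0 //.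
apply: (@le_trans _ _ (\sum_(i < k) C * pi)).
  by apply: ler_sum => i _; exact: (wegner_submatrix i z0).2.
by rewrite sumr_const card_ord -[leLHS]mulr_natr.
Qed.

(** Minami's estimate, summed over pairs of sites. As phi ^ 2 = phi, the statistic
    counts points, and the difference counts ordered pairs of distinct points. *)
Lemma mean_pairstat (phi : R -> R) c h : (0 < n)%N -> 0 < h -> 0 <= c ->
  measurable_fun setT (fun w => linstat phi (rescale n E (s w))) ->
  (forall x, 0 <= phi x <= c * cauchy_kernel 0 h x) -> (forall x, phi x ^+ 2 = phi x) ->
  ge0_integrable P (fun w => linstat phi (rescale n E (s w)) ^+ 2 - linstat phi (rescale n E (s w))) /\
  mean P (fun w => linstat phi (rescale n E (s w)) ^+ 2 - linstat phi (rescale n E (s w)))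
    <= (c * C * pi * (k%:R / n%:R)) ^+ 2.
Proof.
move=> n0 h0 c0 mphi phic phi2; have z0 := zpar_Im E 0 n0 h0.
pose F i j w := complex.Im (resolvent (A w) (zpar n E 0 h) i i) *
      complex.Im (resolvent (isolate (A w) i) (zpar n E 0 h) j j).
have FI i j : j != i -> ge0_integrable P (F i j) /\ mean P (F i j) <= (C * pi) ^+ 2.
  exact: minami_submatrix.
have [I1 E1] : ge0_integrable P (fun w => \sum_i \sum_(j | j != i) F i j w) /\
    mean P (fun w => \sum_i \sum_(j | j != i) F i j w) <= k%:R ^+ 2 * (C * pi) ^+ 2.
  have H i := @mean_sum _ _ _ P _ (index_enum 'I_k) (fun j => j != i) _ (fun j ji => (FI i j ji).1).
  have [I1 E1] := @mean_sum _ _ _ P _ (index_enum 'I_k) (xpredT) _ (fun i _ => (H i).1).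
  split; first exact: I1.
  rewrite E1; apply: (@le_trans _ _ (\sum_(i < k) \sum_(j < k) (C * pi) ^+ 2)).
    apply: ler_sum => i _; rewrite (H i).2 [leRHS](bigID (fun j => j != i)) /=.
    rewrite -[leLHS]addr0; apply: lerD; last by apply: sumr_ge0 => *; exact: sqr_ge0.
    by apply: ler_sum => j ji; exact: (FI i j ji).2.
  by rewrite !sumr_const !card_ord -mulrnA -[leLHS]mulr_natl expr2 natrM.
have n2 : 0 <= c ^+ 2 * n%:R^-2 :> R by rewrite mulr_ge0 ?sqr_ge0 // invr_ge0 exprn_ge0.
have [I2 E2] := @meanZ _ _ _ P _ _ n2 I1.
have phiE w : linstat phi (rescale n E (s w)) =
    linstat (fun x => phi x ^+ 2) (rescale n E (s w)).
  by apply: eq_bigr => x _; rewrite phi2.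
pose g w := linstat phi (rescale n E (s w)) ^+ 2 - linstat phi (rescale n E (s w)).
have mg : measurable_fun setT g by apply: measurable_funB => //; exact: measurable_funX.
have gle w : 0 <= g w <= c ^+ 2 * n%:R^-2 * \sum_i \sum_(j | j != i) F i j w.
  rewrite /g; apply/andP; split.
    have := @le_pairstat R (fun=> 0) phi (rescale n E (s w)).
    rewrite -phiE => H; apply: le_trans (H _); last first.
      by move=> x; rewrite lexx; have /andP[] := phic x.
    by rewrite /linstat !big1 ?expr0n ?subr0 // => x _; rewrite expr0n.
  rewrite [X in _ - X]phiE; apply: (le_trans (le_pairstat _ phic)).
  have -> : linstat (fun x => c * cauchy_kernel 0 h x) (rescale n E (s w)) =
      c * linstat (cauchy_kernel 0 h) (rescale n E (s w)) by rewrite /linstat mulr_sumr.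
  have -> : linstat (fun x => (c * cauchy_kernel 0 h x) ^+ 2) (rescale n E (s w)) =
      c ^+ 2 * linstat (fun x => cauchy_kernel 0 h x ^+ 2) (rescale n E (s w)).
    by rewrite /linstat mulr_sumr; apply: eq_bigr => x _; rewrite exprMn.
  rewrite exprMn -mulrBr -mulrA ler_wpM2l ?sqr_ge0 //.
  exact: pairstat_kernel_le (submatrix_sym _) n0 h0 (sP _).
have [I3 E3] := mean_le mg gle I2; split; first exact: I3.
apply: le_trans E3 _; rewrite E2.
apply: le_trans (ler_wpM2l n2 E1) _.
rewrite le_eqVlt; apply/orP; left; apply/eqP.
by rewrite !exprMn exprVn; move: (n%:R ^- 2) (k%:R ^+ 2) => N K; ring.
Qed.

End Submatrix.
End RandomJacobi.
Local Close Scope complex_scope.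
(** * Elementary estimates *)

Section Products.
Context {R : realType}.

(** The hypothesis says that phi takes the values 0 and 1. *)
Lemma linstat_count (phi : R -> R) s : (forall x, phi x ^+ 2 = phi x) ->
  linstat phi s = (count (fun x => phi x == 1) s)%:R.
Proof.
move=> phi2; rewrite /linstat -sum1_count natr_sum [RHS]big_mkcond.
apply: eq_bigr => x _; have [->//|p1] := eqVneq (phi x) 1.
have /eqP := phi2 x; rewrite expr2 -{3}[phi x]mulr1 -subr_eq0 -mulrBr mulf_eq0 subr_eq0.
by rewrite (negPf p1) orbF => /eqP.
Qed.

Lemma expRN_taylor (q : R) : 0 <= q <= 1 -> `|(1 - q) - expR (- q)| <= q ^+ 2.
Proof.
move=> /andP[q0 q1]; have h1 := expR_ge1Dx (- q); have h2 := expR_ge1Dx q.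
have h3 : expR (- q) <= 1 - q + q ^+ 2.
  rewrite expRN; apply: (@le_trans _ _ (1 + q)^-1).
    by rewrite lef_pV2 // posrE ?expR_gt0 //; lra.
  rewrite -[leLHS]mul1r ler_pdivrMr; last by lra.
  have : 0 <= q ^+ 3 by exact: exprn_ge0.
  rewrite (_ : (1 - q + q ^+ 2) * (1 + q) = 1 + q ^+ 3); last by ring.
  by lra.
by rewrite ler_norml; apply/andP; split; lra.
Qed.

(** Each factor is replaced in turn; all of them are at most 1. *)
Lemma prod_exp_le (I : Type) (r : seq I) (q : I -> R) : (forall i, 0 <= q i <= 1) ->
  `|\prod_(i <- r) (1 - q i) - expR (- \sum_(i <- r) q i)| <= \sum_(i <- r) q i ^+ 2.
Proof.
move=> q01; elim: r => [|i r IH]; first by rewrite !big_nil oppr0 expR0 subrr normr0.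
rewrite !big_cons opprD expRD; have /andP[q0 q1] := q01 i.
have h := expRN_taylor (q01 i).
have A0 : 0 <= \prod_(j <- r) (1 - q j) <= 1.
  elim: r {IH} => [|j r /andP[IH1 IH2]]; first by rewrite big_nil ler01 lexx.
  rewrite big_cons; have /andP[a0 a1] := q01 j; rewrite mulr_ge0 //=; last by lra.
  by rewrite mulr_ile1 //; lra.
have B0 : 0 <= expR (- q i) <= 1 by rewrite expR_ge0 /= expR_le1; lra.
move: A0 B0 IH h; move: (\prod_(j <- r) (1 - q j)) (expR (- q i)) (expR (- \sum_(j <- r) q j)).
move=> A e B /andP[A0 A1] /andP[e0 e1] IH h.
have -> : (1 - q i) * A - e * B = A * ((1 - q i) - e) + e * (A - B) by ring.
apply: le_trans (ler_normD _ _) _; rewrite !normrM (ger0_norm A0) (ger0_norm e0).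
apply: lerD; [apply: le_trans h|apply: le_trans IH]; exact: ler_piMl.
Qed.

Lemma expRN_lipschitz (x y : R) : 0 <= x -> 0 <= y ->
  `|expR (- x) - expR (- y)| <= `|x - y|.
Proof.
wlog xy : x y / x <= y.
  move=> H x0 y0; have [xy|/ltW yx] := leP x y; first exact: H.
  by rewrite distrC [leRHS]distrC; exact: H.
move=> x0 y0; rewrite [leRHS]distrC !ger0_norm ?subr_ge0 ?ler_expR ?lerN2 //.
have -> : - y = - x + (- (y - x)) by ring.
rewrite expRD -{1}[expR (- x)]mulr1 -mulrBr.
have h := expR_ge1Dx (- (y - x)); have e1 : expR (- x) <= 1 by rewrite expR_le1; lra.
have e0 := expR_ge0 (- x).
have : expR (- (y - x)) <= 1 by rewrite expR_le1; lra.
move: h; move: (expR (- (y - x))) => u h u1.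
by apply: le_trans (_ : 1 - u <= _); [apply: ler_piMl; lra|lra].
Qed.

Lemma dist_le_of (x y z : R) : x <= y + z -> y <= x + z -> `|y - x| <= z.
Proof. by move=> xy yx; rewrite ler_norml; apply/andP; split; lra. Qed.

End Products.

(** * Division of the indices into blocks *)

Section BlockIndices.
Variables n m L : nat.
Hypothesis L2 : (2 <= L)%N.
Hypothesis mL : (m * L <= n)%N.

Lemma block_first_subproof (p : 'I_m) : (p * L < n)%N.
Proof. by have := ltn_ord p; nia. Qed.
Lemma block_last_subproof (p : 'I_m) : (p * L + L.-1 < n)%N.
Proof. by have := ltn_ord p; nia. Qed.

Definition block_first p := Ordinal (block_first_subproof p).
Definition block_last p := Ordinal (block_last_subproof p).

Lemma block_lo_hi p : (block_first p < block_last p)%N.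
Proof. by rewrite /=; lia. Qed.

Lemma block_size p : (block_last p - block_first p).+1 = L.
Proof. by rewrite /=; lia. Qed.

(** The sites m * L, ..., n - 1 are left out of the blocks. *)
Lemma sum_blocks (R : pzRingType) (F : 'I_n -> R) :
  \sum_x F x =
  \sum_(p < m) \sum_(i < (block_last p - block_first p).+1) F (window i)
  + \sum_(x < n | (m * L <= x)%N) F x.
Proof.
pose G j := oapp F 0 (insub j).
have GE (x : 'I_n) : F x = G x by rewrite /G valK.
have -> : \sum_(p < m) \sum_(i < (block_last p - block_first p).+1) F (window i) =
    \sum_(0 <= j < m * L) G j.
  under eq_bigr => p _.
    under eq_bigr => i _ do rewrite GE windowE ?(ltnW (block_lo_hi p)) //.
    rewrite block_size /= -(big_mkord xpredT (fun i => G (p * L + i)%N)).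
    over.
  clear mL; elim: m => [|k IH]; first by rewrite big_ord0 mul0n big_geq.
  rewrite big_ord_recr IH /= mulSnr (big_cat_nat (leq0n _) (leq_addr _ _)) /=.
  congr (_ + _).
  rewrite [RHS](_ : _ = \sum_(0 + k * L <= i < L + k * L) G i);
    last by rewrite add0n addnC.
  rewrite big_addn addnK.
  by apply: eq_bigr => i _; rewrite addnC.
rewrite (bigID (fun x : 'I_n => (m * L <= x)%N)) /= addrC; congr (_ + _).
under eq_bigl do rewrite -ltnNge.
under eq_bigr do rewrite GE.
rewrite -(big_mkord (fun x => x < m * L)%N G).
rewrite (big_cat_nat (leq0n _) mL) /= [X in _ + X]big1_seq ?addr0; last first.
  by move=> j /andP[jm]; rewrite mem_index_iota leqNgt jm.
rewrite big_seq_cond [RHS]big_seq; apply: eq_bigl => j.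
by rewrite mem_index_iota; lia.
Qed.

(** The bonds between two blocks belong to neither. *)
Definition block_variables p : {set 'I_n + 'I_n.-1} := finset (fun k : 'I_n + 'I_n.-1 =>
  match k with
  | inl i => (block_first p <= i <= block_last p)%N
  | inr i => (block_first p <= i < block_last p)%N
  end).

Lemma block_variables_disjoint p q k : p != q ->
  k \in block_variables p -> k \notin block_variables q.
Proof.
move=> /eqP pq; rewrite !inE.
have {pq} : (p < q)%N || (q < p)%N.
  by rewrite -neq_ltn; apply/eqP => /val_inj.
by case: k => i /=; nia.
Qed.

Lemma block_variables_inl p (k : 'I_(block_last p - block_first p).+1) :
  inl (window k) \in block_variables p.
Proof.
have kb := ltn_ord k; rewrite inE windowE ?(ltnW (block_lo_hi p)) //=.
by rewrite /= in kb; lia.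
Qed.

Lemma block_variables_inr p (k l : 'I_(block_last p - block_first p).+1) (j : 'I_n.-1) :
  j = minn (window k) (window l) :> nat ->
  window k != window l -> inr j \in block_variables p.
Proof.
move=> jE kl; have uv := ltnW (block_lo_hi p).
have {}kl : window k <> window l :> nat by move=> /val_inj E0; rewrite E0 eqxx in kl.
have kb := ltn_ord k; have lb := ltn_ord l.
rewrite inE; rewrite (windowE k uv) (windowE l uv) /= in jE kl kb lb *.
by lia.
Qed.

End BlockIndices.

(** * Comparison of a Jacobi matrix with its diagonal blocks *)

Section Blocks.
Context {R : realType} d {T : measurableType d}.
Variable P : probability T R.
Variables (n : nat) (a : 'I_n -> T -> R) (b : 'I_n.-1 -> T -> R).
Let X (k : 'I_n + 'I_n.-1) (w : T) : R :=
  match k with inl i => a i w | inr i => b i w end.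
Hypothesis mX : forall k, measurable_fun setT (X k).
Hypothesis indep : independent P X.
Variable C : R.
Hypothesis C0 : 0 <= C.
Hypothesis aC : forall i, bounded_law P C (a i).
Hypothesis b_gt0 : forall i w, 0 < b i w.
Let J w := jacobi (a ^~ w) (b ^~ w).
Variables (M_B expo s M_s gamma delta E : R).
Hypothesis s0 : 0 < s.
Hypothesis s1 : s < 1.
Hypothesis expo1 : 1 < expo.
Hypothesis gamma0 : 0 < gamma.
Hypothesis Ms0 : 0 < M_s.
Hypothesis momB : forall i, (\int[P]_w (b i w `^ expo)%:E <= M_B%:E)%E.
Hypothesis decayG : forall (u v y x : 'I_n) (z : R[i]),
    (u < v)%N -> (y == u) || (y == v) -> (u <= x <= v)%N ->
    0 < complex.Im z -> Normc.normc (z - real_complex R E) < delta ->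
    (\int[P]_w (Normc.normc (green (J w) u v z y x) `^ s)%:E
      <= (M_s * expR (- gamma * `|y%:R - x%:R|))%:E)%E.

(** A trivial bound by 1 trades first moments, which may be infinite for Green
    functions, for small fractional moments. *)
Lemma min1_powR_le (x y r : R) : 0 <= x -> 0 <= y -> 0 < r <= 1 ->
  Num.min 1 (x + y) <= x `^ r + y `^ r.
Proof.
move=> x0 y0 /andP[r0 r1].
have H t : 0 <= t -> Num.min 1 t <= t `^ r.
  move=> t0; have [t1|t1] := leP 1 t.
    have <- : 1 `^ r = 1 by rewrite powR1.
    by rewrite ge0_ler_powR ?nnegrE ?ler01 // ltW.
  have [->|tn] := eqVneq t 0; first by rewrite powR_ge0.
  by apply: ger1_powR => //; rewrite ?(ltW t1) lt0r tn t0.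
apply: le_trans (lerD (H _ x0) (H _ y0)).
by case: (leP 1 x) => h1; case: (leP 1 y) => h2; case: (leP 1 (x + y)) => h3; lra.
Qed.

(** The parameter k balances a small factor g against a bounded factor q. *)
Lemma half_power_amgm (g q k r : R) : 0 <= g -> 0 <= q -> 0 < k ->
  (g * q) `^ (r / 2) <= (k * g `^ r + k^-1 * q `^ r) / 2.
Proof.
move=> g0 q0 k0.
have -> : (g * q) `^ (r / 2) = g `^ (r / 2) * q `^ (r / 2) by rewrite powRM.
have sq x : x `^ r = (x `^ (r / 2)) ^+ 2.
  by rewrite -powR_mulrn ?powR_ge0 // -powRrM divfK.
rewrite !sq; move: (g `^ _) (q `^ _) => x y.
have : 0 <= k * (x - k^-1 * y) ^+ 2 by rewrite mulr_ge0 ?sqr_ge0 // ltW.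
have -> : k * (x - k^-1 * y) ^+ 2 = k * x ^+ 2 + k^-1 * y ^+ 2 - 2 * (x * y).
  by field; rewrite gt_eqF.
by lra.
Qed.

(** The matrix is tridiagonal: at most one bond leaves the window on each side. *)
Lemma bond_before (u : 'I_n) :
  (exists k, forall w, \sum_(l < n | (l < u)%N) `|J w u l| = b k w) \/
  (forall w, \sum_(l < n | (l < u)%N) `|J w u l| = 0).
Proof.
case: (posnP u) => [u0|u0].
  by right => w; rewrite big1 // => l; rewrite u0.
have un := ltn_ord u; left.
have kn : (u.-1 < n.-1)%N by lia.
exists (Ordinal kn) => w; have ln : (u.-1 < n)%N by lia.
rewrite (bigD1 (Ordinal ln)) /=; last by rewrite prednK.
rewrite big1 ?addr0; last first.
  move=> l /andP[lu /eqP ll]; rewrite (jacobi_tridiagonal) ?normr0 //.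
  apply/orP; right; have : (l <> u.-1 :> nat) by move=> E0; apply: ll; apply: val_inj.
  lia.
rewrite mxE ifF; last by apply/eqP => /(congr1 val) /=; lia.
rewrite ifT ?prednK ?eqxx ?orbT //= insubT; first by rewrite minnE; lia.
move=> h /=; rewrite gtr0_norm //; congr (b _ w); apply: val_inj => /=.
by rewrite minnE; lia.
Qed.

Lemma bond_after (v : 'I_n) :
  (exists k, forall w, \sum_(l < n | (v < l)%N) `|J w v l| = b k w) \/
  (forall w, \sum_(l < n | (v < l)%N) `|J w v l| = 0).
Proof.
have vn := ltn_ord v; have [kn|nv] := ltnP v n.-1; last first.
  by right => w; rewrite big1 // => l; have := ltn_ord l; lia.
left; exists (Ordinal kn) => w; have ln : (v.+1 < n)%N by lia.
rewrite (bigD1 (Ordinal ln)) /=; last by [].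
rewrite big1 ?addr0; last first.
  move=> l /andP[lu /eqP ll]; rewrite (jacobi_tridiagonal) ?normr0 //.
  apply/orP; left; have : (l <> v.+1 :> nat) by move=> E0; apply: ll; apply: val_inj.
  lia.
rewrite mxE ifF; last by apply/eqP => /(congr1 val) /=; lia.
rewrite ifT ?eqxx //= insubT; first by rewrite minnE; lia.
move=> h /=; rewrite gtr0_norm //; congr (b _ w); apply: val_inj => /=.
by rewrite minnE; lia.
Qed.

Lemma measurable_powR_comp (f : T -> R) r : measurable_fun setT f ->
  measurable_fun setT (fun w => f w `^ r).
Proof. by move=> mf; exact: (measurableT_comp (measurable_powR r) mf). Qed.

(** b ^ s <= 1 + b ^ expo, as s < 1 < expo. *)
Lemma mean_bond k : ge0_integrable P (fun w => b k w `^ s) /\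
  mean P (fun w => b k w `^ s) <= 1 + `|M_B|.
Proof.
have mb : measurable_fun setT (b k) := mX (inr k).
have [I1 E1] : ge0_integrable P (fun w => b k w `^ expo) /\
    mean P (fun w => b k w `^ expo) <= `|M_B|.
  apply: ge0_integrable_bound; first exact: measurable_powR_comp.
    by move=> w; exact: powR_ge0.
  by apply: le_trans (momB k) _; rewrite lee_fin ler_norm.
have [I2 E2] := mean_cst P (@ler01 R); have [I3 E3] := meanD I2 I1.
have [] // := @mean_le _ _ _ P (fun w => b k w `^ s) _ _ _ I3.
- exact: measurable_powR_comp.
- move=> w; rewrite powR_ge0 /=; have [b1|b1] := leP (b k w) 1.
    apply: (@le_trans _ _ 1); last by rewrite lerDl powR_ge0.
    have <- : 1 `^ s = 1 by rewrite powR1.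
    by rewrite ge0_ler_powR ?nnegrE ?ler01 // ltW.
  apply: (@le_trans _ _ (b k w `^ expo)); last by rewrite lerDr.
  by rewrite ler_powR // ltW // (lt_trans s1).
- by move=> I4 E4; split => //; apply: le_trans E4 _; rewrite E3 E2 lerD2l.
Qed.

Lemma mean_bond_sum (f : T -> R) : 
  (exists k, forall w, f w = b k w) \/ (forall w, f w = 0) ->
  ge0_integrable P (fun w => f w `^ s) /\ mean P (fun w => f w `^ s) <= 1 + `|M_B|.
Proof.
move=> [[k fE]|fE]; first by have -> : f = b k by [apply/funext]; exact: mean_bond.
under eq_fun do rewrite fE powR0 ?gt_eqF //.
by have [I1 ->] := mean_cst P (lexx (0 : R)); split => //; rewrite addr_ge0.
Qed.

Lemma green_restrict (u v : 'I_n) (A : 'M[R]_n) z (i : 'I_(v - u).+1) : (u <= v)%N ->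
  green A u v z u (window i) = resolvent (Defs.restrict A u v) z ord0 i /\
  green A u v z v (window i) = resolvent (Defs.restrict A u v) z ord_max i.
Proof.
move=> uv; rewrite /green /resolvent windowE // addKn inord_val subnn.
by split; congr (_ _ i); apply: val_inj; rewrite /= inordK.
Qed.

Lemma measurable_normc (f : T -> R[i]) : cmeasurable f ->
  measurable_fun setT (fun w => Normc.normc (f w)).
Proof.
move=> [f1 f2].
rewrite (_ : (fun w => _) =
    (fun w => (complex.Re (f w) ^+ 2 + complex.Im (f w) ^+ 2) `^ 2^-1)); last first.
  apply/funext => w; case: (f w) => x y /=.
  by rewrite powR12_sqrt // addr_ge0 ?sqr_ge0.
apply: measurable_powR_comp.
by apply: measurable_funD; exact: measurable_funX.
Qed.

Lemma mxsub_id_id (A : 'M[R]_n) : mxsub id id A = A.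
Proof. by apply/matrixP => i j; rewrite mxE. Qed.

Lemma measurable_jacobi_resolvent z x : complex.Im z != 0 ->
  cmeasurable (fun w => resolvent (J w) z x x).
Proof.
move=> z0; under eq_fun do rewrite -[J _]mxsub_id_id.
exact: (measurable_submatrix_resolvent mX).
Qed.

Lemma measurable_block_resolvent (u v : 'I_n) z i j : (u <= v)%N ->
  complex.Im z != 0 ->
  cmeasurable (fun w => resolvent (Defs.restrict (J w) u v) z i j).
Proof.
move=> uv z0.
exact: (measurable_submatrix_resolvent mX (@window n u v)).
Qed.

Definition site_error (u v : 'I_n) z (i : 'I_(v - u).+1) w :=
  `|complex.Im (resolvent (J w) z (window i) (window i)) -
    complex.Im (resolvent (Defs.restrict (J w) u v) z i i)|.

Lemma measurable_site_error (u v : 'I_n) z (i : 'I_(v - u).+1) : (u <= v)%N ->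
  complex.Im z != 0 -> measurable_fun setT (site_error z i).
Proof.
move=> uv z0; apply: measurableT_comp => //; apply: measurable_funB.
  by have [] := measurable_jacobi_resolvent (window i) z0.
by have [] := measurable_block_resolvent i i uv z0.
Qed.

(** The error is at most (Im z)^-1 min (1, g b + g' b'), where g, g' are the Green
    functions of the block between the site and its ends, and b, b' the bonds cut
    at these ends. Fractional moments of order s of g and b are then separated by
    the inequality between geometric and arithmetic means: those of g are of order
    exp (- gamma l), those of b are bounded. *)
Lemma site_error_inner (u v : 'I_n) z (i : 'I_(v - u).+1) l : (u < v)%N ->
  (l <= i)%N -> (l <= v - u - i)%N -> 0 < complex.Im z ->
  Normc.normc (z - real_complex R E) < delta ->
  ge0_integrable P (site_error z i) /\
  mean P (site_error z i) <=
    (complex.Im z)^-1 * (M_s + 1 + `|M_B|) * expR (- (gamma * l%:R / 2)).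
Proof.
move=> uv li lvi z0 zE; have uv' := ltnW uv.
have iv : (u <= window i <= v)%N by rewrite windowE //; have := ltn_ord i; lia.
set W := (complex.Im z)^-1; have W0 : 0 < W by rewrite invr_gt0.
pose g1 w := Normc.normc (resolvent (Defs.restrict (J w) u v) z ord0 i).
pose g2 w := Normc.normc (resolvent (Defs.restrict (J w) u v) z ord_max i).
pose B1 w := \sum_(l < n | (l < u)%N) `|J w u l|.
pose B2 w := \sum_(l < n | (v < l)%N) `|J w v l|.
(* With this weight both terms are of order exp (- gamma l / 2). *)
pose k := expR (gamma * l%:R / 2); have k0 : 0 < k by exact: expR_gt0.
have s2 : 0 < s / 2 <= 1 by have := s0; have := s1; lra.
have pw w : 0 <= site_error z i w <= W *
    ((k / 2 * (g1 w `^ s) + k^-1 / 2 * (B1 w `^ s))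
   + (k / 2 * (g2 w `^ s) + k^-1 / 2 * (B2 w `^ s))).
  rewrite /site_error normr_ge0 /=.
  have Js := jacobi_sym (a ^~ w) (b ^~ w).
  have Rs : (Defs.restrict (J w) u v)^T = Defs.restrict (J w) u v.
    exact: trmx_mxsub_sym.
  set D := `|_|.
  have g10 : 0 <= g1 w by exact: normc_ge0.
  have g20 : 0 <= g2 w by exact: normc_ge0.
  have B10 : 0 <= B1 w by apply: sumr_ge0.
  have B20 : 0 <= B2 w by apply: sumr_ge0.
  have D1 : D <= W.
    have h1 := resolvent_diag_gt0 (window i) Js z0.
    have h2 := resolvent_diag_gt0 i Rs z0.
    have h3 := le_trans (Im_le_normc _) (normc_resolvent_le (window i) (window i) Js z0).
    have h4 := le_trans (Im_le_normc _) (normc_resolvent_le i i Rs z0).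
    move: h1 h3 h4; rewrite -/(J w) /D !ler_norml -/W.
    move=> h1 /andP[_ h3] /andP[_ h4].
    by apply/andP; split; lra.
  have D2 : D <= W * (g1 w * B1 w + g2 w * B2 w).
    have := resolvent_restrict i Js (@jacobi_tridiagonal _ _ _ _) z0 uv.
    apply: le_trans; rewrite /D -raddfB; exact: Im_le_normc.
  have D3 : D <= W * Num.min 1 (g1 w * B1 w + g2 w * B2 w).
    by case: (leP 1 (g1 w * B1 w + g2 w * B2 w)) => _; rewrite ?mulr1.
  apply: le_trans D3 _; rewrite ler_pM2l //.
  apply: le_trans (min1_powR_le _ _ s2) _; rewrite ?mulr_ge0 //.
  have := half_power_amgm s g10 B10 k0; have := half_power_amgm s g20 B20 k0.
  by lra.
have green_mean (y : 'I_n) (j : 'I_(v - u).+1) : (y == u) || (y == v) ->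
    (forall A, green A u v z y (window i) = resolvent (Defs.restrict A u v) z j i) ->
    l%:R <= `|y%:R - (window i)%:R| :> R ->
    let g w := Normc.normc (resolvent (Defs.restrict (J w) u v) z j i) `^ s in
    ge0_integrable P g /\ mean P g <= M_s * (k^-1 * k^-1).
  move=> yuv gE ly g; apply: ge0_integrable_bound.
  - apply: measurable_powR_comp; apply: measurable_normc.
    by apply: measurable_block_resolvent => //; rewrite gt_eqF.
  - by move=> w; exact: powR_ge0.
  have := @decayG u v y (window i) z uv yuv iv z0 zE.
  under eq_integral do rewrite gE.
  move=> H; apply: le_trans H _.
  rewrite lee_fin ler_pM2l // -!expRN -expRD ler_expR.
  have : gamma * l%:R <= gamma * `|y%:R - (window i)%:R| by rewrite ler_pM2l.
  by rewrite mulNr; lra.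
have yl (y x : nat) : (y + l <= x)%N || (x + l <= y)%N -> l%:R <= `|y%:R - x%:R| :> R.
  rewrite -2!(ler_nat R) !natrD => /orP[] yx; rewrite ler_normr; apply/orP.
    by right; lra.
  by left; lra.
have yu : (u == u) || (u == v) by rewrite eqxx.
have yv : (v == u) || (v == v) by rewrite eqxx orbT.
have lu : l%:R <= `|u%:R - (window i)%:R| :> R.
  by apply: yl; rewrite windowE // leq_add2l li.
have lv : l%:R <= `|v%:R - (window i)%:R| :> R.
  by apply: yl; rewrite windowE //; apply/orP; right; clear -lvi uv; have := ltn_ord i; lia.
have [I1 E1] := green_mean u ord0 yu (fun A => (green_restrict A z i uv').1) lu.
have [I2 E2] := green_mean v ord_max yv (fun A => (green_restrict A z i uv').2) lv.
have [I3 E3] := mean_bond_sum (bond_before u).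
have [I4 E4] := mean_bond_sum (bond_after v).
have kk : 0 <= k / 2 by rewrite divr_ge0 // ltW.
have kk' : 0 <= k^-1 / 2 by rewrite divr_ge0 // invr_ge0 ltW.
have [I1' F1] := meanZ kk I1; have [I2' F2] := meanZ kk I2.
have [I3' F3] := meanZ kk' I3; have [I4' F4] := meanZ kk' I4.
have [I5 F5] := meanD I1' I3'; have [I6 F6] := meanD I2' I4'.
have [I7 F7] := meanD I5 I6; have [I8 F8] := meanZ (ltW W0) I7.
have mS := measurable_site_error i uv' (lt0r_neq0 z0).
have [I9 E9] := mean_le mS pw I8; split; first exact: I9.
apply: le_trans E9 _; rewrite F8 F7 F5 F6 F1 F2 F3 F4 -[leRHS]mulrA ler_pM2l //.
rewrite expRN -/k.
have H1 := ler_wpM2l kk E1; have H2 := ler_wpM2l kk E2.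
have H3 := ler_wpM2l kk' E3; have H4 := ler_wpM2l kk' E4.
apply: le_trans (lerD (lerD H1 H3) (lerD H2 H4)) _.
have kne : k != 0 by rewrite gt_eqF.
by rewrite le_eqVlt; apply/orP; left; apply/eqP; field.
Qed.

Lemma wegner_jacobi z x : 0 < complex.Im z ->
  ge0_integrable P (fun w => complex.Im (resolvent (J w) z x x)) /\
  mean P (fun w => complex.Im (resolvent (J w) z x x)) <= C * pi.
Proof.
move=> z0; under eq_fun do rewrite -[J _]mxsub_id_id.
exact: (wegner_submatrix mX indep C0 aC (@inj_id _)).
Qed.

Lemma wegner_block (u v : 'I_n) z (i : 'I_(v - u).+1) : (u <= v)%N ->
  0 < complex.Im z ->
  ge0_integrable P (fun w => complex.Im (resolvent (Defs.restrict (J w) u v) z i i)) /\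
  mean P (fun w => complex.Im (resolvent (Defs.restrict (J w) u v) z i i)) <= C * pi.
Proof.
by move=> uv z0; exact: (wegner_submatrix mX indep C0 aC (window_inj uv)).
Qed.

(** Wegner's estimate for the matrix and for the block. *)
Lemma site_error_le (u v : 'I_n) z (i : 'I_(v - u).+1) : (u <= v)%N ->
  0 < complex.Im z ->
  ge0_integrable P (site_error z i) /\ mean P (site_error z i) <= 2 * C * pi.
Proof.
move=> uv z0; have [I1 E1] := wegner_jacobi (window i) z0.
have [I2 E2] := wegner_block i uv z0.
have [I3 E3] := meanD I1 I2; have mS := measurable_site_error i uv (lt0r_neq0 z0).
have pw w : 0 <= site_error z i w <= complex.Im (resolvent (J w) z (window i) (window i))
    + complex.Im (resolvent (Defs.restrict (J w) u v) z i i).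
  rewrite normr_ge0 /=; apply: le_trans (ler_normB _ _) _.
  by apply: lerD; rewrite gtr0_norm //; apply: resolvent_diag_gt0 => //;
    [exact: jacobi_sym | apply: trmx_mxsub_sym; exact: jacobi_sym].
have [I4 E4] := mean_le mS pw I3; split; first exact: I4.
by apply: le_trans E4 _; rewrite E3; lra.
Qed.

Lemma sum_ltn k l : (\sum_(i < k) (i < l) = minn k l)%N.
Proof.
elim: k => [|k IH]; first by rewrite big_ord0 min0n.
by rewrite big_ord_recr /= IH; lia.
Qed.

(** Sites within distance l of an end of the block are handled by the Wegner
    bound, the others by the decay of the Green function. *)
Lemma block_error (u v : 'I_n) z l : (u < v)%N -> 0 < complex.Im z ->
  Normc.normc (z - real_complex R E) < delta ->
  ge0_integrable P (fun w => \sum_(i < (v - u).+1) site_error z i w) /\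
  mean P (fun w => \sum_(i < (v - u).+1) site_error z i w) <=
    l%:R * (4 * C * pi) + (v - u).+1%:R *
    ((complex.Im z)^-1 * (M_s + 1 + `|M_B|) * expR (- (gamma * l%:R / 2))).
Proof.
move=> uv z0 zE; have uv' := ltnW uv.
have [I1 E1] := @mean_sum _ _ _ P _ (index_enum 'I_(v - u).+1) xpredT _
  (fun i _ => (site_error_le i uv' z0).1).
split; first exact: I1.
rewrite E1; set g := _ * expR _.
have g0 : 0 <= g.
  rewrite mulr_ge0 ?expR_ge0 // mulr_ge0 ?invr_ge0 ?(ltW z0) // addr_ge0 //.
  by rewrite addr_ge0 // ltW.
have c0 : 0 <= 2 * C * pi by rewrite !mulr_ge0 // pi_ge0.
apply: (@le_trans _ _ (\sum_(i < (v - u).+1)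
   ((i < l)%:R * (2 * C * pi) + (rev_ord i < l)%:R * (2 * C * pi) + g))).
  apply: ler_sum => i _; case: (ltnP i l) => il /=.
    apply: le_trans (site_error_le i uv' z0).2 _.
    by rewrite mul1r -addrA lerDl addr_ge0 // mulr_ge0.
  case: (ltnP (rev_ord i) l) => il2 /=.
    apply: le_trans (site_error_le i uv' z0).2 _.
    by rewrite mul1r mul0r add0r lerDl.
  by rewrite !mul0r !add0r; exact: (site_error_inner uv il il2 z0 zE).2.
rewrite !big_split /= sumr_const card_ord -[g *+ _]mulr_natl lerD2r.
rewrite -!mulr_suml.
have -> : \sum_(i < (v - u).+1) (rev_ord i < l)%:R =
    \sum_(i < (v - u).+1) (i < l)%:R :> R.
  by rewrite (reindex_inj rev_ord_inj); apply: eq_bigr => i _; rewrite rev_ordK.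
have H : \sum_(i < (v - u).+1) (i < l)%:R <= l%:R :> R.
  by rewrite -natr_sum sum_ltn ler_nat geq_minr.
rewrite -mulrDl; have := ler_wpM2r c0 H; lra.
Qed.

Lemma restrict_jacobi_sym u v w :
  (Defs.restrict (J w) u v)^T = Defs.restrict (J w) u v.
Proof. exact: (trmx_mxsub_sym _ (jacobi_sym _ _)). Qed.

Section Windows.
Variables m L : nat.
Hypothesis L2 : (2 <= L)%N.
Hypothesis mL : (m * L <= n)%N.

Local Notation block_lo := (block_first L2 mL).
Local Notation block_hi := (block_last L2 mL).
Local Notation block_variables := (block_variables L2 mL).
Variables (sn : T -> seq R) (sp : 'I_m -> T -> seq R).
Hypothesis snP : forall w, eigenvalues_of (J w) (sn w).
Hypothesis spP : forall p w,
  eigenvalues_of (Defs.restrict (J w) (block_lo p) (block_hi p)) (sp p w).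
Hypothesis n_gt0 : (0 < n)%N.

Definition block_gap f w :=
  `|linstat f (rescale n E (sn w)) - \sum_(p < m) linstat f (rescale n E (sp p w))|.

Lemma measurable_full_kernel t h : 0 < h ->
  measurable_fun setT (fun w => linstat (cauchy_kernel t h) (rescale n E (sn w))).
Proof.
move=> h0; under eq_fun do rewrite (linstat_kernel _ _ (jacobi_sym _ _) n_gt0 h0 (snP _)).
apply: measurable_funM; first exact: measurable_cst.
apply: measurable_sum => i.
by have [] := measurable_jacobi_resolvent i (lt0r_neq0 (zpar_Im E t n_gt0 h0)).
Qed.

Lemma sigma_block_kernel p t h : 0 < h ->
  measurable_fun setT ((fun w => linstat (cauchy_kernel t h) (rescale n E (sp p w)))
    : sigmaType X (block_variables p) -> R).
Proof.
move=> h0; have Js w := restrict_jacobi_sym (block_lo p) (block_hi p) w.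
rewrite (_ : (fun w => _) = (fun w => n%:R^-1 * \sum_i complex.Im
  (resolvent (Defs.restrict (J w) (block_lo p) (block_hi p)) (zpar n E t h) i i)));
  last by apply/funext => w; exact: linstat_kernel.
apply: measurable_funM; first exact: measurable_cst.
apply: measurable_sum => i.
have [] // := @cmeasurable_resolvent _ _ (sigmaType X (block_variables p)) _
  (fun w => Defs.restrict (J w) (block_lo p) (block_hi p)) (zpar n E t h) i i Js.
  by rewrite gt_eqF // zpar_Im.
move=> k l; under eq_fun do rewrite mxE.
apply: measurable_jacobi => [_|j jE kl]; first exact: block_variables_inl.
exact: block_variables_inr jE kl.
Qed.

Lemma measurable_block_kernel p t h : 0 < h ->
  measurable_fun setT (fun w => linstat (cauchy_kernel t h) (rescale n E (sp p w))).
Proof.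
move=> h0; apply: (@sigmaType_measurable_fun _ _ _ _ _ mX (block_variables p)).
exact: sigma_block_kernel.
Qed.

(** The three terms come from the sites near the ends of the blocks, from the sites
    outside the blocks, and from the sites inside the blocks. *)
Definition gap_bound h : R := 4 * C * pi / m%:R + m%:R * C * pi / n%:R +
  h^-1 * (M_s + 1 + `|M_B|) * (n%:R * expR (- (gamma * (L %/ m)%:R / 2))).

(** Sum of the errors over sites, at the spectral parameter of imaginary part h / n.
    Sites closer than L %/ m to an end of their block count as near. *)
Lemma block_gap_kernel t h : 0 < h -> (0 < m)%N -> (n < m * L + m)%N ->
  Normc.normc (zpar n E t h - real_complex R E) < delta ->
  ge0_integrable P (block_gap (cauchy_kernel t h)) /\
  mean P (block_gap (cauchy_kernel t h)) <= gap_bound h.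
Proof.
move=> h0 m0 nmL zE; have z0 := zpar_Im E t n_gt0 h0.
set z := zpar n E t h in zE z0; set l := (L %/ m)%N.
have uv p := block_lo_hi L2 mL p.
have Be p := block_error l (uv p) z0 zE.
have [I1 E1] := @mean_sum _ _ _ P _ (index_enum 'I_m) xpredT _ (fun p _ => (Be p).1).
have [I2 E2] := @mean_sum _ _ _ P _ (index_enum 'I_n) (fun x : 'I_n => (m * L <= x)%N) _
  (fun x _ => (wegner_jacobi x z0).1).
have [I3 E3] := meanD I1 I2.
have n0 : 0 <= n%:R^-1 :> R by rewrite invr_ge0.
have [I4 E4] := meanZ n0 I3.
have mD : measurable_fun setT (block_gap (cauchy_kernel t h)).
  apply: measurableT_comp => //; apply: measurable_funB; first exact: measurable_full_kernel.
  by apply: measurable_sum => p; exact: measurable_block_kernel.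
have pw w : 0 <= block_gap (cauchy_kernel t h) w <= n%:R^-1 *
   (\sum_(p < m) \sum_(i < (block_hi p - block_lo p).+1) site_error z i w +
    \sum_(x < n | (m * L <= x)%N) complex.Im (resolvent (J w) z x x)).
  rewrite normr_ge0 andTb /block_gap (linstat_kernel _ _ (jacobi_sym _ _) n_gt0 h0 (snP _)).
  have Js p := restrict_jacobi_sym (block_lo p) (block_hi p) w.
  rewrite (eq_bigr _ (fun p _ => linstat_kernel E t (Js p) n_gt0 h0 (spP p w))).
  rewrite -mulr_sumr -mulrBr normrM ger0_norm // ler_wpM2l //.
  rewrite (sum_blocks L2 mL) addrAC; apply: le_trans (ler_normD _ _) _; apply: lerD.
    rewrite -sumrB; apply: le_trans (ler_norm_sum _ _ _) _; apply: ler_sum => p _.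
    by rewrite -sumrB; exact: ler_norm_sum.
  rewrite ger0_norm // sumr_ge0 // => x _; rewrite ltW // resolvent_diag_gt0 //.
  exact: jacobi_sym.
have [I5 E5] := mean_le mD pw I4; split; first exact: I5.
apply: le_trans E5 _; rewrite E4 E3 E1 E2.
have N0 : 0 < n%:R :> R by rewrite ltr0n.
rewrite ler_pdivrMl //.
set K := M_s + 1 + `|M_B|; set ex := expR (- (gamma * l%:R / 2)).
have A1 : \sum_(p < m) mean P (fun w => \sum_(i < (block_hi p - block_lo p).+1) site_error z i w)
   <= m%:R * (l%:R * (4 * C * pi) + L%:R * (n%:R / h * K * ex)).
  apply: (@le_trans _ _ (\sum_(p < m) (l%:R * (4 * C * pi) + L%:R * (n%:R / h * K * ex)))).
    apply: ler_sum => p _; apply: le_trans (Be p).2 _.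
    by rewrite block_size /z /zpar /= invf_div.
  by rewrite sumr_const card_ord -[leLHS]mulr_natl.
have A2 : \sum_(x < n | (m * L <= x)%N) mean P (fun w => complex.Im (resolvent (J w) z x x))
   <= m%:R * (C * pi).
  apply: (@le_trans _ _ (\sum_(x < n | (m * L <= x)%N) C * pi)).
    by apply: ler_sum => x _; exact: (wegner_jacobi x z0).2.
  rewrite sumr_const -[leLHS]mulr_natl ler_wpM2r ?mulr_ge0 ?pi_ge0 // ler_nat.
  rewrite -sum1_card -(big_mkord (fun x => m * L <= x)%N (fun=> 1%N)).
  rewrite (big_cat_nat (leq0n _) mL) /= big1_seq ?add0n; last first.
    by move=> j /andP[jm]; rewrite mem_index_iota ltnNge jm.
  rewrite big_mkcond /=; apply: (@leq_trans (\sum_(m * L <= j < n) 1)%N).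
    by apply: leq_sum => j _; case: ifP.
  by rewrite sum_nat_const_nat muln1 leq_subLR ltnW.
apply: le_trans (lerD A1 A2) _; rewrite /gap_bound -/K -/ex.
have M0 : 0 < m%:R :> R by rewrite ltr0n.
have mLn : m%:R * L%:R <= n%:R :> R by rewrite -natrM ler_nat.
have mlL : m%:R * l%:R <= L%:R :> R by rewrite -natrM ler_nat mulnC leq_trunc_div.
have c0 : 0 <= 4 * C * pi by rewrite !mulr_ge0 // pi_ge0.
have K0 : 0 <= n%:R / h * K * ex.
  rewrite mulr_ge0 ?expR_ge0 // mulr_ge0 ?divr_ge0 ?(ltW h0) //.
  by rewrite addr_ge0 // addr_ge0 // ltW.
have mm : m%:R * l%:R <= n%:R / m%:R :> R.
  rewrite ler_pdivlMr //; apply: le_trans mLn.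
  by rewrite mulrC ler_wpM2l // ltW.
have H1 : m%:R * l%:R * (4 * C * pi) <= n%:R * (4 * C * pi / m%:R).
  by apply: le_trans (ler_wpM2r c0 mm) _; rewrite mulrAC mulrA.
have H2 := ler_wpM2r K0 mLn.
have H3 : m%:R * (C * pi) = n%:R * (m%:R * C * pi / n%:R).
  by rewrite [RHS]mulrC divfK ?mulrA // gt_eqF.
have H4 : n%:R * (n%:R / h * K * ex) = n%:R * (h^-1 * K * (n%:R * ex)) by ring.
rewrite H3 [X in X + _]mulrDr 2!(mulrDr n%:R) -H4 [leRHS]addrAC lerD2r !mulrA.
by rewrite !mulrA in H1 H2; apply: lerD.
Qed.

Lemma mean_full_kernel t h : 0 < h ->
  ge0_integrable P (fun w => linstat (cauchy_kernel t h) (rescale n E (sn w))) /\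
  mean P (fun w => linstat (cauchy_kernel t h) (rescale n E (sn w))) <= C * pi.
Proof.
move=> h0; have N0 : n%:R != 0 :> R by rewrite pnatr_eq0 -lt0n.
have sP w : eigenvalues_of (mxsub id id (J w)) (sn w) by rewrite mxsub_id_id.
have := mean_linstat mX indep C0 aC (@inj_id _) E sP t n_gt0 h0.
by rewrite divff // mulr1.
Qed.

Lemma mean_block_kernel p t h : 0 < h ->
  ge0_integrable P (fun w => linstat (cauchy_kernel t h) (rescale n E (sp p w))) /\
  mean P (fun w => linstat (cauchy_kernel t h) (rescale n E (sp p w)))
    <= C * pi * (L%:R / n%:R).
Proof.
move=> h0; have uv := ltnW (block_lo_hi L2 mL p).
have := mean_linstat mX indep C0 aC (window_inj uv) E (spP p) t n_gt0 h0.
by rewrite block_size.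
Qed.

Lemma block_gap_ge0 f w : 0 <= block_gap f w.
Proof. exact: normr_ge0. Qed.

Lemma block_gap_comb l w :
  block_gap (comb l) w <= \sum_(q <- l) `|q.1.1| * block_gap (cauchy_kernel q.1.2 q.2) w.
Proof.
rewrite /block_gap linstat_comb.
under [X in _ - X]eq_bigr do rewrite linstat_comb.
rewrite exchange_big /= -sumrB; apply: le_trans (ler_norm_sum _ _ _) _.
by apply: ler_sum => q _; rewrite -mulr_sumr -mulrBr normrM.
Qed.

(** Means of statistics of a combination are bounded through absolute values of its
    coefficients. *)
Definition abs_comb (l : seq (R * R * R)) : seq (R * R * R) :=
  [seq (`|q.1.1|, q.1.2, q.2) | q <- l].

Lemma comb_le_abs l x : heights_pos l -> comb l x <= comb (abs_comb l) x.
Proof.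
rewrite /comb big_map big_seq [leRHS]big_seq => lpos; apply: ler_sum => q ql.
rewrite ler_wpM2r ?ler_norm // ltW // cauchy_kernel_gt0 //.
exact: (allP lpos).
Qed.

Lemma mean_full_comb l : heights_pos l ->
  ge0_integrable P (fun w => linstat (comb (abs_comb l)) (rescale n E (sn w))) /\
  mean P (fun w => linstat (comb (abs_comb l)) (rescale n E (sn w))) <= weight l * (C * pi).
Proof.
under eq_fun do rewrite linstat_comb big_map /=.
rewrite /weight; elim: l => [_|q l IH /= /andP[q0 l0]].
  under eq_fun do rewrite big_nil; rewrite big_nil mul0r.
  by have [I1 ->] := mean_cst P (lexx (0 : R)).
under eq_fun do rewrite big_cons; rewrite big_cons mulrDl.
have [I1 E1] := IH l0; have [I2 E2] := mean_full_kernel q.1.2 q0.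
have [I3 E3] := meanZ (normr_ge0 q.1.1) I2; have [I4 E4] := meanD I3 I1.
split; first exact: I4.
by rewrite E4 E3; apply: lerD => //; rewrite ler_wpM2l.
Qed.

Lemma mean_block_comb l p : heights_pos l ->
  ge0_integrable P (fun w => linstat (comb (abs_comb l)) (rescale n E (sp p w))) /\
  mean P (fun w => linstat (comb (abs_comb l)) (rescale n E (sp p w)))
    <= weight l * (C * pi * (L%:R / n%:R)).
Proof.
under eq_fun do rewrite linstat_comb big_map /=.
rewrite /weight; elim: l => [_|q l IH /= /andP[q0 l0]].
  under eq_fun do rewrite big_nil; rewrite big_nil mul0r.
  by have [I1 ->] := mean_cst P (lexx (0 : R)).
under eq_fun do rewrite big_cons; rewrite big_cons mulrDl.
have [I1 E1] := IH l0; have [I2 E2] := mean_block_kernel p q.1.2 q0.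
have [I3 E3] := meanZ (normr_ge0 q.1.1) I2; have [I4 E4] := meanD I3 I1.
split; first exact: I4.
by rewrite E4 E3; apply: lerD => //; rewrite ler_wpM2l.
Qed.

Lemma measurable_full_indic x y : x < y ->
  measurable_fun setT (fun w => linstat (\1_(`[x, y[ : set R)) (rescale n E (sn w))).
Proof. by apply: measurable_indic_stat; exact: measurable_full_kernel. Qed.

Lemma measurable_block_indic p x y : x < y ->
  measurable_fun setT (fun w => linstat (\1_(`[x, y[ : set R)) (rescale n E (sp p w))).
Proof. by apply: measurable_indic_stat; exact: measurable_block_kernel. Qed.

Definition comb_gap (l : seq (R * R * R)) : R := \sum_(q <- l) `|q.1.1| * gap_bound q.2.

(** The part approximated by l is controlled by [block_gap_kernel], the remainder
    chi by Wegner's estimate for the matrix and for the blocks. *)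
Lemma block_gap_indic x y l chi : x < y -> (0 < m)%N -> (n < m * L + m)%N ->
  heights_pos l -> heights_pos chi ->
  (forall z, `|\1_(`[x, y[ : set R) z - comb l z| <= comb chi z) ->
  (forall q, q \in l -> Normc.normc (zpar n E q.1.2 q.2 - real_complex R E) < delta) ->
  ge0_integrable P (block_gap (\1_(`[x, y[ : set R))) /\
  mean P (block_gap (\1_(`[x, y[ : set R))) <= comb_gap l + 2 * weight chi * (C * pi).
Proof.
move=> xy m0 nmL lpos cpos lchi lz.
have [I1 E1] : ge0_integrable P (fun w => \sum_(q <- l) `|q.1.1| * block_gap (cauchy_kernel q.1.2 q.2) w) /\
    mean P (fun w => \sum_(q <- l) `|q.1.1| * block_gap (cauchy_kernel q.1.2 q.2) w) <= comb_gap l.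
  rewrite /comb_gap; elim: (l) (lpos) (lz) => [_ _|q l' IH /= /andP[q0 l0] lz'].
    under eq_fun do rewrite big_nil; rewrite big_nil.
    by have [I1 ->] := mean_cst P (lexx (0 : R)).
  under eq_fun do rewrite big_cons; rewrite big_cons.
  have [|I1 E1] := IH l0; first by move=> q' q'l; apply: lz'; rewrite inE q'l orbT.
  have [I2 E2] := block_gap_kernel q0 m0 nmL (lz' q (mem_head _ _)).
  have [I3 E3] := meanZ (normr_ge0 q.1.1) I2; have [I4 E4] := meanD I3 I1.
  split; first exact: I4.
  by rewrite E4 E3; apply: lerD => //; rewrite ler_wpM2l.
have [I2 E2] := mean_full_comb cpos.
have [I3 E3] := @mean_sum _ _ _ P _ (index_enum 'I_m) xpredT _ (fun p _ => (mean_block_comb p cpos).1).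
have [I4 E4] := meanD I2 I3; have [I5 E5] := meanD I1 I4.
have mD : measurable_fun setT (block_gap (\1_(`[x, y[ : set R))).
  apply: measurableT_comp => //; apply: measurable_funB; first exact: measurable_full_indic.
  by apply: measurable_sum => p; exact: measurable_block_indic.
have pw w : 0 <= block_gap (\1_(`[x, y[ : set R)) w <=
   \sum_(q <- l) `|q.1.1| * block_gap (cauchy_kernel q.1.2 q.2) w +
   (linstat (comb (abs_comb chi)) (rescale n E (sn w)) +
    \sum_(p < m) linstat (comb (abs_comb chi)) (rescale n E (sp p w))).
  rewrite block_gap_ge0 /=; set S1 := linstat _ _; set S2 := \sum_(p < m) _.
  have near s' : `|linstat (\1_(`[x, y[ : set R)) s' - linstat (comb l) s'| <=
      linstat (comb (abs_comb chi)) s'.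
    rewrite linstatB; apply: le_trans (linstat_norm _ _) _; apply: le_linstat => z.
    by apply: le_trans (lchi z) _; exact: comb_le_abs.
  have h1 := near (rescale n E (sn w)).
  have h2 : `|\sum_(p < m) linstat (\1_(`[x, y[ : set R)) (rescale n E (sp p w)) -
       \sum_(p < m) linstat (comb l) (rescale n E (sp p w))| <= S2.
    rewrite -sumrB; apply: le_trans (ler_norm_sum _ _ _) _.
    by apply: ler_sum => p _; exact: near.
  have h3 := block_gap_comb l w; rewrite /block_gap in h3 *.
  move: h1 h2 h3; rewrite -/S1; clearbody S1 S2.
  move: (linstat (\1_(`[x, y[ : set R)) _) (linstat (comb l) _)
    (\sum_(p < m) linstat (\1_(`[x, y[ : set R)) _) (\sum_(p < m) linstat (comb l) _)
    (\sum_(q <- l) _) => a1 a2 a3 a4 a5.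
  by rewrite !ler_norml => /andP[? ?] /andP[? ?] /andP[? ?]; apply/andP; split; lra.
have [I6 E6] := mean_le mD pw I5; split; first exact: I6.
apply: le_trans E6 _; rewrite E5 E4 E3.
have w0 : 0 <= weight chi by apply: sumr_ge0.
have N0 : 0 < n%:R :> R by rewrite ltr0n.
have cp : 0 <= weight chi * (C * pi) by rewrite !mulr_ge0 // pi_ge0.
have B3 : \sum_(p < m) mean P (fun w => linstat (comb (abs_comb chi)) (rescale n E (sp p w)))
   <= weight chi * (C * pi).
  apply: (@le_trans _ _ (\sum_(p < m) weight chi * (C * pi) * (L%:R / n%:R))).
    by apply: ler_sum => p _; rewrite -mulrA; exact: (mean_block_comb p cpos).2.
  rewrite sumr_const card_ord -[leLHS]mulr_natl mulrCA ler_piMr //.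
  by rewrite mulrA ler_pdivrMr // mul1r -natrM ler_nat.
have -> : 2 * weight chi * (C * pi) = weight chi * (C * pi) + weight chi * (C * pi) by ring.
by apply: lerD => //; apply: lerD.
Qed.

(** * Poisson approximation of avoidance probabilities *)

Section Avoidance.
Variables (phi : R -> R) (c h : R).
Hypothesis phi2 : forall x, phi x ^+ 2 = phi x.
Hypothesis phic : forall x, 0 <= phi x <= c * cauchy_kernel 0 h x.
Hypothesis h0 : 0 < h.
Hypothesis c0 : 0 <= c.
Let N w := linstat phi (rescale n E (sn w)).
Let Np p w := linstat phi (rescale n E (sp p w)).
Hypothesis mN : measurable_fun setT N.
Hypothesis mNp : forall p,
  measurable_fun setT (Np p : sigmaType X (block_variables p) -> R).
Hypothesis gapI : ge0_integrable P (block_gap phi).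

Let mNp' p : measurable_fun setT (Np p).
Proof. exact: (@sigmaType_measurable_fun _ _ _ _ _ mX (block_variables p)). Qed.

Let natstat pts : exists k : nat, linstat phi pts = k%:R.
Proof. by rewrite linstat_count //; eexists. Qed.

Lemma measurable_zero (f : T -> R) : measurable_fun setT f ->
  measurable [set w | f w = 0].
Proof. by move=> mf; have := mf measurableT [set 0] (measurable_set1 0); rewrite setTI. Qed.

Let MN w := \sum_(p < m) Np p w.

Let mMN : measurable_fun setT MN.
Proof. by apply: measurable_sum => p; exact: mNp'. Qed.

(* The indicators of k = 0 and l = 0 differ only if k and l differ by at least 1. *)
Let nat_gap (k l : nat) : (k%:R == 0 :> R)%:R <= (l%:R == 0 :> R)%:R + `|k%:R - l%:R| :> R.
Proof.
rewrite !pnatr_eq0; case: k => [|k] /=; last by rewrite addr_ge0.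
case: l => [|l] /=; first by rewrite lerDl.
by rewrite add0r sub0r normrN ger0_norm // ler1n.
Qed.

Let MN_nat w : exists k : nat, MN w = k%:R.
Proof.
exists (\sum_(p < m) count (fun x => phi x == 1%R) (rescale n E (sp p w)))%N.
by rewrite natr_sum; apply: eq_bigr => p _; rewrite /Np linstat_count.
Qed.

Let zero_gap : `|fine (P [set w | N w = 0]) - fine (P [set w | MN w = 0])|
  <= mean P (block_gap phi).
Proof.
have [I1 <-] := mean_indic P (measurable_zero mN).
have [I2 <-] := mean_indic P (measurable_zero mMN).
have E1 (f : T -> R) w : (\1_[set w | f w = 0] w : R) = (f w == 0)%:R.
  by rewrite indicE; congr (nat_of_bool _)%:R; apply/idP/eqP; rewrite inE.
have [I3 E3] := meanD I2 gapI; have [I4 E4] := meanD I1 gapI.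
have [|_ A] := mean_le (measurable_indic (measurable_zero mN)) _ I3.
  move=> w; rewrite !E1 ler0n /=; have [k kE] := natstat (rescale n E (sn w)).
  have [l lE] := MN_nat w; rewrite /block_gap -/(N w) -/(MN w) lE /N kE.
  exact: nat_gap.
have [|_ B] := mean_le (measurable_indic (measurable_zero mMN)) _ I4.
  move=> w; rewrite !E1 ler0n /=; have [k kE] := natstat (rescale n E (sn w)).
  have [l lE] := MN_nat w; rewrite /block_gap -/(N w) -/(MN w) lE /N kE distrC.
  exact: nat_gap.
by rewrite ler_norml; apply/andP; split; lra.
Qed.

Let q p := 1 - fine (P [set w | Np p w = 0]).

Let q01 p : 0 <= q p <= 1.
Proof.
have /andP[u0 u1] := fine_prob_le1 P (measurable_zero (mNp' p)).
by rewrite /q; apply/andP; split; lra.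
Qed.

Let zero_prod : fine (P [set w | MN w = 0]) = \prod_(p <- index_enum 'I_m) (1 - q p).
Proof.
have -> : [set w | MN w = 0] =
    [set w | forall p, p \in index_enum 'I_m -> [set w | Np p w = 0] w].
  have Np0 p w : 0 <= Np p w.
    by apply: linstat_ge0 => x; have /andP[] := phic x.
  apply/seteqP; split => w /= H.
    move=> p _; apply/eqP; have /eqP := H; rewrite /MN psumr_eq0 //.
    by move=> /allP /(_ p (mem_index_enum p)).
  by rewrite /MN big1 // => p _; apply: H; rewrite mem_index_enum.
rewrite (independent_blocks mX indep (index_enum_uniq 'I_m)
  (K := block_variables) (A := fun p => [set w | Np p w = 0])).
- rewrite (_ : (\prod_(p <- index_enum 'I_m) P [set w | Np p w = 0%R])%E =
    (\prod_(p <- index_enum 'I_m) (1 - q p))%:E) //.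
  elim: (index_enum _) => [|p r IH]; first by rewrite !big_nil.
  rewrite !big_cons IH EFinM /q opprB addrCA subrr addr0 fineK //.
  by apply: fin_num_measure; apply: measurable_zero.
- by move=> p p' i; exact: block_variables_disjoint.
- move=> p _; have := @mNp p measurableT _ (measurable_set1 0).
  by rewrite setTI.
Qed.

Hypothesis m0 : (0 < m)%N.
Let B := c * C * pi.

Let B0 : 0 <= B.
Proof. by rewrite !mulr_ge0 // pi_ge0. Qed.

Let Ln : L%:R / n%:R <= m%:R^-1 :> R.
Proof. by rewrite ler_pdivrMr ?ltr0n // ler_pdivlMl ?ltr0n // -natrM ler_nat. Qed.

Let meanNp p : ge0_integrable P (Np p) /\ mean P (Np p) <= B / m%:R.
Proof.
have [I1 E1] := mean_block_kernel p 0 h0; have [I2 E2] := meanZ c0 I1.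
have pw w : 0 <= Np p w <= c * linstat (cauchy_kernel 0 h) (rescale n E (sp p w)).
  rewrite /Np linstat_ge0 /=; last by move=> x; have /andP[] := phic x.
  rewrite /linstat mulr_sumr; apply: ler_sum => x _.
  by have /andP[] := phic x.
have [I3 E3] := mean_le (mNp' p) pw I2; split; first exact: I3.
apply: le_trans E3 _; rewrite E2; apply: le_trans (ler_wpM2l c0 E1) _.
rewrite (_ : c * _ = B * (L%:R / n%:R)); last by rewrite /B !mulrA.
exact: ler_wpM2l.
Qed.

Let meanN : ge0_integrable P N.
Proof.
have [I1 E1] := mean_full_kernel 0 h0; have [I2 E2] := meanZ c0 I1.
have pw w : 0 <= N w <= c * linstat (cauchy_kernel 0 h) (rescale n E (sn w)).
  rewrite /N linstat_ge0 /=; last by move=> x; have /andP[] := phic x.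
  rewrite /linstat mulr_sumr; apply: ler_sum => x _.
  by have /andP[] := phic x.
by have [] := mean_le mN pw I2.
Qed.

Let meanMN : ge0_integrable P MN /\ mean P MN = \sum_(p <- index_enum 'I_m) mean P (Np p).
Proof. by apply: mean_sum => p _; exact: (meanNp p).1. Qed.

Let indic_zero (f : T -> R) w : (\1_[set w | f w = 0] w : R) = (f w == 0)%:R.
Proof. by rewrite indicE; congr (nat_of_bool _)%:R; apply/idP/eqP; rewrite inE. Qed.

Let q_le p : q p <= B / m%:R.
Proof.
apply: le_trans (meanNp p).2; rewrite /q.
have mz := measurable_zero (mNp' p); have [I1 <-] := mean_indic P mz.
have [I2 E2] := meanD I1 (meanNp p).1.
have [||_] := @mean_le _ _ _ P (fun=> 1) _ _ _ I2.
- exact: measurable_cst.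
- move=> w; rewrite ler01 indic_zero /=; have [k] := natstat (rescale n E (sp p w)).
  rewrite -/(Np p w) => ->; rewrite pnatr_eq0; case: k => [|k] /=; first by rewrite addr0.
  by rewrite add0r ler1n.
- by have [_ ->] := mean_cst P (@ler01 R); rewrite E2; lra.
Qed.

(** A block holding k points contributes k - 1 <= k (k - 1) to the defect. *)
Let q_defect p : 0 <= mean P (Np p) - q p <= (B / m%:R) ^+ 2.
Proof.
have mz := measurable_zero (mNp' p); have [I1 E1] := mean_indic P mz.
have [I2 E2] := meanD I1 (meanNp p).1.
have [I0 E0] := mean_cst P (@ler01 R).
have uv := ltnW (block_lo_hi L2 mL p).
have [I3 E3] := mean_pairstat mX indep C0 aC (window_inj uv) (spP p) n_gt0 h0 c0
  (mNp' p) phic phi2.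
have [I4 E4] := meanD I0 I3.
have [||_ G] := @mean_le _ _ _ P (fun w => \1_[set w | Np p w = 0] w + Np p w) _ _ _ I4.
- exact: (measurable_funD (measurable_indic mz) (mNp' p)).
- move=> w /=; rewrite indic_zero -/(Np p w); have [k] := natstat (rescale n E (sp p w)).
  rewrite -/(Np p w) => ->; rewrite addr_ge0 //= pnatr_eq0.
  case: k => [|k] /=; first by rewrite expr0n /= subr0 !addr0.
  have : 0 <= (k%:R) ^+ 2 :> R by exact: exprn_ge0.
  by rewrite add0r -natr1; lra.
apply/andP; split.
  have [||_] := @mean_le _ _ _ P (fun=> 1) _ _ _ I2.
  - exact: measurable_cst.
  - move=> w; rewrite ler01 indic_zero /=; have [k] := natstat (rescale n E (sp p w)).
    rewrite -/(Np p w) => ->; rewrite pnatr_eq0; case: k => [|k] /=; first by rewrite addr0.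
    by rewrite add0r ler1n.
  - by rewrite E0 E2 E1 /q; lra.
apply: (@le_trans _ _ ((c * C * pi * (L%:R / n%:R)) ^+ 2)).
  apply: le_trans (_ : mean P (fun w => Np p w ^+ 2 - Np p w) <= _); last first.
    by move: E3; rewrite block_size.
  by move: G; rewrite E4 E0 E2 E1 /q; lra.
by rewrite lerXn2r // ?nnegrE ?mulr_ge0 ?invr_ge0 // ?pi_ge0 // ler_wpM2l.
Qed.

(** The error terms are, in this order: the cost of replacing the matrix by its
    blocks, in the probability and in the mean; and B ^ 2 / m twice, for the
    product of the 1 - q p against an exponential and for \sum q p against the
    mean number of points in the blocks. *)
Lemma avoidance_estimate :
  `|fine (P [set w | N w = 0]) - expR (- mean P N)| <=
  2 * mean P (block_gap phi) + 2 * (B ^+ 2 / m%:R).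
Proof.
have M0 : m%:R != 0 :> R by rewrite pnatr_eq0 -lt0n.
have sumB (F : 'I_m -> R) : (forall p, F p <= (B / m%:R) ^+ 2) ->
    \sum_(p <- index_enum 'I_m) F p <= B ^+ 2 / m%:R.
  move=> H; apply: le_trans (ler_sum _ (fun p _ => H p)) _.
  rewrite sumr_const card_ord -[leLHS]mulr_natl exprMn exprVn.
  by rewrite le_eqVlt; apply/orP; left; apply/eqP; move: (m%:R) M0 => x x0; field.
have h1 := zero_gap; have h2 := prod_exp_le (index_enum 'I_m) q01.
rewrite -zero_prod in h2.
have h3 : \sum_(p <- index_enum 'I_m) q p ^+ 2 <= B ^+ 2 / m%:R.
  apply: sumB => p; have /andP[q0 _] := q01 p.
  by rewrite lerXn2r ?nnegrE // divr_ge0.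
have [IM EM] := meanMN.
have h4 : `|mean P MN - mean P N| <= mean P (block_gap phi).
  clear sumB; have [I3 E3] := meanD IM gapI; have [I4 E4] := meanD meanN gapI.
  have N0 w : 0 <= N w by apply: linstat_ge0 => x; have /andP[] := phic x.
  have MN0 w : 0 <= MN w.
    by apply: sumr_ge0 => p _; apply: linstat_ge0 => x; have /andP[] := phic x.
  have [|_ A1] := mean_le mN _ I3.
    move=> w; rewrite N0 /= /block_gap -/(N w) -/(MN w).
    by rewrite -lerBlDl ler_norm.
  have [|_ A2] := mean_le mMN _ I4.
    move=> w; rewrite MN0 /= /block_gap -/(N w) -/(MN w) distrC.
    by rewrite -lerBlDl ler_norm.
  by rewrite E3 in A1; rewrite E4 in A2; exact: dist_le_of.
have h5 : `|\sum_(p <- index_enum 'I_m) q p - mean P MN| <= B ^+ 2 / m%:R.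
  rewrite distrC EM -sumrB ger0_norm; last first.
    by apply: sumr_ge0 => p _; have /andP[] := q_defect p.
  by apply: sumB => p; have /andP[] := q_defect p.
have Q0 : 0 <= \sum_(p <- index_enum 'I_m) q p.
  by apply: sumr_ge0 => p _; have /andP[] := q01 p.
have N0 : 0 <= mean P N by apply: mean_ge0 => w; apply: linstat_ge0 => x; have /andP[] := phic x.
clear sumB; have h6 := expRN_lipschitz Q0 N0.
have h7 := ler_distD (mean P MN) (\sum_(p <- index_enum 'I_m) q p) (mean P N).
have h8 := ler_distD (fine (P [set w | MN w = 0])) (fine (P [set w | N w = 0])) (expR (- mean P N)).
have h9 := ler_distD (expR (- \sum_(p <- index_enum 'I_m) q p)) (fine (P [set w | MN w = 0])) (expR (- mean P N)).
apply: le_trans h8 _; set D := mean P (block_gap phi) in h1 h4 *.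
have -> : 2 * D + 2 * (B ^+ 2 / m%:R) = D + (B ^+ 2 / m%:R + (B ^+ 2 / m%:R + D)).
  by move: (B ^+ 2 / m%:R) => b0; ring.
apply: lerD => //; apply: le_trans h9 _; apply: lerD; first exact: le_trans h2 h3.
by apply: le_trans h6 _; apply: le_trans h7 _; exact: lerD.
Qed.

End Avoidance.
End Windows.


End Blocks.
(** * Avoidance probabilities as the size tends to infinity *)

Section Asymptotics.
Context {R : realType}.
Variables (d : nat -> measure_display) (Om : forall n, measurableType (d n)).
Variable P : forall n, probability (Om n) R.
Variables (a : forall n, 'I_n -> Om n -> R) (b : forall n, 'I_n.-1 -> Om n -> R).
Let X n (k : 'I_n + 'I_n.-1) (w : Om n) : R :=
  match k with inl i => @a n i w | inr i => @b n i w end.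
Hypothesis mX : forall n (k : 'I_n + 'I_n.-1), measurable_fun setT (X k).
Hypothesis indep : forall n, independent (P n) (@X n).
Variable C : R.
Hypothesis C0 : 0 <= C.
Hypothesis aC : forall n (i : 'I_n), bounded_law (P n) C (@a n i).
Hypothesis b_gt0 : forall n (i : 'I_n.-1) w, 0 < @b n i w.
Let J n (w : Om n) := jacobi (@a n ^~ w) (@b n ^~ w).
Variables (M_B expo s M_s gamma delta E : R).
Hypothesis s0 : 0 < s.
Hypothesis s1 : s < 1.
Hypothesis expo1 : 1 < expo.
Hypothesis gamma0 : 0 < gamma.
Hypothesis delta0 : 0 < delta.
Hypothesis Ms0 : 0 < M_s.
Hypothesis momB : forall n (i : 'I_n.-1),
  (\int[P n]_w (@b n i w `^ expo)%:E <= M_B%:E)%E.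
Hypothesis decayG : forall n (u v y x : 'I_n) (z : R[i]),
    (u < v)%N -> (y == u) || (y == v) -> (u <= x <= v)%N ->
    0 < complex.Im z -> Normc.normc (z - real_complex R E) < delta ->
    (\int[P n]_w (Normc.normc (green (J w) u v z y x) `^ s)%:E
      <= (M_s * expR (- gamma * `|y%:R - x%:R|))%:E)%E.
Variable sn : forall n, Om n -> seq R.
Hypothesis snP : forall n w, eigenvalues_of (J w) (@sn n w).

(** From exp (2 x) >= (1 + x)^2 with x = gamma l / 4, where l = n %/ m %/ m is
    at least n / m ^ 2 - 1. *)
Lemma exp_decay_rate n m : (0 < m)%N -> (0 < n)%N ->
  n%:R * expR (- (gamma * (n %/ m %/ m)%:R / 2)) <=
  (m%:R ^+ 4 / (Num.min 1 (gamma / 4)) ^+ 2) / n%:R.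
Proof.
move=> m0 n0; set l := (n %/ m %/ m)%N; set c := Num.min _ _.
have c1 : c <= 1 by rewrite ge_min lexx.
have c4 : c <= gamma / 4 by rewrite ge_min lexx orbT.
have cpos : 0 < c by rewrite lt_min ltr01 divr_gt0.
have N0 : 0 < n%:R :> R by rewrite ltr0n.
have M0 : 0 < m%:R :> R by rewrite ltr0n.
have nl : n%:R <= m%:R ^+ 2 * (1 + l%:R) :> R.
  rewrite -natrX nat1r -natrM ler_nat /l -divnMA mulnn mulnC.
  by rewrite ltnW // ltn_ceil // expn_gt0 m0.
have h1 : c * (n%:R / m%:R ^+ 2) <= 1 + gamma * l%:R / 4.
  apply: (@le_trans _ _ (c * (1 + l%:R))).
    by rewrite ler_wpM2l ?(ltW cpos) // ler_pdivrMr ?exprn_gt0 // mulrC.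
  rewrite mulrDr mulr1; apply: lerD => //.
  by rewrite [leRHS]mulrAC ler_wpM2r.
have h2 : (c * (n%:R / m%:R ^+ 2)) ^+ 2 <= expR (gamma * l%:R / 2).
  rewrite (_ : gamma * l%:R / 2 = gamma * l%:R / 4 + gamma * l%:R / 4); last by lra.
  rewrite expRD -expr2 lerXn2r ?nnegrE ?expR_ge0 //.
    by rewrite mulr_ge0 ?(ltW cpos) // divr_ge0 // exprn_ge0.
  by apply: le_trans h1 (expR_ge1Dx _).
have z0 : 0 < (c * (n%:R / m%:R ^+ 2)) ^+ 2.
  by rewrite exprn_gt0 // mulr_gt0 // divr_gt0 // exprn_gt0.
rewrite expRN; apply: (@le_trans _ _ (n%:R * ((c * (n%:R / m%:R ^+ 2)) ^+ 2)^-1)).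
  by rewrite ler_wpM2l // lef_pV2 // posrE ?expR_gt0.
rewrite le_eqVlt; apply/orP; left; apply/eqP.
move: (n%:R : R) (m%:R : R) N0 M0 => x y x0 y0; field.
by rewrite !gt_eqF.
Qed.

Lemma gap_bound_rate m h : (0 < m)%N -> 0 < h -> exists A : R,
  forall n, (0 < n)%N ->
  gap_bound n C M_B M_s gamma m (n %/ m) h <= 4 * C * pi / m%:R + A / n%:R.
Proof.
move=> m0 h0; set r := m%:R ^+ 4 / (Num.min 1 (gamma / 4)) ^+ 2 : R.
exists (m%:R * C * pi + h^-1 * (M_s + 1 + `|M_B|) * r) => n n0.
rewrite /gap_bound -addrA lerD2l mulrDl lerD2l -[leRHS]mulrA ler_wpM2l //.
  by rewrite mulr_ge0 ?invr_ge0 ?(ltW h0) // addr_ge0 // addr_ge0 // ltW.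
exact: exp_decay_rate.
Qed.

Lemma comb_gap_rate m l : (0 < m)%N -> heights_pos l -> exists A : R,
  forall n, (0 < n)%N ->
  comb_gap n C M_B M_s gamma m (n %/ m) l <= weight l * (4 * C * pi / m%:R) + A / n%:R.
Proof.
move=> m0; rewrite /comb_gap /weight; elim: l => [_|q l IH /= /andP[q0 l0]].
  by exists 0 => n n0; rewrite !big_nil !mul0r addr0.
have [A HA] := IH l0; have [B HB] := gap_bound_rate m0 q0.
exists (`|q.1.1| * B + A) => n n0; rewrite !big_cons.
rewrite mulrDl [_ / n%:R]mulrDl addrACA; apply: lerD; last exact: HA.
by rewrite -[_ * B / _]mulrA -mulrDr ler_wpM2l //; exact: HB.
Qed.

Lemma eventually_le (A e : R) : 0 < e ->
  exists n0, forall n, (n0 <= n)%N -> (0 < n)%N -> A / n%:R <= e.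
Proof.
move=> e0; exists (Num.truncn (`|A| / e)).+1 => n n1 n0.
rewrite ler_pdivrMr ?ltr0n //; apply: le_trans (ler_norm _) _.
rewrite mulrC -ler_pdivrMr //; apply/ltW; apply: lt_le_trans (truncnS_gt _) _.
by rewrite ler_nat.
Qed.

(** The spectral parameters of finitely many kernels approach E. *)
Lemma eventually_near (l : seq (R * R * R)) : exists n0, forall n, (n0 <= n)%N -> (0 < n)%N ->
  forall q, q \in l ->
    Normc.normc (zpar n E q.1.2 q.2 - real_complex R E) < delta.
Proof.
elim: l => [|q l [n1 H]]; first by exists 0%N.
have d2 : 0 < delta / 2 by rewrite divr_gt0.
have [n2 H2] := eventually_le (`|q.1.2| + `|q.2|) d2.
exists (maxn n1 n2) => n; rewrite geq_max => /andP[nn1 nn2] n0 q'.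
rewrite inE => /orP[/eqP ->|]; last exact: H.
apply: le_lt_trans (_ : delta / 2 < _); last by have := delta0; lra.
apply: le_trans (H2 n nn2 n0).
have -> : zpar n E q.1.2 q.2 - real_complex R E =
   real_complex R (q.1.2 / n%:R) + Complex 0 1 * real_complex R (q.2 / n%:R).
  by apply/eqP; rewrite eq_complex /= !(mul0r, mul1r, mulr0, subr0, addr0, add0r) ?subrr addrAC subrr add0r !eqxx.
apply: le_trans (le_normcD _ _) _; rewrite Normc.normcM !normc_real.
rewrite /Normc.normc expr0n /= add0r expr1n sqrtr1 mul1r.
by rewrite !normrM normfV !(ger0_norm (ler0n _ n)) mulrDl.
Qed.

Section FixedWindow.
Variables (n m : nat).
Hypothesis L2 : (2 <= n %/ m)%N.
Hypothesis mL : (m * (n %/ m) <= n)%N.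

Definition block_eigs (p : 'I_m) (w : Om n) :=
  eigs (Defs.restrict (J w) (block_first L2 mL p) (block_last L2 mL p)).

Lemma block_eigsP p w : eigenvalues_of
  (Defs.restrict (J w) (block_first L2 mL p) (block_last L2 mL p)) (block_eigs p w).
Proof. by apply/eigsP/restrict_jacobi_sym. Qed.

End FixedWindow.

(** First the approximating combinations are chosen, then the number m of blocks,
    then the size n: the combinations do not depend on m and n. *)
Lemma interval_gap x y e : x < y -> 0 < e ->
  exists m0, forall m, (m0 <= m)%N -> (0 < m)%N ->
  exists n0, forall n, (n0 <= n)%N -> (0 < n)%N ->
  forall (L2 : (2 <= n %/ m)%N) (mL : (m * (n %/ m) <= n)%N),
  ge0_integrable (P n) (block_gap n E (@sn n) (block_eigs L2 mL) (\1_(`[x, y[ : set R))) /\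
  mean (P n) (block_gap n E (@sn n) (block_eigs L2 mL) (\1_(`[x, y[ : set R))) <= e.
Proof.
move=> xy e0; have Cp : 0 <= C * pi by rewrite mulr_ge0 // pi_ge0.
have e1 : 0 < e / (6 * (C * pi + 1)) by rewrite divr_gt0 // mulr_gt0 //; lra.
have [k [chi [cpos wchi lchi]]] := indicator_comb_approx xy e1.
set l := indicator_comb x y k in lchi.
have lpos : heights_pos l by exact: indicator_comb_pos.
have e3 : 0 < e / 3 by rewrite divr_gt0.
have [m0 Hm] := eventually_le (weight l * (4 * C * pi)) e3.
exists m0 => m mm m1; have [A HA] := comb_gap_rate m1 lpos.
have [n1 H1] := eventually_le A e3; have [n2 H2] := eventually_near l.
exists (maxn n1 n2) => n; rewrite geq_max => /andP[nn1 nn2] n0 L2 mL.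
have nmL : (n < m * (n %/ m) + m)%N.
  by rewrite {1}(divn_eq n m) mulnC ltn_add2l ltn_pmod.
have [I1 E1] := block_gap_indic (@mX n) (@indep n) C0 (@aC n) (@b_gt0 n) s0 s1 expo1
  gamma0 Ms0 (@momB n) (@decayG n) (@snP n) (block_eigsP L2 mL) n0 xy m1 nmL lpos cpos
  lchi (H2 n nn2 n0).
split; first exact: I1.
apply: le_trans E1 _; apply: le_trans (_ : e / 3 + e / 3 + e / 3 <= _); last by lra.
apply: lerD.
  apply: le_trans (HA n n0) _; apply: lerD; last exact: H1.
  by rewrite mulrA; exact: Hm.
have wC : weight chi * (C * pi) <= e / (6 * (C * pi + 1)) * (C * pi + 1).
  by rewrite ler_pM ?lerDl //; apply: sumr_ge0.
rewrite -mulrA; apply: le_trans (ler_wpM2l _ wC) _ => //.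
have : C * pi + 1 != 0 by rewrite gt_eqF //; lra.
move: (C * pi + 1) => D D0; rewrite le_eqVlt; apply/orP; left; apply/eqP.
by field.
Qed.

(** The indicator of the union if the intervals are disjoint; this is later
    expressed by the condition that it is equal to its square. *)
Definition union_indic (V : seq (R * R)) (x : R) : R :=
  \sum_(I <- V) (\1_(`[I.1, I.2[ : set R) x).

Definition intervals (V : seq (R * R)) := all (fun I => I.1 < I.2) V.

Lemma linstat_union V pts : linstat (union_indic V) pts =
  \sum_(I <- V) linstat (\1_(`[I.1, I.2[ : set R)) pts.
Proof. exact: exchange_big. Qed.

Lemma measurable_union_stat d' (T' : measurableType d') (pts : T' -> seq R) V :
  (forall t h, 0 < h -> measurable_fun setT (fun w => linstat (cauchy_kernel t h) (pts w))) ->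
  intervals V -> measurable_fun setT (fun w => linstat (union_indic V) (pts w)).
Proof.
move=> mK; under eq_fun do rewrite linstat_union.
elim: V => [_|I V IH /= /andP[I12 V12]].
  by under eq_fun do rewrite big_nil; exact: measurable_cst.
under eq_fun do rewrite big_cons; apply: measurable_funD; last exact: IH.
exact: measurable_indic_stat.
Qed.

Lemma measurable_union V n : (0 < n)%N -> intervals V ->
  measurable_fun setT (fun w => linstat (union_indic V) (rescale n E (@sn n w))).
Proof.
move=> n0 V12; apply: measurable_union_stat => // t h h0.
exact: (measurable_full_kernel (@mX n) E (@snP n) n0 t h0).
Qed.

Lemma union_gap V e : intervals V -> 0 < e ->
  exists m0, forall m, (m0 <= m)%N -> (0 < m)%N ->
  exists n0, forall n, (n0 <= n)%N -> (0 < n)%N ->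
  forall (L2 : (2 <= n %/ m)%N) (mL : (m * (n %/ m) <= n)%N),
  ge0_integrable (P n) (block_gap n E (@sn n) (block_eigs L2 mL) (union_indic V)) /\
  mean (P n) (block_gap n E (@sn n) (block_eigs L2 mL) (union_indic V)) <= e.
Proof.
elim: V e => [|I V IH] e /= => [_ e0|/andP[I12 V12] e0].
  exists 0%N => m _ _; exists 0%N => n _ _ L2 mL.
  rewrite (_ : block_gap _ _ _ _ _ = (fun=> 0)).
    by have [I1 ->] := mean_cst (P n) (lexx (0 : R)); split => //; exact: ltW.
  apply/funext => w; rewrite /block_gap linstat_union big_nil sub0r normrN.
  by rewrite big1 ?normr0 // => p _; rewrite linstat_union big_nil.
have e2 : 0 < e / 2 by rewrite divr_gt0.
have [m1 H1] := IH _ V12 e2; have [m2 H2] := interval_gap I12 e2.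
exists (maxn m1 m2) => m; rewrite geq_max => /andP[mm1 mm2] m0.
have [n1 {}H1] := H1 m mm1 m0; have [n2 {}H2] := H2 m mm2 m0.
exists (maxn n1 n2) => n; rewrite geq_max => /andP[nn1 nn2] n0 L2 mL.
have [I1 E1] := H1 n nn1 n0 L2 mL; have [I2 E2] := H2 n nn2 n0 L2 mL.
have [I3 E3] := meanD I2 I1.
have [||I4 E4] := @mean_le _ _ _ (P n)
  (block_gap n E (@sn n) (block_eigs L2 mL) (union_indic (I :: V))) _ _ _ I3.
- apply: measurableT_comp => //; apply: measurable_funB.
    by apply: measurable_union => //=; rewrite I12.
  apply: measurable_sum => p; apply: measurable_union_stat; last by rewrite /= I12.
  by move=> t h h0; exact: (measurable_block_kernel (@mX n) E (block_eigsP L2 mL) n0 p t h0).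
- move=> w; rewrite block_gap_ge0 /= /block_gap !linstat_union big_cons.
  under [X in _ - X]eq_bigr do rewrite linstat_union big_cons -linstat_union.
  by rewrite big_split /= opprD addrACA; exact: ler_normD.
split; first exact: I4.
by apply: le_trans E4 _; rewrite E3; lra.
Qed.

(** The indicator of a bounded set is dominated by a kernel of large height. *)
Lemma union_indic_kernel V : (forall x, union_indic V x ^+ 2 = union_indic V x) ->
  exists2 r, 0 < r & forall x, 0 <= union_indic V x <= 2 * r * cauchy_kernel 0 r x.
Proof.
move=> V2; pose r := 1 + \sum_(I <- V) (`|I.1| + `|I.2|).
have r0 : 0 < r.
  by apply: (@lt_le_trans _ _ 1); rewrite // lerDl; apply: sumr_ge0 => I _; rewrite addr_ge0.
exists r => // x; have K0 : 0 <= 2 * r * cauchy_kernel 0 r x.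
  have r2 : 0 < 2 * r by rewrite mulr_gt0.
  exact/ltW/(mulr_gt0 r2)/cauchy_kernel_gt0.
have u0 : 0 <= union_indic V x by apply: sumr_ge0 => I _; rewrite indic_itvE.
rewrite u0 /=; have [->//|u1] := eqVneq (union_indic V x) 0.
have u_le1 : union_indic V x <= 1.
  have /eqP := V2 x; rewrite expr2 -{3}[union_indic V x]mulr1 -subr_eq0 -mulrBr mulf_eq0 subr_eq0.
  by rewrite (negPf u1) /= => /eqP ->.
apply: le_trans u_le1 _; apply: half_le_kernel => //; rewrite subr0.
have [I IV /= Ix] : exists2 I, I \in V & I.1 <= x < I.2.
  apply/hasP; apply: contraNT u1 => /hasPn H; rewrite /union_indic big_seq big1 // => I /H.
  by rewrite indic_itvE => /negPf ->.
have : `|I.1| + `|I.2| <= \sum_(I <- V) (`|I.1| + `|I.2|).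
  rewrite (big_rem I) //= lerDl; apply: sumr_ge0 => I' _; exact: addr_ge0.
move: Ix => /andP[x1 x2] h; rewrite /r; have h1 := ler_norm I.2.
have h2 := ler_norm (- I.1); rewrite normrN in h2.
have h3 := normr_ge0 I.1; have h4 := normr_ge0 I.2.
by rewrite ler_norml; apply/andP; split; lra.
Qed.

(** For a Poisson process, the exponential is the probability that the union is
    empty. *)
Lemma avoidance_asymptotic V e : intervals V ->
  (forall x, union_indic V x ^+ 2 = union_indic V x) -> 0 < e ->
  exists n0, forall n, (n0 <= n)%N -> (0 < n)%N ->
  `|fine (P n [set w | linstat (union_indic V) (rescale n E (@sn n w)) = 0]) -
    expR (- mean (P n) (fun w => linstat (union_indic V) (rescale n E (@sn n w))))| <= e.
Proof.
move=> V12 V2 e0; have [r r0 Vr] := union_indic_kernel V2.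
have e4 : 0 < e / 4 by rewrite divr_gt0.
have [m1 H1] := union_gap V12 e4.
have [m2 H2] := eventually_le ((2 * r * C * pi) ^+ 2) e4.
pose m := (maxn m1 m2).+1; have m0 : (0 < m)%N by [].
have [|n1 {}H1] := H1 m _ m0; first by rewrite ltnW // ltnS leq_maxl.
have {}H2 : (2 * r * C * pi) ^+ 2 / m%:R <= e / 4.
  by apply: H2 => //; rewrite ltnW // ltnS leq_maxr.
exists (maxn n1 (2 * m)) => n; rewrite geq_max => /andP[nn1 nm] n0.
have L2 : (2 <= n %/ m)%N by rewrite leq_divRL.
have mL : (m * (n %/ m) <= n)%N by rewrite mulnC leq_trunc_div.
have [I1 E1] := H1 n nn1 n0 L2 mL.
have r20 : 0 <= 2 * r by rewrite mulr_ge0 // ltW.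
have mN := measurable_union n0 V12.
have mNp p : measurable_fun setT ((fun w => linstat (union_indic V) (rescale n E (block_eigs L2 mL p w)))
   : sigmaType (@X n) (block_variables L2 mL p) -> R).
  apply: (@measurable_union_stat _ (sigmaType (@X n) (block_variables L2 mL p))
    (fun w => rescale n E (block_eigs L2 mL p w))) => // t h h0.
  exact: (sigma_block_kernel E (block_eigsP L2 mL) n0 t h0).
have := avoidance_estimate (@mX n) (@indep n) C0 (@aC n) (@snP n) (block_eigsP L2 mL) n0
  V2 Vr r0 r20 mN mNp I1 m0.
by move=> H; apply: le_trans H _; lra.
Qed.

End Asymptotics.
(** * Vague topology and counts in the cells of a grid *)

Section Grid.
Context {R : realType}.
Implicit Types (mu nu : point_measure R) (k i j : nat).

Definition npoints mu (A : set R) : R := fine (mu A).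

(** With mesh K^-3 on [-K, K), K = k + 1, the number of cells times the square of
    the mesh tends to 0. *)
Definition mesh k : R := k.+1%:R ^- 3.
Definition node k i : R := - k.+1%:R + i%:R * mesh k.
Definition ncells k := (2 * k.+1 ^ 4)%N.
Definition cell k i : set R := `[node k i, node k i.+1[%classic.

Lemma mesh_gt0 k : 0 < mesh k.
Proof. by rewrite invr_gt0 exprn_gt0. Qed.

Lemma mesh_le1 k : mesh k <= k.+1%:R^-1.
Proof.
rewrite /mesh lef_pV2 ?posrE ?exprn_gt0 // exprS ler_peMr //.
by rewrite -natrX ler1n expn_gt0.
Qed.

Lemma nodeS k i : node k i.+1 = node k i + mesh k.
Proof. by rewrite /node -natr1; ring. Qed.

Lemma node_lt k i : node k i < node k i.+1.
Proof. by rewrite nodeS ltrDl mesh_gt0. Qed.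

Lemma cellE k i x : cell k i x <-> node k i <= x < node k i.+1.
Proof. by rewrite /cell /= in_itv. Qed.

Lemma indic_cell k i x : \1_(cell k i) x = (node k i <= x < node k i.+1)%R%:R :> R.
Proof. exact: indic_itvE. Qed.

Lemma cell_uniq k i j x : cell k i x -> cell k j x -> i = j.
Proof.
move=> /cellE /andP[a1 a2] /cellE /andP[b1 b2].
suff H i' j' : node k i' < node k j'.+1 -> (i' <= j')%N.
  by apply/eqP; rewrite eqn_leq !H //; [apply: le_lt_trans b1 a2|apply: le_lt_trans a1 b2].
by rewrite /node ltrD2l ltr_pM2r ?mesh_gt0 // ltr_nat.
Qed.

Lemma cell_cover k x : - k.+1%:R <= x < k.+1%:R -> exists2 i, (i < ncells k)%N & cell k i x.
Proof.
move=> /andP[x1 x2].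
have y0 : 0 <= (x + k.+1%:R) * k.+1%:R ^+ 3 by rewrite mulr_ge0 ?exprn_ge0 //; lra.
pose i := Num.truncn ((x + k.+1%:R) * k.+1%:R ^+ 3).
have K3 : 0 < k.+1%:R ^+ 3 :> R by rewrite exprn_gt0.
have /andP[i1 i2] := truncn_itv y0; rewrite -/i in i1 i2.
exists i.
  rewrite -(ltr_nat R); apply: le_lt_trans i1 _.
  rewrite /ncells natrM natrX -[_ ^+ 4]/(_ ^+ (1 + 3)) exprD expr1 mulrA ltr_pM2r //; lra.
apply/cellE; rewrite /node /mesh.
move: i1 i2; rewrite -ler_pdivrMr // -ltr_pdivlMr // => i1 i2.
by rewrite addrC lerBlDr i1 addrC ltrBrDr.
Qed.

Lemma node_ge k i : - k.+1%:R <= node k i.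
Proof. by rewrite /node lerDl mulr_ge0 // ltW // mesh_gt0. Qed.

Lemma node_le k i : (i <= ncells k)%N -> node k i <= k.+1%:R.
Proof.
rewrite -(ler_nat R) /node /mesh addrC lerBlDr => h.
rewrite ler_pdivrMr ?exprn_gt0 //; apply: le_trans h _.
rewrite /ncells natrM natrX; move: (k.+1%:R : R) => x.
by rewrite le_eqVlt; apply/orP; left; apply/eqP; ring.
Qed.

Lemma measurable_cell k i : measurable (cell k i : set (measurableTypeR R)).
Proof. exact: measurable_itv. Qed.

Lemma itv_finite mu (x y : R) : (mu `[x, y[%classic < +oo)%E.
Proof.
apply: le_lt_trans (pm_radon mu (@segment_compact _ x y)).
by apply: le_measure; rewrite ?inE; [exact: measurable_itv|exact: measurable_itv|];
  apply: subset_itv_co_cc.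
Qed.

Lemma npoints_nat mu x y : exists c : nat, npoints mu `[x, y[%classic = c%:R.
Proof.
have [c cE] := pm_nat (measurable_itv `[x, y[ : measurable (_ : set (measurableTypeR R))) (itv_finite mu x y).
by exists c; rewrite /npoints cE.
Qed.

Lemma npoints_ge0 mu A : 0 <= npoints mu A.
Proof. by apply: fine_ge0; exact: measure_ge0. Qed.

Lemma integrable_cells mu k (r : seq nat) (c : nat -> R) :
  mu.-integrable setT (EFin \o (fun x => \sum_(i <- r) c i * \1_(cell k i) x)) /\
  \int[mu]_x (\sum_(i <- r) c i * \1_(cell k i) x) =
  \sum_(i <- r) c i * npoints mu (cell k i).
Proof.
elim: r => [|i r [IH1 IH2]].
  rewrite (_ : (EFin \o _) = cst 0%E); last by apply/funext => x /=; rewrite big_nil.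
  split; first exact: integrable0.
  by under eq_Rintegral do rewrite big_nil; rewrite big_nil Rintegral_cst // mul0r.
have mc := measurable_cell k i.
have Ii : mu.-integrable setT (EFin \o (\1_(cell k i) : R -> R)).
  apply/integrableP; split; first exact/measurable_EFinP/measurable_indic.
  under eq_integral do rewrite gee0_abs ?lee_fin //.
  by rewrite integral_indic // setIT; exact: itv_finite.
have Ici : mu.-integrable setT (EFin \o (fun x => c i * \1_(cell k i) x)).
  rewrite (_ : (EFin \o _) = (fun x => (c i)%:E * (\1_(cell k i) x)%:E)%E) //.
  exact: integrableZl.
split.
  rewrite (_ : (EFin \o _) = (fun x => (c i * \1_(cell k i) x)%:E +
    (\sum_(j <- r) c j * \1_(cell k j) x)%:E)%E).
    exact: integrableD.
  by apply/funext => x /=; rewrite big_cons EFinD.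
under eq_Rintegral do rewrite big_cons.
rewrite RintegralD // IH2 big_cons RintegralZl //; congr (_ * _ + _).
by rewrite /Rintegral integral_indic // setIT.
Qed.

(** The cells on the right are those that can meet the support [-K, K], since the
    mesh is at most 1; the others do not contribute, which keeps the error bounded
    by the mass near the support. *)
Lemma step_approx (f : R -> R) K e D k x : 0 <= e ->
  (forall y, K < `|y| -> f y = 0) ->
  (forall y z, `|y - z| < D -> `|f y - f z| <= e) ->
  mesh k < D -> K + 1 < k.+1%:R ->
  `|f x - \sum_(i <- iota 0 (ncells k)) f (node k i) * \1_(cell k i) x| <=
  \sum_(i <- iota 0 (ncells k)) (e *+ (`|node k i| <= K + 1)%R) * \1_(cell k i) x.
Proof.
move=> e0 fK fe kD Kk.
case: (boolP (- k.+1%:R <= x < k.+1%:R)) => [|xk]; last first.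
  have xK : K < `|x|.
    rewrite ltr_normr; clear -Kk xk; move: (k.+1%:R : R) Kk xk => u Kk; rewrite negb_and -ltNge -leNgt => /orP[] xk; apply/orP.
      by right; lra.
    by left; lra.
  rewrite fK // sub0r normrN big1_seq ?normr0.
    by apply: sumr_ge0 => i _; rewrite mulr_ge0 // ?mulrn_wge0 // indicE.
  move=> i; rewrite mem_iota add0n => /andP[_ /andP[_ ik]].
  rewrite indic_cell; case: (boolP (_ <= x < _)) => [/andP[x1 x2]|]; last by rewrite mulr0.
  by rewrite (le_trans (node_ge k i) x1) (lt_le_trans x2 (node_le ik)) in xk.
move=> /cell_cover [i ik ix].
have sumE (g : nat -> R) : \sum_(j <- iota 0 (ncells k)) g j * \1_(cell k j) x = g i.
  rewrite (bigD1_seq i) ?iota_uniq ?mem_iota //= big1 ?addr0.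
    by rewrite indicE mem_set // mulr1.
  move=> j ji; rewrite indicE memNset ?mulr0 // => jx.
  by rewrite (cell_uniq jx ix) eqxx in ji.
rewrite !sumE; move/cellE: ix => /andP[x1 x2]; rewrite nodeS in x2.
have m1 := mesh_le1 k; have k1 : k.+1%:R^-1 <= 1 :> R by rewrite invf_le1 // ler1n.
case: (leP `|node k i| (K + 1)) => nK.
  by apply: fe; apply: le_lt_trans kD; rewrite ler_norml; apply/andP; split; lra.
have xn : `|node k i| <= `|x| + mesh k.
  have := ler_distD x (node k i) 0; rewrite !subr0 distrC.
  have : `|x - node k i| <= mesh k by rewrite ler_norml; apply/andP; split; lra.
  lra.
have f1 : K < `|x|.
  rewrite -(ltrD2r 1); apply: lt_le_trans nK _; apply: le_trans xn _.
  by rewrite lerD2l (le_trans m1 k1).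
have f2 : K < `|node k i| by apply: lt_trans nK; rewrite ltrDl.
by rewrite !fK // subrr normr0 mulr0n.
Qed.

(** Compactness of [-(K + 1), K + 1], in the form of near coverings. *)
Lemma uniform_continuity (f : R -> R) K e : continuous f -> 0 < e ->
  (forall y, K < `|y| -> f y = 0) ->
  exists2 D, 0 < D & forall y z, `|y - z| < D -> `|f y - f z| <= e.
Proof.
move=> cf e0 fK.
have := (@segment_compact _ (- (K + 1)) (K + 1)).
rewrite compact_near_coveringP => cov.
have H : \forall D \near 0^'+, `[- (K + 1), K + 1] `<=`
    [set y | forall z, `|y - z| < D -> `|f y - f z| <= e].
  apply: (cov R 0^'+ (fun D y => forall z, `|y - z| < D -> `|f y - f z| <= e)) => y _.
  have e2 : 0 < e / 2 by rewrite divr_gt0.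
  have := cf y; move=> /cvgrPdist_lt /(_ _ e2) /nbhs_ballP [r /= r0 Hr].
  have r2 : 0 < r / 2 by rewrite divr_gt0.
  exists (ball y (r / 2), [set D | D < r / 2]); first split => /=.
  - exact: nbhsx_ballx.
  - exact: nbhs_right_lt.
  move=> [y' D] /= [yy' Dr] z y'z.
  have h1 : `|f y - f y'| < e / 2.
    by apply: Hr; rewrite /ball /=; apply: lt_trans yy' _; lra.
  have h2 : `|f y - f z| < e / 2.
    apply: Hr; rewrite /ball /=; have := ler_distD y' y z; move: yy'; rewrite /ball /=.
    by lra.
  have := ler_distD (f y) (f y') (f z); rewrite (distrC (f y') (f y)); lra.
have H0 : \forall D \near (0 : R)^'+, 0 < D by exact: nbhs_right_gt.
have [D [HD D0]] := filter_ex (filterI H H0).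
exists (Num.min D 1) => [|y z]; first by rewrite lt_min D0 ltr01.
rewrite lt_min => /andP[yzD yz1]; have [yK|yK] := leP `|y| (K + 1).
  by apply: HD yzD; rewrite /= in_itv /= -ler_norml.
have h1 : K < `|y| by apply: lt_trans yK; rewrite ltrDl.
have h2 : K < `|z|.
  have := ler_normD (y - z) z; rewrite subrK; lra.
by rewrite !fK // subrr normr0 ltW.
Qed.

(** Integrals against a test function are determined, up to a small error, by
    the numbers of points in the cells meeting its support. *)
Lemma integral_approx mu (f : R -> R) K e D k : continuous f -> 0 <= e ->
  (forall y, K < `|y| -> f y = 0) ->
  (forall y z, `|y - z| < D -> `|f y - f z| <= e) ->
  mesh k < D -> K + 1 < k.+1%:R ->
  `|\int[mu]_x f x - \sum_(i <- iota 0 (ncells k)) f (node k i) * npoints mu (cell k i)| <=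
  \sum_(i <- iota 0 (ncells k)) (e *+ (`|node k i| <= K + 1)%R) * npoints mu (cell k i).
Proof.
move=> cf e0 fK fe kD Kk; have step := step_approx _ e0 fK fe kD Kk.
have [I1 E1] := integrable_cells mu k (iota 0 (ncells k)) (fun i => f (node k i)).
have [I2 E2] := integrable_cells mu k (iota 0 (ncells k)) (fun i => e *+ (`|node k i| <= K + 1)%R).
rewrite -E1 -E2; set S := fun x => \sum_(i <- _) f _ * _ in I1 *.
set B := fun x => \sum_(i <- _) _ *+ _ * _ in I2 *.
have mf : measurable_fun setT (f : measurableTypeR R -> R) by exact: continuous_measurable_fun.
have ID : mu.-integrable setT (EFin \o (fun x => f x - S x)).
  apply: (le_integrable measurableT _ _ I2).
    apply/measurable_EFinP; apply: measurable_funB => //.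
    by have /integrableP[/measurable_EFinP] := I1.
  by move=> x _ /=; rewrite lee_fin; apply: le_trans (step x) _; exact: ler_norm.
have If : mu.-integrable setT (EFin \o f).
  rewrite (_ : EFin \o f = (fun x => (f x - S x)%:E + (S x)%:E)%E).
    exact: integrableD.
  by apply/funext => x /=; rewrite -EFinD subrK.
rewrite -RintegralB //; apply: le_trans (le_normr_Rintegral measurableT ID) _.
apply: le_Rintegral => //; exact: (integrable_abse ID).
Qed.

(** The cap makes a function of the counts a finite sum of indicators; it grows with
    k, so that it does not affect a given measure on a given bounded set for
    large k. *)
Definition counts k mu : {ffun 'I_(ncells k) -> 'I_k.+3} :=
  [ffun i : 'I_(ncells k) => inord (minn k.+2 (Num.truncn (npoints mu (cell k i))))].

Lemma counts_eq k mu nu (i : 'I_(ncells k)) : counts k nu = counts k mu ->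
  npoints mu (cell k i) < k.+2%:R -> npoints nu (cell k i) = npoints mu (cell k i).
Proof.
move=> /ffunP /(_ i); rewrite !ffunE => /(congr1 (@nat_of_ord _)).
rewrite !inordK ?ltnS ?geq_minl //.
have [c ->] := npoints_nat mu (node k i) (node k i.+1).
have [c' ->] := npoints_nat nu (node k i) (node k i.+1).
by rewrite !natrK ltr_nat => h c1; congr (_%:R); lia.
Qed.

(** The cells near [-K, K] are disjoint and stay in a fixed bounded interval. *)
Lemma near_cells_mass mu K : 0 <= K -> exists N : R, forall k,
  \sum_(i <- iota 0 (ncells k)) (1 *+ (`|node k i| <= K + 1)%R) * npoints mu (cell k i) <= N.
Proof.
move=> K0; exists (npoints mu `[- (K + 2), K + 2[%classic) => k.
have [I1 <-] := integrable_cells mu k (iota 0 (ncells k)) (fun i => 1 *+ (`|node k i| <= K + 1)%R).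
have mI : measurable (`[- (K + 2), K + 2[%classic : set (measurableTypeR R)) by exact: measurable_itv.
have I2 : mu.-integrable setT (EFin \o (\1_(`[- (K + 2), K + 2[%classic) : R -> R)).
  apply/integrableP; split; first exact/measurable_EFinP/measurable_indic.
  under eq_integral do rewrite gee0_abs ?lee_fin //.
  by rewrite integral_indic // setIT; exact: itv_finite.
have -> : npoints mu `[- (K + 2), K + 2[%classic =
    \int[mu]_x (\1_(`[- (K + 2), K + 2[%classic) x : R).
  by rewrite /Rintegral integral_indic // setIT.
apply: le_Rintegral => // x _.
have [[i ik ix]|nx] := pselect (exists2 i, (i < ncells k)%N & cell k i x); last first.
  rewrite big1_seq ?indicE // => i; rewrite mem_iota add0n => /andP[_ /andP[_ ik]].
  by rewrite indicE memNset ?mulr0 // => ix; apply: nx; exists i.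
rewrite (bigD1_seq i) ?iota_uniq ?mem_iota //= big1 ?addr0; last first.
  move=> j ji; rewrite indicE memNset ?mulr0 // => jx.
  by rewrite (cell_uniq jx ix) eqxx in ji.
rewrite indicE mem_set // mulr1; case: (leP `|node k i| (K + 1)) => nK; last by rewrite indicE.
move/cellE: ix => /andP[x1 x2]; rewrite nodeS in x2.
have m1 := le_trans (mesh_le1 k) (_ : k.+1%:R^-1 <= 1).
have {}m1 : mesh k <= 1 by apply: m1; rewrite invf_le1 // ler1n.
rewrite indic_itvE; move: nK; rewrite ler_norml => /andP[n1 n2].
have -> : - (K + 2) <= x by apply: le_trans x1; apply: le_trans n1; lra.
have -> // : x < K + 2.
by apply: lt_le_trans x2 _; apply: le_trans (lerD n2 m1) _; lra.
Qed.

Lemma test_fun_support (phi : test_function R) :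
  exists2 K, 0 <= K & forall y, K < `|y| -> test_fun phi y = 0.
Proof.
have cpt : compact (closure [set x | test_fun phi x != 0]) := s2valP' phi.
have [M [_ HM]] := compact_bounded cpt.
have h : M < `|M| + 1 by apply: le_lt_trans (ler_norm M) _; rewrite ltrDl.
exists (`|M| + 1) => [|y yM]; first by rewrite addr_ge0.
apply: contrapT => /eqP fy; have := HM _ h y; rewrite /= leNgt yM.
by move=> /(_ (@subset_closure _ _ y fy)).
Qed.

(** The sets of measures with the same counts as mu generate a filter. It converges
    to mu in the vague topology, by [integral_approx] applied to mu and to the
    other measure, whose sums over cells are equal. *)
Lemma grid_continuous (Phi : point_measure R -> R) mu e : continuous Phi -> 0 < e ->
  exists k0, forall k, (k0 <= k)%N -> forall nu, counts k nu = counts k mu ->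
  `|Phi mu - Phi nu| < e.
Proof.
move=> cPhi e0.
pose F : set_system (point_measure R) := [set A | exists k0, forall k, (k0 <= k)%N ->
  forall nu, counts k nu = counts k mu -> A nu].
have FF : Filter F.
  split; first by exists 0%N.
    move=> A B [k1 H1] [k2 H2]; exists (maxn k1 k2) => k; rewrite geq_max => /andP[kk1 kk2] nu h.
    by split; [exact: H1 h|exact: H2 h].
  by move=> A B AB [k1 H1]; exists k1 => k kk nu h; apply: AB; exact: H1 h.
suff Fmu : F --> mu.
  have := cPhi mu; move=> /cvgrPdist_lt /(_ e e0) /Fmu [k0 H].
  by exists k0 => k kk nu h; exact: H h.
have img : (vague_map (R := R) @ F) --> vague_map mu.
  apply/cvg_sup => phi A /= [B [[U Uop <-] Umu BA]].
  apply: filterS BA _; rewrite /=.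
  have : (fun nu => vague_map nu phi) @ F --> vague_map mu phi; last first.
    by apply; exact: open_nbhs_nbhs.
  have [K K0 fK] := test_fun_support phi.
  have cf : continuous (test_fun phi) := s2valP phi.
  apply/cvgrPdist_le => e1 e10.
  have [N HN] := near_cells_mass mu K0.
  have N0 : 0 <= N.
    apply: le_trans (HN 0%N); apply: sumr_ge0 => i _.
    by rewrite mulr_ge0 ?mulrn_wge0 // npoints_ge0.
  have e20 : 0 < e1 / (2 * (N + 1)).
    by rewrite divr_gt0 // mulr_gt0 // (@lt_le_trans _ _ 1) // lerDr.
  have [D D0 fe] := uniform_continuity cf e20 fK.
  exists (maxn (Num.truncn D^-1) (maxn (Num.truncn (K + 1)) (Num.truncn N))).
  move=> k; rewrite !geq_max => /and3P[kD kK kN] nu h.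
  have trunc_lt (x : R) : (Num.truncn x <= k)%N -> x < k.+1%:R.
    by move=> xk; apply: lt_le_trans (truncnS_gt x) _; rewrite ler_nat ltnS.
  have {}kD : mesh k < D.
    apply: le_lt_trans (mesh_le1 k) _; rewrite -[D]invrK ltf_pV2 ?posrE ?invr_gt0 //.
    exact: trunc_lt.
  have A1 := integral_approx mu cf (ltW e20) fK fe kD (trunc_lt _ kK).
  have A2 := integral_approx nu cf (ltW e20) fK fe kD (trunc_lt _ kK).
  have near_eq i : (i < ncells k)%N -> `|node k i| <= K + 1 ->
      npoints nu (cell k i) = npoints mu (cell k i).
    move=> ik iK; apply: (counts_eq (i := Ordinal ik) h) => /=.
    apply: (@lt_le_trans _ _ k.+1%:R); last by rewrite ler_nat.
    apply: le_lt_trans (trunc_lt _ kN); apply: le_trans (HN k).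
    rewrite (bigD1_seq i) ?iota_uniq ?mem_iota //= iK mulr1n mul1r lerDl.
    by apply: sumr_ge0 => j _; rewrite mulr_ge0 ?mulrn_wge0 // npoints_ge0.
  have S1 : \sum_(i <- iota 0 (ncells k)) test_fun phi (node k i) * npoints nu (cell k i) =
      \sum_(i <- iota 0 (ncells k)) test_fun phi (node k i) * npoints mu (cell k i).
    apply: eq_big_seq => i; rewrite mem_iota add0n => /andP[_ ik].
    have [iK|iK] := leP `|node k i| (K + 1); first by rewrite near_eq.
    by rewrite fK ?mul0r //; apply: lt_trans iK; rewrite ltrDl.
  have S2 (e' : R) : \sum_(i <- iota 0 (ncells k)) (e' *+ (`|node k i| <= K + 1)%R) * npoints nu (cell k i) =
      e' * \sum_(i <- iota 0 (ncells k)) (1 *+ (`|node k i| <= K + 1)%R) * npoints mu (cell k i).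
    rewrite mulr_sumr; apply: eq_big_seq => i; rewrite mem_iota add0n => /andP[_ ik].
    have [iK|iK] := leP `|node k i| (K + 1); last by rewrite !mulr0n !mul0r mulr0.
    by rewrite near_eq // !mulr1n mul1r.
  have S3 (e' : R) : \sum_(i <- iota 0 (ncells k)) (e' *+ (`|node k i| <= K + 1)%R) * npoints mu (cell k i) =
      e' * \sum_(i <- iota 0 (ncells k)) (1 *+ (`|node k i| <= K + 1)%R) * npoints mu (cell k i).
    rewrite mulr_sumr; apply: eq_bigr => i _.
    by case: (_ <= _); rewrite ?mulr0n ?mulr1n ?mul1r ?mul0r ?mulr0.
  rewrite S1 S2 in A2; rewrite S3 in A1.
  have Be := ler_wpM2l (ltW e20) (HN k).
  have {}A1 := le_trans A1 Be; have {}A2 := le_trans A2 Be.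
  rewrite distrC in A2; apply: le_trans (ler_distD _ _ _) (le_trans (lerD A1 A2) _).
  have -> : e1 / (2 * (N + 1)) * N + e1 / (2 * (N + 1)) * N = e1 * (N / (N + 1)).
    by field; rewrite gt_eqF // (@lt_le_trans _ _ 1) // lerDr.
  rewrite ler_piMr ?(ltW e10) // ler_pdivrMr ?mul1r ?lerDl //.
  by rewrite (@lt_le_trans _ _ 1) // lerDr.
move=> A /= [B [[U Uop <-] Umu BA]].
apply: filterS BA _; have FU : (vague_map (R := R) @ F) U.
  by apply: img; exact: open_nbhs_nbhs.
exact: FU.
Qed.

End Grid.
(** * Laws of counts in the cells of a grid *)

Section Configurations.
Context {R : realType}.
Implicit Types (mu nu : point_measure R) (k : nat).

Definition occupied k mu : {ffun 'I_(ncells k) -> bool} :=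
  [ffun i : 'I_(ncells k) => npoints mu (cell k i) != 0].

(** The counts of a configuration with at most one point per cell. *)
Definition simple_counts k (o : {ffun 'I_(ncells k) -> bool}) :
    {ffun 'I_(ncells k) -> 'I_k.+3} := [ffun i => inord (o i)].

Lemma counts_simple k mu : (forall i : 'I_(ncells k), npoints mu (cell k i) < 2) ->
  counts k mu = simple_counts (occupied k mu).
Proof.
move=> H; apply/ffunP => i; rewrite !ffunE; have := H i.
have [c ->] := npoints_nat mu (node k i) (node k i.+1).
rewrite ltr_nat natrK pnatr_eq0; case: c => [|[|c]] // _.
Qed.

Variables (Phi : point_measure R -> R) (M : R).
Hypothesis Phi_bd : forall mu, 0 <= Phi mu <= M.

(** The largest function of the counts below Phi. *)
Definition cell_inf k (t : {ffun 'I_(ncells k) -> 'I_k.+3}) : R :=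
  inf [set Phi nu | nu in [set nu | counts k nu = t]].

Let values_lb k t : has_lbound [set Phi nu | nu in [set nu | counts k nu = t]].
Proof. by exists 0 => _ [nu _ <-]; have /andP[] := Phi_bd nu. Qed.

Lemma cell_inf_le k mu : cell_inf (counts k mu) <= Phi mu.
Proof. by apply: ge_inf => //; exists mu. Qed.

Lemma cell_inf_bd k (t : {ffun 'I_(ncells k) -> 'I_k.+3}) : 0 <= M -> 0 <= cell_inf t <= M.
Proof.
move=> M0; have [[_ [nu nut _]]|E] := pselect (nonempty [set Phi nu | nu in [set nu | counts k nu = t]]).
  rewrite lb_le_inf /=; last by move=> _ [mu _ <-]; have /andP[] := Phi_bd mu.
    by rewrite -nut; apply: le_trans (cell_inf_le k nu) _; have /andP[] := Phi_bd nu.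
  by exists (Phi nu), nu.
by rewrite /cell_inf inf_out ?lexx // => -[ne _]; exact: E.
Qed.

Lemma cell_inf_cvg mu : continuous Phi -> cell_inf (counts k mu) @[k --> \oo] --> Phi mu.
Proof.
move=> cPhi; apply/cvgrPdist_le => e e0; have [k0 H] := grid_continuous mu cPhi e0.
exists k0 => // k /= kk; rewrite ger0_norm ?subr_ge0 ?cell_inf_le // lerBlDl -lerBlDr.
apply: lb_le_inf; first by exists (Phi mu), mu.
move=> _ [nu nut <-]; have := H k kk nu nut; rewrite ltr_norml => /andP[_ h].
by rewrite lerBlDl -lerBlDr ltW.
Qed.

End Configurations.

Section CountingLaw.
Context {R : realType} d {T : measurableType d} (P : probability T R).
Variable xi : T -> point_measure R.
Hypothesis mxi : forall x y, x < y ->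
  measurable_fun setT (fun w => npoints (xi w) `[x, y[%classic).

Let N k i w := npoints (xi w) (cell k i).

Let mN k i : measurable_fun setT (N k i).
Proof. exact: mxi (node_lt k i). Qed.

Let N_nat k i w : exists c : nat, N k i w = c%:R.
Proof. exact: npoints_nat. Qed.

Lemma measurable_finite_family (I : finType) (A : I -> set T) :
  (forall i, measurable (A i)) -> measurable [set w | forall i, A i w].
Proof.
move=> mA; have -> : [set w | forall i, A i w] = \bigcap_(i in [set: I]) A i.
  by apply/seteqP; split => w H i; [move=> _; exact: H|exact: H].
by apply: fin_bigcap_measurable => //; exact: finite_finset.
Qed.

Lemma measurable_count_event k (i : 'I_(ncells k)) c :
  measurable [set w | counts k (xi w) i = c].
Proof.
have [ck|ck] := ltnP c k.+2.
  rewrite (_ : [set w | _] = N k i @^-1` [set c%:R]).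
    by rewrite -[X in measurable X]setTI; apply: mN => //; exact: measurable_set1.
  apply/seteqP; split => w /=; rewrite ffunE -/(N k i w); have [e ->] := N_nat k i w; rewrite natrK.
    by move=> h; rewrite -{}h inordK ?ltnS ?geq_minl // in ck *; congr (_%:R); lia.
  move=> /eqP; rewrite eqr_nat => /eqP ->; apply: val_inj => /=.
  by rewrite inordK; lia.
rewrite (_ : [set w | _] = N k i @^-1` `[k.+2%:R, +oo[%classic).
  by rewrite -[X in measurable X]setTI; apply: mN => //; exact: measurable_itv.
apply/seteqP; split => w /=; rewrite ffunE -/(N k i w); have [e ->] := N_nat k i w; rewrite natrK.
  move=> h; rewrite in_itv /= andbT ler_nat; move: ck; rewrite -h inordK ?ltnS ?geq_minl //.
  by rewrite leq_min => /andP[].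
rewrite in_itv /= andbT ler_nat => h; apply: val_inj => /=; rewrite inordK ?ltnS ?geq_minl //.
by have := ltn_ord c; lia.
Qed.

Lemma measurable_counts k (g : {ffun 'I_(ncells k) -> 'I_k.+3} -> R) :
  measurable_fun setT (fun w => g (counts k (xi w))).
Proof.
have mt t : measurable [set w | counts k (xi w) = t].
  rewrite (_ : [set w | _] = [set w | forall i, [set w | counts k (xi w) i = t i] w]).
    by apply: measurable_finite_family => i; exact: measurable_count_event.
  by apply/seteqP; split => [w /= -> //|w H]; apply/ffunP.
rewrite (_ : (fun w => _) = (fun w => \sum_t g t * \1_[set w | counts k (xi w) = t] w)).
  apply: measurable_sum => t; apply: measurable_funM; first exact: measurable_cst.
  exact: measurable_indic.
apply/funext => w; rewrite (bigD1 (counts k (xi w))) //= indicE mem_set // mulr1.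
by rewrite big1 ?addr0 // => t tw; rewrite indicE memNset ?mulr0 // => /= E; rewrite E eqxx in tw.
Qed.

(** The cells in Z are empty and those in B are not: two lists, so that inclusion-
    exclusion can move one cell at a time from B to Z. *)
Definition pattern k (Z B : seq nat) : set T :=
  [set w | (forall i, i \in Z -> N k i w = 0) /\ (forall i, i \in B -> N k i w <> 0)].

Lemma measurable_pattern k Z B : measurable (pattern k Z B).
Proof.
have mz i : measurable [set w | N k i w = 0].
  rewrite (_ : [set w | _] = N k i @^-1` [set 0]) //.
  by rewrite -[X in measurable X]setTI; apply: mN => //; exact: measurable_set1.
have -> : pattern k Z B = (\bigcap_(i in [set` Z]) [set w | N k i w = 0]) `&`
    (\bigcap_(i in [set` B]) ~` [set w | N k i w = 0]).
  by apply/seteqP; split => w [h1 h2]; split => i; [exact: h1|exact: h2|exact: h1|exact: h2].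
by apply: measurableI; apply: fin_bigcap_measurable => // i _; exact: measurableC.
Qed.

Lemma pattern_cons k Z B i : i \notin Z -> i \notin B ->
  fine (P (pattern k Z (i :: B))) = fine (P (pattern k Z B)) - fine (P (pattern k (i :: Z) B)).
Proof.
move=> iZ iB; have m := @measurable_pattern k.
have -> : pattern k Z B = pattern k Z (i :: B) `|` pattern k (i :: Z) B.
  apply/seteqP; split => w; rewrite /pattern /=.
    move=> [h1 h2]; have [h|h] := pselect (N k i w = 0); [right|left]; split => // j;
      rewrite inE => /orP[/eqP ->|] //; [exact: h1|exact: h2].
  move=> [] [h1 h2]; split => // j jZ; [apply: h2|apply: h1]; by rewrite inE jZ orbT.
rewrite measureU //; last first.
  apply/seteqP; split => w //= [[_ h1] [h2 _]].
  by have := h1 i (mem_head _ _); rewrite h2 // mem_head.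
by rewrite fineD ?fin_num_measure // addrK.
Qed.

Definition crowd k i : set T := [set w | 2 <= N k i w].

Lemma measurable_crowd k i : measurable (crowd k i).
Proof.
rewrite (_ : crowd k i = N k i @^-1` `[2, +oo[%classic); last first.
  by apply/seteqP; split => w; rewrite /= in_itv /= andbT.
by rewrite -[X in measurable X]setTI; apply: mN => //; exact: measurable_itv.
Qed.

Definition empty_cells k (o : {ffun 'I_(ncells k) -> bool}) : seq nat :=
  [seq val i | i <- enum 'I_(ncells k) & ~~ o i].
Definition full_cells k (o : {ffun 'I_(ncells k) -> bool}) : seq nat :=
  [seq val i | i <- enum 'I_(ncells k) & o i].

Lemma occupied_pattern k o :
  [set w | occupied k (xi w) = o] = pattern k (empty_cells o) (full_cells o).
Proof.
apply/seteqP; split => w /=.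
  move=> <-; split => i /mapP[j]; rewrite mem_filter ffunE => /andP[h _] ->.
    by move: h; rewrite negbK => /eqP.
  by apply/eqP.
move=> [h1 h2]; apply/ffunP => i; rewrite ffunE; case oi: (o i).
  by apply/eqP; apply: h2; apply/mapP; exists i; rewrite // mem_filter oi mem_enum.
apply/negbTE; rewrite negbK; apply/eqP; apply: h1; apply/mapP; exists i => //.
by rewrite mem_filter oi mem_enum.
Qed.

Variables (Phi : point_measure R -> R) (M : R).
Hypothesis Phi_bd : forall mu, 0 <= Phi mu <= M.
Hypothesis M0 : 0 <= M.
Hypothesis cPhi : continuous Phi.

(** A pointwise limit of functions of finitely many counts. *)
Lemma measurable_functional : measurable_fun setT (fun w => Phi (xi w)).
Proof.
apply: (@measurable_fun_cvg _ _ _ _ (fun k w => cell_inf Phi (counts k (xi w)))).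
  by move=> k; exact: measurable_counts.
by move=> w _; apply: cell_inf_cvg.
Qed.

Lemma integrable_cell_inf k : ge0_integrable P (fun w => cell_inf Phi (counts k (xi w))).
Proof.
have [I1 E1] := mean_cst P M0.
have [] // := mean_le (@measurable_counts k (@cell_inf _ Phi k)) _ I1.
by move=> w; exact: (cell_inf_bd Phi_bd).
Qed.

Lemma integrable_functional : ge0_integrable P (fun w => Phi (xi w)).
Proof.
have [I1 E1] := mean_cst P M0.
by have [] // := mean_le measurable_functional _ I1.
Qed.

Lemma mean_cell_inf_le k :
  mean P (fun w => cell_inf Phi (counts k (xi w))) <= mean P (fun w => Phi (xi w)).
Proof.
have [||_] // := @mean_le _ _ _ P (fun w => cell_inf Phi (counts k (xi w))) _ _ _ integrable_functional.
  exact: measurable_counts.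
by move=> w; rewrite (cell_inf_le Phi_bd) andbT; have /andP[] := cell_inf_bd Phi_bd (counts k (xi w)) M0.
Qed.

Lemma mean_cell_inf_cvg :
  mean P (fun w => cell_inf Phi (counts k (xi w))) @[k --> \oo] --> mean P (fun w => Phi (xi w)).
Proof.
have mG k : measurable_fun setT (fun w => (cell_inf Phi (counts k (xi w)))%:E).
  exact/measurable_EFinP/measurable_counts.
have mPhi : measurable_fun setT (fun w => (Phi (xi w))%:E).
  exact/measurable_EFinP/measurable_functional.
have GPhi : {ae P, forall w, [set: T] w ->
    (cell_inf Phi (counts k (xi w)))%:E @[k --> \oo] --> (Phi (xi w))%:E}.
  by apply: aeW => w _; apply: cvg_EFin; [exact: nearW|exact: cell_inf_cvg].
have IM : P.-integrable setT (fun=> M%:E) by exact: finite_measure_integrable_cst.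
have GM : {ae P, forall w k, [set: T] w -> (`|(cell_inf Phi (counts k (xi w)))%:E| <= M%:E)%E}.
  apply: aeW => w k _; have /andP[g0 gM] := cell_inf_bd Phi_bd (counts k (xi w)) M0.
  by rewrite gee0_abs lee_fin.
have [_ _ H] := dominated_convergence measurableT mG mPhi GPhi IM GM.
by apply: fine_cvg; rewrite -meanE //; exact: integrable_functional.
Qed.

(** Outside the event that some cell is crowded, the counts are determined by
    the occupied cells. *)
Lemma mean_cell_inf_pattern k :
  `|mean P (fun w => cell_inf Phi (counts k (xi w))) -
    \sum_(o : {ffun 'I_(ncells k) -> bool}) cell_inf Phi (simple_counts o) * fine (P (pattern k (empty_cells o) (full_cells o)))|
  <= M * \sum_(i < ncells k) fine (P (crowd k i)).
Proof.
have I1 := integrable_cell_inf k.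
have mo (o : {ffun 'I_(ncells k) -> bool}) : measurable [set w | occupied k (xi w) = o].
  by rewrite occupied_pattern; exact: measurable_pattern.
have G0 (o : {ffun 'I_(ncells k) -> bool}) : 0 <= cell_inf Phi (simple_counts o) <= M.
  exact: cell_inf_bd.
have Io (o : {ffun 'I_(ncells k) -> bool}) : ge0_integrable P (fun w => cell_inf Phi (simple_counts o) * \1_[set w | occupied k (xi w) = o] w)
  /\ mean P (fun w => cell_inf Phi (simple_counts o) * \1_[set w | occupied k (xi w) = o] w) =
    cell_inf Phi (simple_counts o) * fine (P (pattern k (empty_cells o) (full_cells o))).
  have /andP[g0 _] := G0 o; have [J1 J2] := mean_indic P (mo o).
  by rewrite -occupied_pattern -J2; exact: meanZ.
have [I2 E2] := @mean_sum _ _ _ P _ (index_enum {ffun 'I_(ncells k) -> bool}) xpredT _ (fun o _ => (Io o).1).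
have Ic (i : nat) : ge0_integrable P (\1_(crowd k i) : T -> R) /\ mean P (\1_(crowd k i)) = fine (P (crowd k i)).
  by apply: mean_indic; exact: measurable_crowd.
have [I3 E3] := @mean_sum _ _ _ P _ (index_enum 'I_(ncells k)) xpredT _ (fun i _ => (Ic i).1).
have [I4 E4] := meanZ M0 I3.
rewrite (eq_bigr _ (fun o _ => esym (Io o).2)) -E2 (eq_bigr _ (fun (i : 'I_(ncells k)) _ => esym (Ic i).2)) -E3 -E4.
set f := fun w => cell_inf _ _; set g := fun w => \sum_o _; set c := fun w => M * _.
have gE w : g w = cell_inf Phi (simple_counts (occupied k (xi w))).
  rewrite /g (bigD1 (occupied k (xi w))) //= indicE mem_set // mulr1.
  by rewrite big1 ?addr0 // => t tw; rewrite indicE memNset ?mulr0 // => /= E; rewrite E eqxx in tw.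
have near w : f w <= g w + c w /\ g w <= f w + c w.
  rewrite gE /f; have [[i iw]|none] := pselect (exists i : 'I_(ncells k), crowd k i w).
    have c1 : M <= c w.
      rewrite /c -[leLHS]mulr1 ler_wpM2l // (bigD1 i) //= indicE mem_set // lerDl.
      by apply: sumr_ge0 => j _; rewrite indicE.
    have /andP[a1 a2] := cell_inf_bd Phi_bd (counts k (xi w)) M0.
    have /andP[b1 b2] := G0 (occupied k (xi w)).
    by split; [apply: le_trans a2 _|apply: le_trans b2 _]; apply: le_trans c1 _; rewrite lerDr.
  rewrite -counts_simple.
    by rewrite lerDl mulr_ge0 // sumr_ge0 // => j _; rewrite indicE.
  by move=> i; rewrite ltNge; apply/negP => h; apply: none; exists i.
have [J1 F1] := meanD I2 I4; have [J2 F2] := meanD I1 I4.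
have [_ f0 _] := I1; have [_ g0 _] := I2; have [mf _ _] := I1; have [mg _ _] := I2.
have [|_ A1] := mean_le mf _ J1; first by move=> w; rewrite f0 /=; exact: (near w).1.
have [|_ A2] := mean_le mg _ J2; first by move=> w; rewrite g0 /=; exact: (near w).2.
by rewrite F1 in A1; rewrite F2 in A2; rewrite distrC; exact: dist_le_of.
Qed.

End CountingLaw.

(** * Weak convergence from avoidance probabilities *)

Section Limit.
Context {R : realType}.
Variables (d : nat -> measure_display) (Om : forall n, measurableType (d n)).
Variables (P : forall n, probability (Om n) R) (xi : forall n, Om n -> point_measure R).
Variables (d' : measure_display) (Om' : measurableType d') (Q : probability Om' R).
Variable eta : Om' -> point_measure R.
Hypothesis mxi : forall n x y, x < y ->
  measurable_fun setT (fun w => npoints (@xi n w) `[x, y[%classic).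
Hypothesis meta : forall x y, x < y ->
  measurable_fun setT (fun w => npoints (eta w) `[x, y[%classic).
Variable theta : R.
Hypothesis avoid_cvg : forall k (Z : seq nat), uniq Z ->
  fine (P n (pattern (@xi n) k Z [::])) @[n --> \oo] --> fine (Q (pattern eta k Z [::])).
Hypothesis crowd_xi : forall k, exists2 D : nat -> nat -> R,
  forall n i, fine (P n (crowd (@xi n) k i)) <= D n i &
  exists2 l, forall i, D n i @[n --> \oo] --> l & l <= (theta * mesh k) ^+ 2.
Hypothesis crowd_eta : forall k i, fine (Q (crowd eta k i)) <= (theta * mesh k) ^+ 2.

(** Inclusion-exclusion, one occupied cell at a time. *)
Lemma pattern_cvg k B Z : uniq (Z ++ B) ->
  fine (P n (pattern (@xi n) k Z B)) @[n --> \oo] --> fine (Q (pattern eta k Z B)).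
Proof.
elim: B Z => [|i B IH] Z; first by rewrite cats0; exact: avoid_cvg.
rewrite (uniq_catCA Z [:: i] B).
rewrite /= mem_cat negb_or => /andP[/andP[iZ iB] uZB'].
rewrite (pattern_cons Q meta k iZ iB).
under eq_fun do rewrite (pattern_cons (P _) (@mxi _) k iZ iB).
by apply: cvgB; [exact: IH|apply: IH; rewrite /= mem_cat negb_or iZ iB].
Qed.

Section SemiContinuity.
Variables (Phi : point_measure R -> R) (M : R).
Hypothesis Phi_bd : forall mu, 0 <= Phi mu <= M.
Hypothesis M0 : 0 <= M.
Hypothesis cPhi : continuous Phi.

Let sum_cvg (I : Type) (r : seq I) (u : I -> nat -> R) (l : I -> R) :
  (forall i, u i n @[n --> \oo] --> l i) ->
  \sum_(i <- r) u i n @[n --> \oo] --> \sum_(i <- r) l i.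
Proof.
move=> H; elim: r => [|i r IH].
  by under eq_fun do rewrite big_nil; rewrite big_nil; exact: cvg_cst.
by under eq_fun do rewrite big_cons; rewrite big_cons; apply: cvgD.
Qed.

Lemma crowd_budget k : (ncells k)%:R * (theta * mesh k) ^+ 2 = 2 * theta ^+ 2 / k.+1%:R ^+ 2.
Proof.
rewrite /ncells /mesh natrM natrX; have : k.+1%:R != 0 :> R by rewrite pnatr_eq0.
by move: (k.+1%:R : R) => x x0; field.
Qed.

(** On a fixed fine grid, Phi is bounded below by its infimum given the counts,
    whose mean is up to crowded cells a function of the law of the set of occupied
    cells, and this law converges. The five errors e / 5 are: the infimum against
    Phi for eta, crowded cells for eta, the law of the occupied cells, and two for
    the crowded cells of xi n, whose probabilities are bounded in the limit only. *)
Lemma mean_lower_semicontinuous e : 0 < e -> \forall n \near \oo,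
  mean Q (fun w => Phi (eta w)) - e <= mean (P n) (fun w => Phi (@xi n w)).
Proof.
move=> e0; have e5 : 0 < e / 5 by rewrite divr_gt0.
have A0 : 2 * M * theta ^+ 2 / k.+1%:R @[k --> \oo] --> (0 : R).
  rewrite -[X in _ --> X](mulr0 (2 * M * theta ^+ 2)).
  by apply: cvgM; [exact: cvg_cst|exact: cvg_harmonic].
have /cvgrPdist_le /(_ _ e5) H1 := mean_cell_inf_cvg meta Phi_bd M0 cPhi (P := Q).
have /cvgrPdist_le /(_ _ e5) H2 := A0.
have [k [{}H1 {}H2]] := filter_ex (filterI H1 H2).
have budget : M * ((ncells k)%:R * (theta * mesh k) ^+ 2) <= e / 5.
  rewrite crowd_budget; apply: le_trans H2; rewrite sub0r normrN.
  apply: le_trans (ler_norm _); rewrite mulrA (mulrCA M) (mulrA 2).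
  have c0 : 0 <= 2 * M * theta ^+ 2 by apply: mulr_ge0; [exact: mulr_ge0|exact: sqr_ge0].
  apply: ler_wpM2l => //; rewrite lef_pV2 ?posrE ?exprn_gt0 //.
  by rewrite expr2 ler_peMr // ler1n.
pose S (p : {ffun 'I_(ncells k) -> bool} -> R) := \sum_(o : {ffun 'I_(ncells k) -> bool})
  cell_inf Phi (simple_counts o) * p o.
have cvgS : S (fun o => fine (P n (pattern (@xi n) k (empty_cells o) (full_cells o)))) @[n --> \oo]
   --> S (fun o => fine (Q (pattern eta k (empty_cells o) (full_cells o)))).
  apply: sum_cvg => o; apply: cvgM; first exact: cvg_cst.
  apply: pattern_cvg; rewrite /empty_cells /full_cells -map_cat map_inj_uniq; last exact: val_inj.
  rewrite (perm_uniq (_ : perm_eq _ (enum 'I_(ncells k)))) ?enum_uniq //.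
  by rewrite perm_catC perm_filterC.
have [D Dle [l Dl lle]] := crowd_xi k.
have cvgD : M * \sum_(i <- index_enum 'I_(ncells k)) D n i @[n --> \oo] -->
    M * ((ncells k)%:R * l).
  apply: cvgM; first exact: cvg_cst.
  have -> : (ncells k)%:R * l = \sum_(i <- index_enum 'I_(ncells k)) l.
    by rewrite sumr_const card_ord mulr_natl.
  by apply: sum_cvg => i; exact: Dl.
move/cvgrPdist_le : cvgS => /(_ _ e5) H3; move/cvgrPdist_le : cvgD => /(_ _ e5) H4.
apply: filterS (filterI H3 H4) => n [{}H3 {}H4].
have B1 := mean_cell_inf_pattern Q meta Phi_bd M0 k.
have B2 := mean_cell_inf_pattern (P n) (@mxi n) Phi_bd M0 k.
have B3 := mean_cell_inf_le (P n) (@mxi n) Phi_bd M0 cPhi k.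
have C1 : M * \sum_(i < ncells k) fine (Q (crowd eta k i)) <= e / 5.
  apply: le_trans budget; rewrite ler_wpM2l //.
  apply: le_trans (ler_sum _ (fun (i : 'I_(ncells k)) _ => crowd_eta k i)) _.
  by rewrite sumr_const card_ord mulr_natl.
have C2 : M * \sum_(i < ncells k) fine (P n (crowd (@xi n) k i)) <=
    M * \sum_(i <- index_enum 'I_(ncells k)) D n i.
  by rewrite ler_wpM2l //; apply: ler_sum => i _; exact: Dle.
have C3 : M * ((ncells k)%:R * l) <= e / 5.
  by apply: le_trans budget; rewrite ler_wpM2l // ler_wpM2l.
rewrite -/(S (fun o => fine (Q (pattern eta k (empty_cells o) (full_cells o))))) in B1.
rewrite -/(S (fun o => fine (P n (pattern (@xi n) k (empty_cells o) (full_cells o))))) in B2.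
move: H1 H3 H4 B1 B2 B3 C1 C2 C3 => /=.
set x1 := mean Q _; set x2 := mean Q _; set x3 := mean (P n) _; set x4 := mean (P n) _.
set y1 := S _; set y2 := S _; set z1 := M * _; set z2 := M * _; set z3 := M * _; set z4 := M * _.
clearbody x1 x2 x3 x4 y1 y2 z1 z2 z3 z4.
rewrite !ler_norml => /andP[a1 a2] /andP[b1 b2] /andP[c1 c2] /andP[d1 d2] /andP[f1 f2] g1 g2 g3 g4.
lra.
Qed.

End SemiContinuity.

(** Expectations of signed functions, through the mean of a nonnegative one. *)
Lemma mean_shift d0 (T : measurableType d0) (P0 : probability T R) (f : T -> R) M :
  ge0_integrable P0 (fun w => f w + M) ->
  'E_P0[f]%E = (mean P0 (fun w => f w + M) - M)%:E.
Proof.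
move=> I1; have [mf f0 fi] := I1.
have I2 : P0.-integrable setT (EFin \o (fun w => f w + M)).
  apply/integrableP; split; first exact/measurable_EFinP.
  by under eq_integral do rewrite gee0_abs ?lee_fin //.
have I3 : P0.-integrable setT (EFin \o (fun=> M)) by exact: finite_measure_integrable_cst.
rewrite unlock EFinB -meanE //; have := integralB_EFin measurableT I2 I3.
under eq_integral do rewrite -EFinB addrK.
move=> ->; congr (_ - _)%E; rewrite integral_cst // -[RHS]mule1; congr (_ * _)%E.
exact: probability_setT.
Qed.

(** Lower semicontinuity for Phi + M and for M - Phi. *)
Lemma grid_weak_cvg : weak_cvg P xi Q eta.
Proof.
move=> Phi cPhi [M PhiM].
have M0 : 0 <= M by apply: le_trans (PhiM (atomic_measure [::])).
have bd1 mu : 0 <= Phi mu + M <= M + M.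
  by have := PhiM mu; rewrite ler_norml => /andP[]; lra.
have bd2 mu : 0 <= M - Phi mu <= M + M.
  by have := PhiM mu; rewrite ler_norml => /andP[]; lra.
have MM : 0 <= M + M by rewrite addr_ge0.
have c1 : continuous (fun mu => Phi mu + M).
  by move=> mu; exact: (cvgD (cPhi mu) (cvg_cst M)).
have c2 : continuous (fun mu => M - Phi mu).
  by move=> mu; exact: (cvgB (cvg_cst M) (cPhi mu)).
have mirror d0 (T : measurableType d0) (P0 : probability T R) (z : T -> point_measure R) :
    (forall x y, x < y -> measurable_fun setT (fun w => npoints (z w) `[x, y[%classic)) ->
    ge0_integrable P0 (fun w => Phi (z w) + M) /\
    mean P0 (fun w => M - Phi (z w)) = M + M - mean P0 (fun w => Phi (z w) + M).
  move=> mz; have I1 := integrable_functional P0 mz bd1 MM c1.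
  have I2 := integrable_functional P0 mz bd2 MM c2.
  split => //; have [_ E3] := meanD I1 I2; have [_ E4] := mean_cst P0 MM.
  by rewrite -[X in X - _]E4 (_ : (fun=> M + M) = (fun w => Phi (z w) + M + (M - Phi (z w))));
    [rewrite E3 addrC addrA addNr add0r | apply/funext => w; ring].
have [IQ EQ] := mirror _ _ Q _ meta.
rewrite (mean_shift IQ).
under eq_fun do rewrite (mean_shift (mirror _ _ (P _) _ (@mxi _)).1).
apply: cvg_EFin; first exact: nearW.
rewrite /=; apply: cvgB; last exact: cvg_cst.
apply/cvgrPdist_le => e e0.
have L1 := mean_lower_semicontinuous bd1 MM c1 e0.
have L2 := mean_lower_semicontinuous bd2 MM c2 e0.
apply: filterS (filterI L1 L2) => n [/= h1 h2].
rewrite EQ (mirror _ _ (P n) _ (@mxi n)).2 in h2.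
by rewrite ler_norml; apply/andP; split; lra.
Qed.

End Limit.
(** * Poisson processes on a grid *)

Section PoissonGrid.
Context {R : realType}.

Lemma exp_defect (x : R) : 0 <= x -> x - 1 + expR (- x) <= x ^+ 2.
Proof.
move=> x0; have [x1|x1] := leP x 1.
  have := @expRN_taylor R x; rewrite x0 x1 => /(_ isT).
  by rewrite ler_norml => /andP[h _]; lra.
have e1 : expR (- x) <= 1 by rewrite expR_le1; lra.
have : x <= x ^+ 2 by rewrite expr2 ler_peMr // ltW.
lra.
Qed.

Lemma atomic_points (s : seq R) x y :
  atomic_measure s `[x, y[%classic = (linstat (\1_(`[x, y[ : set R)) s)%:E.
Proof.
rewrite /atomic_measure /= atomsE /linstat; elim: s => [|p s IH]; first by rewrite !big_nil.
by rewrite !big_cons IH diracE indicE EFinD.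
Qed.

Definition cell_bounds k (Z : seq nat) : seq (R * R) := [seq (node k i, node k i.+1) | i <- Z].

Lemma cell_bounds_intervals k Z : intervals (cell_bounds k Z).
Proof. by rewrite /intervals all_map; apply/allP => i _; exact: node_lt. Qed.

Lemma union_cells_sqr k Z x : uniq Z ->
  union_indic (cell_bounds k Z) x ^+ 2 = union_indic (cell_bounds k Z) x.
Proof.
move=> uZ; rewrite /union_indic big_map /=.
have [[i iZ ix]|none] := pselect (exists2 i, i \in Z & cell k i x); last first.
  rewrite big1_seq ?expr0n // => i /= iZ.
  by rewrite indicE memNset // => ix; apply: none; exists i.
rewrite (bigD1_seq i) //= big1 ?addr0; last first.
  move=> j ji; rewrite indicE memNset // => jx.
  by rewrite (cell_uniq jx ix) eqxx in ji.
by rewrite indicE mem_set // expr1n.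
Qed.

Definition cells_union k (Z : seq nat) : set R := \big[setU/set0]_(i <- Z) cell k i.

Lemma cells_unionP k Z x : cells_union k Z x <-> exists2 i, i \in Z & cell k i x.
Proof.
rewrite /cells_union; elim: Z => [|i Z IH]; first by rewrite big_nil; split => // -[].
rewrite big_cons; split => [[ix|/IH [j jZ jx]]|[j]].
- by exists i => //; rewrite mem_head.
- by exists j => //; rewrite inE jZ orbT.
- by rewrite inE => /orP[/eqP ->|jZ jx]; [left|right; apply/IH; exists j].
Qed.

Lemma measurable_cells_union k Z : measurable (cells_union k Z : set (measurableTypeR R)).
Proof. by apply: bigsetU_measurable => i _; exact: measurable_cell. Qed.

Lemma lebesgue_cell k i : lebesgue_measure (cell k i) = (mesh k)%:E :> \bar R.
Proof.
rewrite /cell lebesgue_measure_itv /= lte_fin node_lt nodeS.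
by rewrite -EFinB [_ + mesh k]addrC addrK.
Qed.

Lemma lebesgue_cells_union k Z : uniq Z ->
  lebesgue_measure (cells_union k Z) = ((size Z)%:R * mesh k)%:E :> \bar R.
Proof.
elim: Z => [_|i Z IH /= /andP[iZ uZ]]; first by rewrite /cells_union big_nil measure0 mul0r.
rewrite /cells_union big_cons -/(cells_union k Z).
have E : (lebesgue_measure (cell k i `|` cells_union k Z) =
    lebesgue_measure (cell k i) + lebesgue_measure (cells_union k Z) :> \bar R)%E.
  apply: measureU; [exact: measurable_cell|exact: measurable_cells_union|].
  apply/seteqP; split => x //= [ix /cells_unionP [j jZ jx]].
  by rewrite (cell_uniq ix jx) jZ in iZ.
rewrite E IH // lebesgue_cell -EFinD -natr1; congr EFin; ring.
Qed.

Lemma npoints_eq0 (mu : point_measure R) k i : npoints mu (cell k i) = 0 <-> mu (cell k i) = 0%E.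
Proof.
rewrite /npoints; split => [h|->//].
by rewrite -[LHS]fineK ?h // ge0_fin_numE ?measure_ge0 // itv_finite.
Qed.

Lemma empty_union (mu : point_measure R) k Z :
  (forall i, i \in Z -> npoints mu (cell k i) = 0) <-> mu (cells_union k Z) = 0%E.
Proof.
split=> [|h i iZ].
  rewrite /cells_union; elim: Z => [_|i Z IH H]; first by rewrite big_nil measure0.
  have h0 : mu (cell k i) = 0%E by apply/npoints_eq0; apply: H; rewrite mem_head.
  have hZ : mu (cells_union k Z) = 0%E.
    by apply: IH => j jZ; apply: H; rewrite inE jZ orbT.
  have : (mu (cell k i `|` cells_union k Z) <= mu (cell k i) + mu (cells_union k Z))%E.
    by apply: measureU2; [exact: measurable_cell|exact: measurable_cells_union].
  rewrite h0 hZ adde0 big_cons => h; apply/eqP; rewrite eq_le measure_ge0 andbT.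
  exact: h.
apply/npoints_eq0/eqP; rewrite eq_le measure_ge0 andbT -h.
apply: le_measure; rewrite ?inE; [exact: measurable_cell|exact: measurable_cells_union|].
by move=> x ix; apply/cells_unionP; exists i.
Qed.

Lemma poisson_prob0 (r : R) : 0 <= r -> poisson_prob r 0 [set 0%N] = (expR (- r))%:E.
Proof.
rewrite le_eqVlt /poisson_prob => /orP[/eqP <-|r0].
  by rewrite ltxx oppr0 expR0 diracE mem_set.
by rewrite r0 esum_set1 ?lee_fin ?poisson_pmf_ge0 // /poisson_pmf r0 expr0 mul1r invr1 mul1r.
Qed.

Lemma poisson_prob1 (r : R) : 0 < r -> poisson_prob r 0 [set 1%N] = (r * expR (- r))%:E.
Proof.
move=> r0; rewrite /poisson_prob r0 esum_set1 ?lee_fin ?poisson_pmf_ge0 //.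
by rewrite /poisson_pmf r0 expr1 invr1 mulr1.
Qed.

Variables (d : measure_display) (T : measurableType d) (Q : probability T R).
Variables (eta : T -> point_measure R) (theta : R).
Hypothesis theta0 : 0 < theta.
Hypothesis eta_poisson : homogeneous_poisson_process Q eta theta.

Lemma measurable_npoints_poisson x y :
  measurable_fun setT (fun w => npoints (eta w) `[x, y[%classic).
Proof.
have [meta _ _] := eta_poisson.
apply: (measurableT_comp (fine_measurable measurableT)); apply: meta; exact: measurable_itv.
Qed.

Lemma poisson_avoidance k Z : uniq Z ->
  fine (Q (pattern eta k Z [::])) = expR (- (theta * ((size Z)%:R * mesh k))).
Proof.
move=> uZ; have [_ law _] := eta_poisson.
have := law _ (measurable_cells_union k Z).
rewrite lebesgue_cells_union // -EFinM /= => /(_ (ltry _) 0%N).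
rewrite poisson_prob0; last first.
  by rewrite mulr_ge0 ?(ltW theta0) // mulr_ge0 // ltW // mesh_gt0.
rewrite (_ : pattern eta k Z [::] = [set w | eta w (cells_union k Z) = 0%:R%:E]).
  by move=> ->.
apply/seteqP; split => w.
  by move=> [h _]; apply/empty_union.
by move=> /= h; split => //; apply/empty_union.
Qed.

(** 1 - exp (- x) - x exp (- x) <= x ^ 2. *)
Lemma poisson_crowd k i : fine (Q (crowd eta k i)) <= (theta * mesh k) ^+ 2.
Proof.
have x0 : 0 < theta * mesh k by rewrite mulr_gt0 // mesh_gt0.
have mN := measurable_npoints_poisson (node k i) (node k i.+1).
have m0 : measurable [set w | npoints (eta w) (cell k i) = 0].
  by have := mN measurableT [set 0] (measurable_set1 0); rewrite setTI.
have m1 : measurable [set w | npoints (eta w) (cell k i) = 1].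
  by have := mN measurableT [set 1] (measurable_set1 1); rewrite setTI.
have m2 : measurable (crowd eta k i).
  by apply: measurable_crowd => *; exact: measurable_npoints_poisson.
have law c : Q [set w | npoints (eta w) (cell k i) = c%:R] = poisson_prob (theta * mesh k) 0 [set c].
  have [_ law _] := eta_poisson.
  have := law _ (measurable_cell k i).
  rewrite lebesgue_cell -EFinM.
  move=> /(_ (ltry _) c) <-; congr (Q _); apply/seteqP; split => w /=.
    move=> h; rewrite -h /npoints fineK // ge0_fin_numE ?measure_ge0 //.
    exact: itv_finite.
  by rewrite /npoints => ->.
have L0 := law 0%N; have L1 := law 1%N.
rewrite poisson_prob0 ?(ltW x0) // in L0; rewrite poisson_prob1 // in L1.
have [I0 F0] := mean_indic Q m0; have [I1 F1] := mean_indic Q m1.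
have [I2 F2] := mean_indic Q m2; have [I3 F3] := meanD I0 I1; have [I4 F4] := meanD I3 I2.
have [J1 G1] := mean_cst Q (@ler01 R).
have [||_ H] := @mean_le _ _ _ Q (fun w => \1_[set w | npoints (eta w) (cell k i) = 0] w +
   \1_[set w | npoints (eta w) (cell k i) = 1] w + \1_(crowd eta k i) w) _ _ _ J1.
- apply: measurable_funD; last exact: measurable_indic.
  by apply: measurable_funD; exact: measurable_indic.
- move=> w; rewrite !addr_ge0 ?indicE //=.
  have E (A : set T) (b : bool) : (A w <-> b) -> (w \in A) = b.
    by move=> h; apply/idP/idP; rewrite inE => /h.
  have [c cE] := npoints_nat (eta w) (node k i) (node k i.+1).
  rewrite (E [set w | npoints (eta w) (cell k i) = 0] (c == 0%N)); last first.
    by rewrite /= /cell cE; split => [/eqP|/eqP ->//]; rewrite pnatr_eq0.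
  rewrite (E [set w | npoints (eta w) (cell k i) = 1] (c == 1%N)); last first.
    by rewrite /= /cell cE; split => [/eqP|/eqP ->//]; rewrite (eqr_nat R c 1).
  rewrite (E (crowd eta k i) (2 <= c)%N); last by rewrite /crowd /= /cell cE ler_nat.
  by case: c {cE} => [|[|c]] /=; lra.
move: H; rewrite F4 F3 F0 F1 F2 G1 L0 L1 /=.
have := expR_ge1Dx (- (theta * mesh k)).
move: (theta * mesh k) (fine _) x0 => x q x0 h1 h2.
have : (1 - x) * (1 + x) <= expR (- x) * (1 + x) by rewrite ler_wpM2r //; lra.
by rewrite expr2; lra.
Qed.

End PoissonGrid.

(** * Rescaled spectra on a grid *)

Section RescaledSpectra.
Context {R : realType}.
Variables (d : nat -> measure_display) (Om : forall n, measurableType (d n)).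
Variables (P : forall n, probability (Om n) R) (E theta : R).
Variable sn : forall n, Om n -> seq R.
Hypothesis size_sn : forall n w, size (@sn n w) = n.
Hypothesis theta0 : 0 < theta.
Hypothesis msn : forall n x y, x < y -> measurable_fun setT
  (fun w => linstat (\1_(`[x, y[ : set R)) (rescale n E (@sn n w))).
Hypothesis density : forall x y, x < y ->
  (\int[P n]_w (linstat (\1_(`[x, y[ : set R)) (rescale n E (@sn n w)))%:E)%E
    @[n --> \oo] --> (theta * (y - x))%:E.
Hypothesis avoidance : forall V e, intervals V ->
  (forall x, union_indic V x ^+ 2 = union_indic V x) -> 0 < e ->
  exists n0, forall n, (n0 <= n)%N -> (0 < n)%N ->
  `|fine (P n [set w | linstat (union_indic V) (rescale n E (@sn n w)) = 0]) -
    expR (- mean (P n) (fun w => linstat (union_indic V) (rescale n E (@sn n w))))| <= e.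
Let xi n (w : Om n) := rescaled_process E n (@sn n w).

Lemma npoints_rescaled n w x y :
  npoints (@xi n w) `[x, y[%classic = linstat (\1_(`[x, y[ : set R)) (rescale n E (@sn n w)).
Proof. by rewrite /npoints /xi /rescaled_process atomic_points. Qed.

Lemma measurable_npoints_rescaled n x y : x < y ->
  measurable_fun setT (fun w => npoints (@xi n w) `[x, y[%classic).
Proof. by move=> xy; under eq_fun do rewrite npoints_rescaled; exact: msn. Qed.

Lemma integrable_npoints n x y : x < y -> ge0_integrable (P n)
  (fun w => linstat (\1_(`[x, y[ : set R)) (rescale n E (@sn n w))).
Proof.
move=> xy; have [I1 _] := mean_cst (P n) (ler0n R n).
have [] // := mean_le (@msn n x y xy) _ I1.
move=> w; rewrite linstat_ge0 /=; last by move=> z; rewrite indicE.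
apply: (@le_trans _ _ (linstat (fun=> 1) (rescale n E (sn w)))).
  by apply: le_linstat => z; rewrite indicE; case: (_ \in _).
by rewrite /linstat big_const_seq count_predT iter_addr_0 size_map size_sn.
Qed.

Lemma mean_npoints_cvg x y : x < y ->
  mean (P n) (fun w => linstat (\1_(`[x, y[ : set R)) (rescale n E (@sn n w)))
    @[n --> \oo] --> theta * (y - x).
Proof. by move=> xy; apply: fine_cvg; exact: density. Qed.

Lemma pattern_union n k Z : pattern (@xi n) k Z [::] =
  [set w | linstat (union_indic (cell_bounds k Z)) (rescale n E (@sn n w)) = 0].
Proof.
have LE w : linstat (union_indic (cell_bounds k Z)) (rescale n E (@sn n w)) =
    \sum_(i <- Z) npoints (@xi n w) (cell k i).
  by rewrite linstat_union big_map; apply: eq_bigr => i _; rewrite npoints_rescaled.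
apply/seteqP; split => w /=; rewrite LE.
  by move=> [h _]; rewrite big1_seq // => i /= iZ; exact: h.
move=> /eqP; rewrite psumr_eq0; last by move=> i _; exact: npoints_ge0.
by move=> /allP h; split => // i iZ; apply/eqP/(h i iZ).
Qed.

Lemma spectra_avoidance k Z : uniq Z ->
  fine (P n (pattern (@xi n) k Z [::])) @[n --> \oo] -->
  expR (- (theta * ((size Z)%:R * mesh k))).
Proof.
move=> uZ; pose V : seq (R * R) := cell_bounds k Z.
have mean_cvg : mean (P n) (fun w => linstat (union_indic V) (rescale n E (@sn n w)))
    @[n --> \oo] --> theta * ((size Z)%:R * mesh k).
  have -> : theta * ((size Z)%:R * mesh k) = \sum_(i <- Z) theta * (node k i.+1 - node k i).
    rewrite (eq_bigr (fun=> theta * mesh k)).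
      by rewrite big_const_seq count_predT iter_addr_0 -[RHS]mulr_natl mulrCA.
    by move=> i _; rewrite nodeS [_ + mesh k]addrC addrK.
  have ME n : mean (P n) (fun w => linstat (union_indic V) (rescale n E (@sn n w))) =
      \sum_(i <- Z) mean (P n) (fun w => linstat (\1_(`[node k i, node k i.+1[ : set R)) (rescale n E (@sn n w))).
    rewrite -(@mean_sum _ _ _ (P n) _ Z xpredT _ (fun i _ => integrable_npoints n (node_lt k i))).2.
    by congr mean; apply/funext => w; rewrite linstat_union big_map.
  under eq_fun do rewrite ME.
  have S (r : seq nat) : \sum_(i <- r) mean (P n) (fun w =>
      linstat (\1_(`[node k i, node k i.+1[ : set R)) (rescale n E (@sn n w)))
      @[n --> \oo] --> \sum_(i <- r) theta * (node k i.+1 - node k i).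
    elim: r => [|i r IH].
      by under eq_fun do rewrite big_nil; rewrite big_nil; exact: cvg_cst.
    under eq_fun do rewrite big_cons; rewrite big_cons; apply: cvgD => //.
    exact: mean_npoints_cvg (node_lt k i).
  exact: S.
have exp_cvg : expR (- mean (P n) (fun w => linstat (union_indic V) (rescale n E (@sn n w))))
    @[n --> \oo] --> expR (- (theta * ((size Z)%:R * mesh k))).
  exact: (cvg_comp _ _ (cvgN mean_cvg) (@continuous_expR R _)).
apply/cvgrPdist_le => e e0; have e2 : 0 < e / 2 by rewrite divr_gt0.
have [n0 H] := avoidance (cell_bounds_intervals k Z) (fun x => union_cells_sqr k x uZ) e2.
move/cvgrPdist_le : exp_cvg => /(_ _ e2) H2.
have H3 : \forall n \near \oo, (maxn n0 1 <= n)%N by exact: nbhs_infty_ge.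
apply: filterS (filterI H2 H3) => n [/= h2]; rewrite geq_max => /andP[h3 h4].
have h1 := H n h3 h4; rewrite pattern_union -/V.
rewrite distrC in h1; apply: le_trans (ler_distD _ _ _) _.
by apply: le_trans (lerD h2 h1) _; rewrite -splitr.
Qed.

(** If N is the number of points in a cell, P (N >= 2) <= E N - P (N > 0), whose
    limit x - (1 - exp (- x)), x = theta * mesh k, is at most x ^ 2. *)
Lemma spectra_crowd k : exists2 D : nat -> nat -> R,
  forall n i, fine (P n (crowd (@xi n) k i)) <= D n i &
  exists2 l, forall i, D n i @[n --> \oo] --> l & l <= (theta * mesh k) ^+ 2.
Proof.
pose mN n i := mean (P n) (fun w => linstat (\1_(`[node k i, node k i.+1[ : set R)) (rescale n E (@sn n w))).
exists (fun n i => mN n i - 1 + fine (P n (pattern (@xi n) k [:: i] [::]))) => [n i|]; last first.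
  exists (theta * mesh k - 1 + expR (- (theta * mesh k))); last first.
    by apply: exp_defect; rewrite mulr_ge0 ?(ltW theta0) // ltW // mesh_gt0.
  move=> i; apply: cvgD; last first.
    by have := @spectra_avoidance k [:: i] isT; rewrite /= mul1r.
  apply: cvgB; last exact: cvg_cst.
  rewrite (_ : mesh k = node k i.+1 - node k i).
    exact: mean_npoints_cvg (node_lt k i).
  by rewrite nodeS addrC addKr.
have mx x y : x < y -> measurable_fun setT (fun w => npoints (@xi n w) `[x, y[%classic).
  exact: measurable_npoints_rescaled.
have [I0 F0] := mean_indic (P n) (measurable_pattern mx k [:: i] [::]).
have [I1 F1] := mean_indic (P n) (measurable_crowd mx k i).
have [J1 G1] := mean_cst (P n) (@ler01 R).
have IN := integrable_npoints n (node_lt k i).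
have [I2 F2] := meanD I1 J1; have [I3 F3] := meanD IN I0.
have [mI2 I20 _] := I2.
have [|_ H] := mean_le mI2 _ I3.
  move=> w; rewrite I20 /= !indicE -npoints_rescaled.
  have [c cE] := npoints_nat (@xi n w) (node k i) (node k i.+1).
  have -> : (w \in crowd (@xi n) k i) = (2 <= c)%N.
    by apply/idP/idP; rewrite inE /crowd /= /cell cE ler_nat.
  have -> : (w \in pattern (@xi n) k [:: i] [::]) = (c == 0%N).
    apply/idP/eqP; rewrite inE /pattern /=.
      by move=> [/(_ i (mem_head _ _))]; rewrite /cell cE => /eqP; rewrite pnatr_eq0 => /eqP.
    by move=> c0; split => // j; rewrite inE => /eqP ->; rewrite /cell cE c0.
  by rewrite cE -[X in _ + X <= _]/(1%:R) -!natrD ler_nat; case: c {cE} => [|[|c]].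
rewrite F2 F3 F0 F1 G1 -/(mN n i) in H.
by rewrite addrAC lerBrDr.
Qed.

End RescaledSpectra.

(** * Convergence of the rescaled eigenvalues *)

Lemma bounded_itv_co (R : realType) (x y : R) : bounded_set [set` `[x, y[].
Proof.
exists (`|x| + `|y|); split; first exact: num_real.
move=> M xyM z /=; rewrite in_itv /= => /andP[xz zy].
have h1 := ler_norm y; have h2 := ler_norm (- x); rewrite normrN in h2.
have h3 := normr_ge0 x; have h4 := normr_ge0 y.
by rewrite ler_norml; apply/andP; split; lra.
Qed.
Theorem theorem2p2 (R : realType) (E : R)
  (d : nat -> measure_display) (Omega : forall n, measurableType (d n))
  (P : forall n, probability (Omega n) R)
  (a : forall n, 'I_n -> {RV (P n) >-> R})
  (b : forall n, 'I_n.-1 -> {RV (P n) >-> R})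
  (b_gt0 : forall n (i : 'I_n.-1) w, 0 < b n i w)
  (indep_ab : forall n, independent (P n)
    (fun (k : 'I_n + 'I_n.-1) w =>
      match k with inl i => a n i w | inr i => b n i w end))
  (lambda : forall n, Omega n -> n.-tuple R)
  (lambdaP : forall n w,
    eigenvalues_of (jacobi (a n ^~ w) (b n ^~ w)) (lambda n w))
  (M_A M_B T s M_s gamma_s delta_s theta : R)
  (hypA : forall n (i : 'I_n), exists2 rho : R -> R,
    has_density (P n) (a n i) rho &
    ('N[lebesgue_measure]_+oo[EFin \o rho] <= M_A%:E)%E)
  (T_gt1 : 1 < T)
  (hypB : forall n (i : 'I_n.-1),
    ('E_(P n)[fun w => (b n i w `^ T)%R] <= M_B%:E)%E)
  (s_gt0 : 0 < s) (s_lt1 : s < 1) (M_s_gt0 : 0 < M_s)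
  (gamma_s_gt0 : 0 < gamma_s) (delta_s_gt0 : 0 < delta_s)
  (hypG : forall n (u v y x : 'I_n) (z : R[i]),
    (u < v)%N -> (y == u) || (y == v) -> (u <= x <= v)%N ->
    0 < complex.Im z -> Normc.normc (z - real_complex R E) < delta_s ->
    ('E_(P n)[fun w => (Normc.normc
        (green (jacobi (a n ^~ w) (b n ^~ w)) u v z y x) `^ s)%R]
      <= (M_s * expR (- gamma_s * `|y%:R - x%:R|))%:E)%E)
  (theta_gt0 : 0 < theta)
  (xi : forall n, Omega n -> point_measure R)
  (xiE : forall n w, xi n w = rescaled_process E n (lambda n w))
  (hypL : forall I : interval R, bounded_set [set` I] ->
    (\int[P n]_w xi n w [set` I])%E @[n --> \oo] -->
      (theta%:E * lebesgue_measure [set` I])%E) :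
  forall (d' : measure_display) (Omega' : measurableType d')
    (Q : probability Omega' R) (eta : Omega' -> point_measure R),
    homogeneous_poisson_process Q eta theta ->
    weak_cvg P xi Q eta.
Proof.
move=> d' Omega' Q eta etaP.
pose sn n w : seq R := lambda n w.
have mX n (k : 'I_n + 'I_n.-1) : measurable_fun [set: Omega n]
    (fun w => match k with inl i => a n i w | inr i => b n i w end).
  by case: k => i; exact: measurable_funPT.
have M_A0 : 0 <= M_A.
  by have [rho /has_density_bounded_law H /H []] := hypA 1%N ord0.
have aC n (i : 'I_n) : bounded_law (P n) M_A (a n i).
  by have [rho /has_density_bounded_law H /H []] := hypA n i.
have momB n (i : 'I_n.-1) : (\int[P n]_w (b n i w `^ T)%:E <= M_B%:E)%E.
  by have := hypB n i; rewrite unlock.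
have decayG n (u v y x : 'I_n) (z : R[i]) : (u < v)%N -> (y == u) || (y == v) ->
    (u <= x <= v)%N -> 0 < complex.Im z -> Normc.normc (z - real_complex R E) < delta_s ->
    (\int[P n]_w (Normc.normc (green (jacobi (a n ^~ w) (b n ^~ w)) u v z y x) `^ s)%:E
      <= (M_s * expR (- gamma_s * `|y%:R - x%:R|))%:E)%E.
  by move=> uv yuv x1 z0 zE; have := hypG n u v y x z uv yuv x1 z0 zE; rewrite unlock.
have msn n x y : x < y -> measurable_fun setT
    (fun w => linstat (\1_(`[x, y[ : set R)) (rescale n E (sn n w))).
  (* There is no resolvent of size 0; the spectrum is then empty. *)
  case: n => [|n] xy.
    rewrite (_ : (fun w => _) = (fun=> 0)) //; apply/funext => w.
    by rewrite /linstat /sn tuple0 big_nil.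
  apply: measurable_indic_stat => // t h h0.
  exact: (measurable_full_kernel (@mX n.+1) E (lambdaP n.+1) (ltn0Sn n) t h0).
have density x y : x < y ->
    (\int[P n]_w (linstat (\1_(`[x, y[ : set R)) (rescale n E (sn n w)))%:E)%E
    @[n --> \oo] --> (theta * (y - x))%:E.
  move=> xy; have := hypL `[x, y[ (bounded_itv_co x y).
  rewrite lebesgue_measure_itv /= lte_fin xy -EFinB -EFinM.
  under eq_fun do (under eq_integral do rewrite xiE atomic_points).
  by [].
have avoid := avoidance_asymptotic mX indep_ab M_A0 aC b_gt0 s_gt0 s_lt1 T_gt1
  gamma_s_gt0 delta_s_gt0 M_s_gt0 momB decayG lambdaP.
have size_sn n w : size (sn n w) = n by exact: size_tuple.
have -> : xi = (fun n w => rescaled_process E n (sn n w)).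
  by apply: functional_extensionality_dep => n; apply/funext => w.
apply: (@grid_weak_cvg _ _ _ _ _ _ _ _ _ _ _ theta).
- exact: measurable_npoints_rescaled.
- by move=> x y _; exact: measurable_npoints_poisson etaP x y.
- move=> k Z uZ; rewrite (poisson_avoidance theta_gt0 etaP) //.
  exact: spectra_avoidance.
- exact: spectra_crowd.
- exact: poisson_crowd.
Qed.
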